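(* Let $0 < r < p < 2$ with $r \le 1$, and let $q$ be defined by $\frac1p+\frac1q=\frac1r$. There exist positive constants $c'(p,r), b_{p,r}, c_{p,r}$ depending only on $p,r$ such that the following holds. For any $\eta \in (0,1]$ and any natural number $n$ (with $\eta n$ a positive integer), let $W$ be the random $(1+\eta)n\times n$ matrix $$ W = \frac{1}{n^{1/q}} \left( \begin{array}{c} \mathrm{Id}_n \\ \tilde S \end{array} \right) : \ell_p^n \to \ell_r^{(1+ \eta) n}, \qquad \tilde S = \frac{c'(p,r)}{(\log(1+1/\eta))^{1/q}}\, S . $$ Then, with probability greater than $1 - 2 \exp (-b_{p,r}\eta n)$, for any $x \in \mathbb{R}^n$, $$ c_{p,r} \, \left( \frac{ \eta}{\log(1+ \frac{1}{\eta})} \right)^{1/q} |x|_p \le |W x|_r \le 3 \cdot 2^{1/r} |x|_p . $$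
   Context: For $s>0$, $|x|_s=(\sum_i|x_i|^s)^{1/s}$ and $\ell_s^N=(\mathbb{R}^N,|\cdot|_s)$. $\mathrm{Id}_n$ is the $n\times n$ identity matrix. The random operator $S$: let $Y$ be the random vector in $\mathbb{R}^{\eta n}$ taking each of the values $\pm e_1,\dots,\pm e_{\eta n}$ (the signed vectors of the canonical basis of $\mathbb{R}^{\eta n}$) with probability $\frac{1}{2\eta n}$. Let $(Y_{ij})$, $1\le i\le n$, $j\ge1$, be independent copies of $Y$. Then $$S:\ell_p^n\to\ell_r^{\eta n},\qquad x=(x_1,\dots,x_n)\mapsto\sum_{i=1}^n x_i\sum_{j\ge1}\frac{1}{j^{1/p}}Y_{ij}.$$ *)

(* Defs.v *)
From HB Require Import structures.
From mathcomp Require Import all_boot all_order all_algebra.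
From mathcomp Require Import all_classical all_reals all_analysis.

Set Implicit Arguments.
Unset Strict Implicit.
Unset Printing Implicit Defensive.

Import Order.TTheory GRing.Theory Num.Theory.
Import numFieldNormedType.Exports.

Local Open Scope classical_set_scope.
Local Open Scope ring_scope.

(* Since [0 `^ s = 0] for [s != 0], zero coordinates contribute nothing. *)
Definition lnorm (R : realType) (s : R) (N : nat) (x : 'cV[R]_N) : R :=
  (\sum_(i < N) `|x i 0| `^ s) `^ s^-1.

(* R^m with its Borel sigma-algebra. It is convertible to ['cV[R]_m]; the alias
   only serves to carry the measurable structure, which matrices do not have. *)
Definition borel_cV (R : realType) (m : nat) :=
  g_sigma_algebraType (@open 'cV[R]_m).

Definition mutually_independent d (T : measurableType d) (R : realType)
    (P : probability T R) (I : choiceType) d' (E : measurableType d')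
    (X : I -> T -> E) : Prop :=
  forall (J : seq I) (A : I -> set E), uniq J ->
    (forall i, i \in J -> measurable (A i)) ->
    P (\bigcap_(i in [set` J]) (X i @^-1` A i)) =
    (\prod_(i <- J) P (X i @^-1` A i))%E.

(* [delta_mx k 0] is the basis vector e_k. The 2m masses prescribed below add
   up to 1, so that they determine the law of [Y] when [0 < m]. *)
Definition uniform_signed_basis d (T : measurableType d) (R : realType)
    (P : probability T R) (m : nat) (Y : T -> 'cV[R]_m) : Prop :=
  measurable_fun [set: T] (Y : T -> borel_cV R m) /\
  forall (k : 'I_m) (sgn : bool),
    P [set w | Y w = (-1) ^+ sgn *: delta_mx k 0] = ((2 * m%:R)^-1)%:E.

(* Partial sums of the series sum_(j >= 1) j^(-1/p) y_j. The term y_j is indexed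
   by [j.-1], so that indices start at 0. *)
Definition weighted_series (R : realType) (p : R) (m : nat)
    (y : nat -> 'cV[R]_m) : nat -> 'cV[R]_m :=
  series (fun j : nat => (j.+1%:R `^ p^-1)^-1 *: y j).

(* The matrix of x |-> sum_i x_i sum_(j >= 1) j^(-1/p) y_ij : its i-th column is
   the sum of the i-th series. [lim] has an arbitrary value when that series
   diverges. *)
Definition Smx (R : realType) (p : R) (n m : nat)
    (y : 'I_n -> nat -> 'cV[R]_m) : 'M[R]_(m, n) :=
  \matrix_(k, i) (limn (weighted_series p (y i)) : 'cV[R]_m) k 0.

Definition Wmx (R : realType) (p q c' eta : R) (n m : nat)
    (y : 'I_n -> nat -> 'cV[R]_m) : 'M[R]_(n + m, n) :=
  (n%:R `^ q^-1)^-1 *: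
    col_mx 1%:M ((c' / ln (1 + eta^-1) `^ q^-1) *: Smx p y).

(* Main.v *)
Require Import Defs.
From HB Require Import structures.
From mathcomp Require Import all_boot all_order all_algebra.
From mathcomp Require Import all_classical all_reals all_analysis.
From mathcomp Require Import measurable_realfun.
From mathcomp Require Import ring lra zify complex.

Set Implicit Arguments.
Unset Strict Implicit.
Unset Printing Implicit Defensive.

Import Order.TTheory GRing.Theory Num.Theory.
Import numFieldNormedType.Exports.

Local Open Scope classical_set_scope.
Local Open Scope ring_scope.

(** Write [L = ln (1 + n / m)], [rho = r / p] and [psum s x] for the sum of the
   [|x_i| ^ s], so that [1 / q = (1 - rho) / r]. Everything is stated for the
   power sums [psum r] and [psum p]; since [r <= 1], [psum r] is subadditive.

   A fixed vector. Let [S_J] be the matrix of the first [J] terms of the series.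
   The vector [S_J x] is a sum of independent signed basis vectors with
   coefficients [x_i j ^ (- 1 / p)]; at most [t ^ (- p)] of these exceed [t |x|_p],
   and about as many if [x] has few nonzero coordinates. For the lower bound, let
   [z] be [S_J x] multiplied by a factor of order [m ^ (1 / p) / |x|_p]. The product
   of the [(2 + cos z_k) / 3] is the average of [cos <v, z>] over a random vector
   [v] with entries in [{-1, 0, 1}]; its expectation factors over the terms of the
   sum, and it is exponentially small in [m] if at least [m / 8] coefficients are
   of order 1 after scaling ([avg_exp_psum_le]). As it dominates
   [exp (- 2 psum r z)], Markov's inequality shows that [psum r (S_J x)] is at
   least of order [m ^ (1 - rho) * psum p x ^ rho], with an exponentially small
   exceptional probability ([pr_psum_small]). For the upper bound, at a level
   [M >= m], the coefficients above [|x|_p M ^ (- 1 / p)] are summed in l_r without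
   using any cancellation, and the others have an exponential moment in l_1
   ([pr_psum_large]).

   Uniformity. The vectors of integers with [psum p <= Q] form a net whose
   cardinality is controlled by a Chernoff bound ([card_net_le]). On this net a
   union bound applies ([pr_net_bad_le]); the bounds then extend to [k]-sparse
   vectors by successive approximation ([sparse_of_net_le], [sparse_of_net_ge]),
   and to all vectors by removing the largest coordinates in blocks of size [k]
   ([psum_mulmx_flat]). The latter step costs a multiple of
   [k ^ (rho - 1) * psum r x], and [psum r x] is what the identity block of [W]
   sees: this is why the identity is there.

   The sparsity level [k] is of order [m / L], with [M = m]. If [m / L] is
   smaller than a constant, [k = 1] and [M] is of order [L]; no lower bound on [S]
   is then needed, because [psum p x ^ rho <= psum r x]
   ([exists_sparsity_level], [good_upper], [good_lower]).

   Passage to the limit. The first [J] terms of the sequences take finitely many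
   values, all equally likely, hence the probabilities above are averages over a
   finite set ([prob_cells]). The series converge almost surely: the partial sums
   of order [N ^ (1 / 2)] of the coordinates are summed by parts
   ([negligible_not_series_cvg]). The conditions on the net are closed and hold for
   infinitely many [J] with the required probability, so they hold for the sum of
   the series ([net_good_limit], [prob_net_good]). The event of the theorem is
   measurable because by continuity it can be tested on a countable set of
   vectors. *)

(** * Powers of real numbers *)

Section Powers.
Variable R : realType.
Implicit Types (r s t u h y : R).

Lemma one_powR t : 1 `^ t = 1 :> R.
Proof. by rewrite powR1. Qed.

Lemma powR_bernoulli t u : 0 <= t -> t <= 1 -> 0 <= u ->
  u `^ t <= 1 + t * (u - 1).
Proof.
move=> t0 t1 u0.
have [->|tn0] := eqVneq t 0; first by rewrite powRr0 mul0r addr0.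
have [->|tn1] := eqVneq t 1; first by rewrite powRr1// mul1r addrC subrK.
have tp : 0 < t by rewrite lt_neqAle eq_sym tn0.
have tl : 0 < 1 - t by rewrite subr_gt0 lt_neqAle tn1.
have := @conjugate_powR _ (u `^ t) 1 t^-1 (1 - t)^-1 (powR_ge0 _ _) ler01.
rewrite !invr_gt0 !invrK => /(_ tp tl); rewrite subrKC => /(_ erefl).
rewrite mulr1 -powRrM mulfV// powRr1// powR1 mul1r => h.
by apply: (le_trans h); lra.
Qed.

Lemma powRN_onem_ge t h : 0 <= t -> 0 <= h -> h < 1 ->
  1 + t * h <= (1 - h) `^ (- t).
Proof.
move=> t0 h0 h1; rewrite /powR gt_eqF ?subr_gt0//.
apply: (le_trans _ (expR_ge1Dx _)); rewrite lerD2l mulNr -mulrN ler_wpM2l//.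
by rewrite lerNr le_ln1Dx// ltrN2.
Qed.

Lemma powRN_1D_ge t h : 0 <= t -> 0 <= h -> 1 - t * h <= (1 + h) `^ (- t).
Proof.
move=> t0 h0; rewrite /powR gt_eqF ?ltr_wpDr//.
apply: (le_trans _ (expR_ge1Dx _)); rewrite lerD2l mulNr lerN2 ler_wpM2l//.
by rewrite le_ln1Dx// (lt_le_trans _ h0)// ltrN10.
Qed.

Lemma powR_div (a b s : R) : 0 <= a -> 0 <= b -> (a / b) `^ s = a `^ s / b `^ s.
Proof.
move=> a0 b0; rewrite powRM ?invr_ge0//; congr (_ * _).
by rewrite -(powR_inv1 b0) -powRrM mulN1r powRN.
Qed.

(** By Bernoulli's inequality, each term is at most the increment of the right-hand
   side; the next lemma is the same telescoping from infinity. *)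
Lemma sum_powRN_le t N : 0 < t -> t < 1 ->
  \sum_(0 <= j < N) j.+1%:R `^ (- t) <= N%:R `^ (1 - t) / (1 - t) :> R.
Proof.
move=> t0 t1; have u0 : 0 < 1 - t by rewrite subr_gt0.
elim: N => [|N IH]; first by rewrite big_geq// divr_ge0 ?powR_ge0// ltW.
rewrite big_nat_recr//=.
apply: (le_trans (lerD IH (lexx _))).
rewrite -lerBrDl -mulrBl ler_pdivlMr//.
have N0 : 0 < N.+1%:R :> R by rewrite ltr0n.
have Nn0 : N.+1%:R != 0 :> R by rewrite gt_eqF.
have e1 : N%:R = N.+1%:R * (1 - N.+1%:R^-1) :> R.
  by rewrite mulrBr mulr1 mulfV// -natr1 addrK.
have h0 : 0 <= 1 - N.+1%:R^-1 :> R.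
  by rewrite subr_ge0 invf_le1// ler1n.
rewrite e1 (powRM _ (ltW N0) h0).
have -> : N.+1%:R `^ (1 - t) = N.+1%:R * N.+1%:R `^ (- t) :> R.
  by rewrite powRD ?powRr1 ?ler0n// Nn0 implybT.
have := powR_bernoulli (ltW u0) _ h0; rewrite gerBl (ltW t0) => /(_ isT) hb.
have a0 : 0 <= N.+1%:R `^ (- t) :> R by exact: powR_ge0.
set a := _ `^ (- t) in a0 *; set b := (_ `^ (1 - t)) in hb *.
have : N.+1%:R * a * b <= N.+1%:R * a * (1 + (1 - t) * (1 - N.+1%:R^-1 - 1)).
  by rewrite ler_wpM2l ?hb ?mulr_ge0 ?ler0n.
have -> : N.+1%:R * a * (1 + (1 - t) * (1 - N.+1%:R^-1 - 1)) =
   N.+1%:R * a - (1 - t) * a by field.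
nra.
Qed.

Lemma sum_powRN_tail s N J : 1 < s -> (0 < N)%N ->
  \sum_(N <= j < J) j.+1%:R `^ (- s) <= N%:R `^ (1 - s) / (s - 1) :> R.
Proof.
move=> s1 N0; have u0 : 0 < s - 1 by rewrite subr_gt0.
have [NJ|JN] := leqP N J; last first.
  by rewrite big_geq ?(ltnW JN)// divr_ge0 ?powR_ge0// ltW.
suff: \sum_(N <= j < J) j.+1%:R `^ (- s) <=
   (N%:R `^ (1 - s) - J%:R `^ (1 - s)) / (s - 1) :> R.
  move=> /le_trans; apply; rewrite ler_pM2r ?invr_gt0// gerBl.
  exact: powR_ge0.
elim: J NJ => [|J IH].
  by rewrite leqn0 => /eqP NE; rewrite NE in N0.
rewrite leq_eqVlt => /orP[/eqP <-|]; first by rewrite big_geq// subrr mul0r.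
rewrite ltnS => NJ; rewrite big_nat_recr//=.
apply: (le_trans (lerD (IH NJ) (lexx _))).
rewrite -lerBrDl -mulrBl ler_pdivlMr//.
have J0 : (0 < J)%N by apply: leq_trans NJ.
have JS0 : 0 < J.+1%:R :> R by rewrite ltr0n.
have Jn0 : J.+1%:R != 0 :> R by rewrite gt_eqF.
have h1 : J.+1%:R^-1 < 1 :> R by rewrite invf_lt1// ltr1n ltnS.
have e1 : J%:R = J.+1%:R * (1 - J.+1%:R^-1) :> R.
  by rewrite mulrBr mulr1 mulfV// -natr1 addrK.
have h0 : 0 <= 1 - J.+1%:R^-1 :> R by rewrite subr_ge0 ltW.
rewrite e1 (powRM _ (ltW JS0) h0).
have -> : J.+1%:R `^ (1 - s) = J.+1%:R * J.+1%:R `^ (- s) :> R.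
  by rewrite powRD ?powRr1 ?ler0n// Jn0 implybT.
have := @powRN_onem_ge (s - 1) J.+1%:R^-1 (ltW u0).
rewrite invr_ge0 ltW// => /(_ isT h1); rewrite opprB => hb.
have a0 : 0 <= J.+1%:R `^ (- s) :> R by exact: powR_ge0.
set a := _ `^ (- s) in a0 *; set b := ((1 - _) `^ (1 - s)) in hb *.
have : J.+1%:R * a * (1 + (s - 1) * J.+1%:R^-1) <= J.+1%:R * a * b.
  by rewrite ler_wpM2l ?hb ?mulr_ge0 ?ler0n.
have -> : J.+1%:R * a * (1 + (s - 1) * J.+1%:R^-1) =
   J.+1%:R * a + (s - 1) * a by field.
nra.
Qed.

(** Not the optimal constant, but an elementary one: for [y <= 1/2] both exponentials
   are compared with geometric series, beyond [1/2] already [y <= 2 y^2]. *)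
Lemma cosh_le y : (expR y + expR (- y)) / 2 <= expR (2 * y ^+ 2).
Proof.
wlog y0 : y / 0 <= y => [hw|].
  have [|y0] := leP 0 y; first exact: hw.
  have := hw (- y); rewrite opprK sqrrN addrC; apply.
  by rewrite oppr_ge0 ltW.
have [y2|y2] := leP y (2^-1); last first.
  apply: (@le_trans _ _ (expR y)).
    rewrite ler_pdivrMr// mulr_natr mulr2n lerD2l ler_expR; lra.
  rewrite ler_expR expr2 mulrA -[leLHS]mul1r ler_wpM2r//; lra.
have e1 : expR y <= (1 - y)^-1.
  rewrite -[expR y]invrK -expRN lef_pV2 ?posrE ?expR_gt0//; last lra.
  exact: expR_ge1Dx.
have e2 : expR (- y) <= (1 + y)^-1.
  rewrite expRN lef_pV2 ?posrE ?expR_gt0//; last lra.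
  exact: expR_ge1Dx.
apply: (@le_trans _ _ ((1 - y ^+ 2)^-1)).
  have -> : (1 - y ^+ 2)^-1 = ((1 - y)^-1 + (1 + y)^-1) / 2.
    field; repeat (apply/andP; split); apply/eqP; nra.
  lra.
apply: (le_trans _ (expR_ge1Dx _)).
have yy : y ^+ 2 <= 4^-1 by nra.
rewrite invf_ple ?posrE; try nra.
rewrite -[_^-1]mul1r ler_pdivrMr; nra.
Qed.

Lemma powR_subadd r u v : 0 < r -> r <= 1 -> 0 <= u -> 0 <= v ->
  (u + v) `^ r <= u `^ r + v `^ r.
Proof.
move=> r0 r1 u0 v0.
have [->|un0] := eqVneq u 0; first by rewrite add0r lerDr powR_ge0.
have [->|vn0] := eqVneq v 0; first by rewrite addr0 lerDl powR_ge0.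
have up : 0 < u by rewrite lt_neqAle eq_sym un0.
have vp : 0 < v by rewrite lt_neqAle eq_sym vn0.
have w0 : 0 < u + v by rewrite addr_gt0.
have h a : 0 < a -> a <= u + v -> a / (u + v) <= a `^ r / (u + v) `^ r.
  move=> a0 au; rewrite -powRN -[- r]mulN1r powRrM (powR_inv1 (ltW w0)).
  rewrite -powRM ?invr_ge0 ?addr_ge0//; last exact: ltW.
  apply: ger1_powR => //.
  by rewrite divr_gt0//= ler_pdivrMr// mul1r.
rewrite -[leLHS]mul1r -ler_pdivlMr ?powR_gt0//.
have -> : 1 = u / (u + v) + v / (u + v) by rewrite -mulrDl divff ?gt_eqF.
by rewrite mulrDl lerD// h// ?lerDl ?lerDr ltW.
Qed.

Lemma powR_sum_subadd (I : Type) (l : seq I) (P : pred I) (F : I -> R) r :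
  0 < r -> r <= 1 -> `|\sum_(i <- l | P i) F i| `^ r <=
    \sum_(i <- l | P i) `|F i| `^ r.
Proof.
move=> r0 r1; elim/big_ind2: _ => //.
- by rewrite normr0 powR0// gt_eqF.
- move=> x1 x2 y1 y2 /= h1 h2.
  apply: (@le_trans _ _ ((`|x2| + `|y2|) `^ r)).
    by apply: ge0_ler_powR; rewrite ?nnegrE ?addr_ge0 ?ler_normD ?(ltW r0).
  exact: (le_trans (powR_subadd r0 r1 (normr_ge0 _) (normr_ge0 _)) (lerD h1 h2)).
Qed.

(** Concavity of the power function, in the form of the tangent inequality at
   the mean of the [v i]. *)
Lemma sum_powR_le (I : finType) (v : I -> R) t : 0 <= t -> t <= 1 ->
  (forall i, 0 <= v i) ->
  \sum_i v i `^ t <= #|I|%:R `^ (1 - t) * (\sum_i v i) `^ t.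
Proof.
move=> t0 t1 v0.
have [->|tn0] := eqVneq t 0.
  rewrite subr0 powRr0 mulr1 powRr1// (eq_bigr (fun=> 1)) => [|i _].
    by rewrite sumr_const.
  by rewrite powRr0.
set V := \sum_i v i; have V0 : 0 <= V by apply: sumr_ge0.
have [VE|Vn0] := eqVneq V 0.
  rewrite big1 ?mulr_ge0 ?powR_ge0// => i _.
  have /eqP := VE; rewrite psumr_eq0// => /allP/(_ i).
  by rewrite mem_index_enum => /(_ isT)/eqP ->; rewrite powR0.
have Vp : 0 < V by rewrite lt_neqAle eq_sym Vn0.
have N0 : 0 < #|I|%:R :> R.
  rewrite ltr0n lt0n; apply/eqP => /card0_eq I0.
  by move: Vn0; rewrite /V big1 ?eqxx// => i; have := I0 i; rewrite inE.
set N := #|I|%:R in N0 *.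
have h i : v i `^ t <= V `^ t * N `^ (- t) * (1 + t * (v i * N / V - 1)).
  have e : v i = v i * N / V * (V * N^-1).
    by field; rewrite (gt_eqF N0) Vn0.
  have vN : 0 <= v i * N / V by rewrite divr_ge0 ?mulr_ge0// ltW.
  rewrite {1}e (powRM _ vN) ?divr_ge0 ?(ltW Vp) ?(ltW N0)//.
  rewrite (powRM _ (ltW Vp)) ?invr_ge0 ?(ltW N0)//.
  rewrite -(powR_inv1 (ltW N0)) -powRrM mulN1r mulrC ler_wpM2l ?mulr_ge0 ?powR_ge0//.
  exact: powR_bernoulli.
apply: (le_trans (ler_sum _ (fun i _ => h i))).
rewrite -mulr_sumr big_split/= sumr_const -mulr_sumr sumrB sumr_const.
have -> : \sum_i v i * N / V = N.
  rewrite -!mulr_suml -/V; field; exact: Vn0.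
rewrite subrr mulr0 addr0 -/N -mulrA [leLHS]mulrC ler_wpM2r ?powR_ge0//.
by rewrite -{2}(powRr1 (ltW N0)) -powRD ?(gt_eqF N0) ?implybT// addrC.
Qed.

(** About half of the integers [j + 1 <= u] are above [u / 2], and there is at least
   one of them as soon as [u >= 1]. *)
Lemma sum_window (u : R) J : 1 <= u -> u <= J%:R ->
  u / 4 <= \sum_(j < J) ((Num.truncn u)./2 <= j < Num.truncn u)%N%:R.
Proof.
move=> u1 uJ; have /andP[N1 N2] := truncn_itv (le_trans ler01 u1).
set N := Num.truncn u in N1 N2 *.
have NJ : (N <= J)%N by rewrite -(ler_nat R) (le_trans N1).
have N0 : (0 < N)%N by rewrite -ltnS -(ltr_nat R) (le_lt_trans u1).
rewrite -(big_mkord xpredT (fun j => (N./2 <= j < N)%N%:R)).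
have hN : (N./2 <= N)%N by lia.
rewrite (big_cat_nat (n := N))//= (big_cat_nat (n := N./2))//=.
rewrite [X in X + _ + _]big_nat big1 ?add0r => [|j]; last first.
  by move=> /andP[_ jN]; rewrite leqNgt jN.
rewrite [X in _ + X]big_nat [X in _ + X]big1 ?addr0 => [|j]; last first.
  by move=> /andP[Nj _]; rewrite [(j < N)%N]ltnNge Nj andbF.
rewrite big_nat (eq_bigr (fun=> 1)) => [|j ->//].
rewrite -big_nat sumr_const_nat.
have h1 : N.+1%:R / 4 <= (N - N./2)%:R :> R.
  rewrite ler_pdivrMr// -natrM ler_nat; lia.
by apply: le_trans h1; rewrite ler_pM2r ?invr_gt0// ltW.
Qed.

End Powers.

(** * Power sums *)

Definition psum (R : realType) (s : R) (N : nat) (x : 'cV[R]_N) : R :=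
  \sum_(i < N) `|x i 0| `^ s.

Section PowerSums.
Variable R : realType.

Lemma psum_ge0 (s : R) N (x : 'cV[R]_N) : 0 <= psum s x.
Proof. by apply: sumr_ge0 => i _; exact: powR_ge0. Qed.

Lemma psumZ (s a : R) N (x : 'cV[R]_N) : psum s (a *: x) = `|a| `^ s * psum s x.
Proof.
rewrite /psum mulr_sumr; apply: eq_bigr => i _.
by rewrite mxE normrM powRM.
Qed.

Lemma psumN (s : R) N (x : 'cV[R]_N) : psum s (- x) = psum s x.
Proof. by apply: eq_bigr => i _; rewrite mxE normrN. Qed.

Lemma psum_sum_le (r : R) (I : Type) (l : seq I) N (F : I -> 'cV[R]_N) :
  0 < r -> r <= 1 -> psum r (\sum_(i <- l) F i) <= \sum_(i <- l) psum r (F i).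
Proof.
move=> r0 r1; rewrite /psum exchange_big; apply: ler_sum => k _ /=.
by rewrite summxE; exact: powR_sum_subadd.
Qed.

Lemma psumD_le (r : R) N (x y : 'cV[R]_N) :
  0 < r -> r <= 1 -> psum r (x + y) <= psum r x + psum r y.
Proof.
move=> r0 r1; rewrite /psum -big_split; apply: ler_sum => i _ /=.
rewrite mxE; apply: (le_trans _ (powR_subadd _ _ _ _)) => //.
by apply: ge0_ler_powR; rewrite ?nnegrE ?addr_ge0 ?ler_normD ?(ltW r0).
Qed.

Lemma psum_eq0 (s : R) N (x : 'cV[R]_N) : psum s x = 0 -> x = 0.
Proof.
move=> /eqP; rewrite psumr_eq0 => [/allP x0|i _]; last exact: powR_ge0.
apply/matrixP => i j; rewrite mxE (ord1 j).
have := x0 i; rewrite mem_index_enum => /(_ isT)/eqP.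
by move/powR_eq0_eq0/normr0_eq0.
Qed.

Lemma psum0 (s : R) N : s != 0 -> psum s (0 : 'cV[R]_N) = 0.
Proof. by move=> s0; rewrite /psum big1// => i _; rewrite mxE normr0 powR0. Qed.

Lemma psum_mean_le (s t : R) N (x : 'cV[R]_N) : 0 < s -> s <= t ->
  psum s x <= N%:R `^ (1 - s / t) * psum t x `^ (s / t).
Proof.
move=> s0 st; have t0 : 0 < t by exact: lt_le_trans st.
have := @sum_powR_le R 'I_N (fun i => `|x i 0| `^ t) (s / t).
rewrite card_ord; under eq_bigr do rewrite -powRrM mulrCA mulfV ?gt_eqF// mulr1.
apply=> [||i]; last exact: powR_ge0.
  by rewrite divr_ge0 ?ltW.
by rewrite ler_pdivrMr// mul1r.
Qed.

Lemma psum_powR_le (s t : R) N (x : 'cV[R]_N) : 0 < s -> s <= t ->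
  psum t x `^ (s / t) <= psum s x.
Proof.
move=> s0 st; have t0 : 0 < t by exact: lt_le_trans st.
rewrite -[psum t x]ger0_norm ?psum_ge0//.
have st1 : s / t <= 1 by rewrite ler_pdivrMr// mul1r.
apply: (le_trans (powR_sum_subadd _ _ _ (divr_gt0 s0 t0) st1)).
apply: ler_sum => i _; rewrite ger0_norm ?powR_ge0// -powRrM mulrCA mulfV ?gt_eqF//.
by rewrite mulr1.
Qed.

End PowerSums.

(** * Averages over finite sets *)

Lemma sum_pair (R : realType) (I J : finType) (F : I * J -> R) :
  \sum_l F l = \sum_i \sum_j F (i, j).
Proof. by rewrite pair_bigA; apply: eq_bigr => -[]. Qed.

Lemma sum_option (R : realType) (T : finType) (F : option T -> R) :
  \sum_c F c = F None + \sum_c F (Some c).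
Proof.
rewrite (bigD1 None)//= (reindex_omap Some id) => [|[c|]]//=.
by congr (_ + _); apply: eq_bigl => c; rewrite eqxx.
Qed.

Section Average.
Variable R : realType.

Definition avg (T : finType) (F : T -> R) : R := (\sum_x F x) / #|T|%:R.

Lemma ler_avg (T : finType) (F G : T -> R) :
  (forall x, F x <= G x) -> avg F <= avg G.
Proof. by move=> FG; rewrite ler_wpM2r ?invr_ge0 ?ler0n// ler_sum. Qed.

Lemma eq_avg (T : finType) (F G : T -> R) : F =1 G -> avg F = avg G.
Proof. by move=> FG; congr (_ / _); apply: eq_bigr. Qed.

Lemma avg_cst (T : finType) (c : R) : (0 < #|T|)%N -> avg (fun _ : T => c) = c.
Proof.
move=> T0; rewrite /avg sumr_const -[c *+ _]mulr_natr mulfK//.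
by rewrite pnatr_eq0 -lt0n.
Qed.

Lemma avgMl (T : finType) (c : R) (F : T -> R) :
  avg (fun x => c * F x) = c * avg F.
Proof. by rewrite /avg -mulr_sumr mulrA. Qed.

Lemma avg_sum (T : finType) (I : Type) (l : seq I) (F : I -> T -> R) :
  avg (fun x => \sum_(i <- l) F i x) = \sum_(i <- l) avg (F i).
Proof. by rewrite /avg exchange_big mulr_suml. Qed.

Lemma avgC (T U : finType) (F : T -> U -> R) :
  avg (fun x => avg (F x)) = avg (fun y => avg (F ^~ y)).
Proof.
rewrite /avg -!mulr_suml exchange_big/= -!mulrA; congr (_ * _).
exact: mulrC.
Qed.

Lemma avg_prod (I T : finType) (h : I -> T -> R) :
  avg (fun f : {ffun I -> T} => \prod_i h i (f i)) = \prod_i avg (h i).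
Proof.
by rewrite /avg prodf_div bigA_distr_bigA/= prodr_const card_ffun natrX.
Qed.

Definition pr (T : finType) (B : pred T) : R := avg (fun x => (B x)%:R).

Lemma markov_avg (T : finType) (F : T -> R) (B : pred T) (c : R) : 0 < c ->
  (forall x, 0 <= F x) -> (forall x, B x -> c <= F x) -> pr B <= avg F / c.
Proof.
move=> c0 F0 BF; rewrite ler_pdivlMr// mulrC -avgMl; apply: ler_avg => x.
by case: (boolP (B x)) => [/BF|_]; rewrite ?mulr1// mulr0.
Qed.

Lemma pr_union (T : finType) (I : eqType) (l : seq I) (B : I -> pred T) (e : R) :
  (forall i, i \in l -> pr (B i) <= e) ->
  pr (fun x => has (B ^~ x) l) <= (size l)%:R * e.
Proof.
move=> h; apply: (@le_trans _ _ (\sum_(i <- l) pr (B i))).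
  rewrite /pr -avg_sum; apply: ler_avg => x.
  elim: l {h} => [|i l IH]; first by rewrite big_nil.
  rewrite /= big_cons; case: (B i x) => /=; last by rewrite add0r.
  by rewrite lerDl sumr_ge0.
rewrite mulr_natl.
elim: l h => [|i l IH] h; first by rewrite big_nil mulr0n.
rewrite big_cons /= mulrS lerD//; first by rewrite h// mem_head.
by apply: IH => j jl; apply: h; rewrite inE jl orbT.
Qed.

Lemma pr_le (T : finType) (B C : pred T) :
  (forall x, B x -> C x) -> pr B <= pr C.
Proof.
by move=> BC; apply: ler_avg => x; rewrite ler_nat; case: (B x) (BC x) => [->|].
Qed.

Lemma pr_or (T : finType) (B C : pred T) : pr (fun x => B x || C x) <= pr B + pr C.
Proof.
rewrite /pr /avg -mulrDl ler_wpM2r ?invr_ge0 ?ler0n// -big_split/= ler_sum//.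
by move=> x _; rewrite -natrD ler_nat /=; case: (B x); case: (C x).
Qed.

(** The characteristic function of a sum of independent symmetric variables is
   the product of their characteristic functions; the symmetry makes them real. *)
Lemma avg_cos (I T : finType) (g : I -> T -> R) :
  (forall i, \sum_t sin (g i t) = 0) ->
  avg (fun f : {ffun I -> T} => cos (\sum_i g i (f i))) =
  \prod_i avg (fun t => cos (g i t)).
Proof.
move=> g0; rewrite /avg prodf_div prodr_const card_ffun natrX; congr (_ / _).
pose e (y : R) : complex R := Complex (cos y) (sin y).
have eD : {morph e : x y / x + y >-> x * y}.
  by move=> x y; rewrite /e cosD sinD /GRing.mul/= addrC [sin x * _ + _]addrC.
have e0 : e 0 = 1 by rewrite /e cos0 sin0.
have ReE y : complex.Re (e y) = cos y by [].
rewrite (eq_bigr (fun f : {ffun I -> T} => complex.Re (e (\sum_i g i (f i)))))//.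
rewrite -raddf_sum/=.
under eq_bigr do rewrite (big_morph e eD e0).
rewrite -(bigA_distr_bigA (fun i t => e (g i t))).
have -> : \prod_i \sum_t e (g i t) =
    \prod_i real_complex R (\sum_t cos (g i t)).
  apply: eq_bigr => i _.
  transitivity (Complex (\sum_t cos (g i t)) (\sum_t sin (g i t))); last by rewrite g0.
  by elim/big_ind3: _ => // x1 x2 x3 y1 y2 y3 -> ->.
by rewrite -rmorph_prod.
Qed.

End Average.

(** * Random signed basis vectors *)

Section SignedBasis.
Variables (R : realType) (m : nat).
Implicit Types (c : 'I_m * bool) (v : 'I_m -> R).

Definition sbasis c : 'cV[R]_m := (-1) ^+ c.2 *: delta_mx c.1 0.

Definition ssum (I : finType) (a : I -> R) (f : I -> 'I_m * bool) : 'cV[R]_m :=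
  \sum_l a l *: sbasis (f l).

Lemma sbasisE c k : sbasis c k 0 = (-1) ^+ c.2 * (c.1 == k)%:R.
Proof. by rewrite !mxE eqxx andbT eq_sym. Qed.

Lemma ssumE (I : finType) (a : I -> R) (f : I -> 'I_m * bool) k :
  ssum a f k 0 = \sum_l a l * sbasis (f l) k 0.
Proof. by rewrite summxE; apply: eq_bigr => l _; rewrite mxE. Qed.

Lemma ssum_dot (I : finType) (a : I -> R) (f : I -> 'I_m * bool) v :
  \sum_k v k * ssum a f k 0 = \sum_l a l * ((-1) ^+ (f l).2 * v (f l).1).
Proof.
under eq_bigr do rewrite ssumE mulr_sumr.
rewrite exchange_big; apply: eq_bigr => l _ /=.
rewrite (bigD1 (f l).1)//= big1 ?addr0 => [|k kl]; last first.
  by rewrite sbasisE eq_sym (negPf kl) !mulr0.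
by rewrite sbasisE eqxx mulr1 mulrC -mulrA.
Qed.

Lemma sum_signed (F : 'I_m * bool -> R) :
  \sum_c F c = \sum_k (F (k, true) + F (k, false)).
Proof.
transitivity (\sum_k \sum_b F (k, b)).
  by rewrite pair_bigA; apply: eq_bigr => -[k b].
by apply: eq_bigr => k _; rewrite big_bool.
Qed.

Hypothesis m0 : (0 < m)%N.

Lemma card_signed : #|{: 'I_m * bool}|%:R = 2 * m%:R :> R.
Proof. by rewrite card_prod card_ord card_bool natrM mulrC. Qed.

Let m_gt0 : 0 < m%:R :> R. Proof. by rewrite ltr0n. Qed.

Lemma avg_signed (F : 'I_m * bool -> R) :
  avg F = (\sum_k (F (k, true) + F (k, false)) / 2) / m%:R.
Proof.
rewrite /avg sum_signed card_signed -mulr_suml; field.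
by rewrite gt_eqF.
Qed.

Lemma avg_exp_signed (a : R) v : (forall k, `|v k| <= 1) ->
  avg (fun c : 'I_m * bool => expR (a * ((-1) ^+ c.2 * v c.1))) <=
  expR (2 * a ^+ 2).
Proof.
move=> v1; rewrite avg_signed ler_pdivrMr//.
apply: (@le_trans _ _ (\sum_(k < m) expR (2 * a ^+ 2))); last first.
  by rewrite sumr_const card_ord mulr_natr.
apply: ler_sum => k _ /=; rewrite expr0 expr1 mulN1r mul1r mulrN addrC.
apply: (le_trans (cosh_le _)); rewrite ler_expR ler_wpM2l// exprMn.
rewrite ler_piMr ?sqr_ge0// -real_normK ?num_real//.
by rewrite expr_le1.
Qed.

(** Subgaussian bound: conditionally on the position of the signed basis vector,
   only the sign is random. *)
Lemma avg_exp_dot (I : finType) (a : I -> R) v : (forall k, `|v k| <= 1) ->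
  avg (fun f : {ffun I -> 'I_m * bool} => expR (\sum_k v k * ssum a f k 0)) <=
  expR (2 * \sum_l a l ^+ 2).
Proof.
move=> v1; rewrite (@eq_avg _ _ _
    (fun f : {ffun I -> 'I_m * bool} =>
      \prod_l expR (a l * ((-1) ^+ (f l).2 * v (f l).1)))); last first.
  by move=> f; rewrite ssum_dot expR_sum.
rewrite (avg_prod (fun l c => expR (a l * ((-1) ^+ c.2 * v c.1)))).
rewrite mulr_sumr expR_sum; apply: ler_prod => l _.
rewrite avg_exp_signed// andbT divr_ge0//; apply: sumr_ge0 => c _.
exact: expR_ge0.
Qed.

(** The l_1 norm is the maximum of [2 ^ m] signed sums of the coordinates. *)
Lemma avg_exp_norm1 (I : finType) (a : I -> R) :
  avg (fun f : {ffun I -> 'I_m * bool} => expR (\sum_k `|ssum a f k 0|)) <=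
  2 ^+ m * expR (2 * \sum_l a l ^+ 2).
Proof.
apply: (@le_trans _ _ (avg (fun f : {ffun I -> 'I_m * bool} =>
    \sum_(s : {ffun 'I_m -> bool}) expR (\sum_k (-1) ^+ s k * ssum a f k 0)))).
  apply: ler_avg => f; rewrite expR_sum.
  under [leRHS]eq_bigr do rewrite expR_sum.
  rewrite -(bigA_distr_bigA (fun k (b : bool) => expR ((-1) ^+ b * ssum a f k 0))).
  apply: ler_prod => k _; rewrite expR_ge0/= big_bool/= expr0 expr1 mul1r mulN1r.
  by case: (ger0P (ssum a f k 0)) => _; rewrite ?lerDl ?lerDr expR_ge0.
rewrite avg_sum.
apply: (@le_trans _ _ (\sum_(s : {ffun 'I_m -> bool}) expR (2 * \sum_l a l ^+ 2))).
  apply: ler_sum => s _; apply: avg_exp_dot => k.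
  by rewrite normrX normrN1 expr1n.
by rewrite sumr_const card_ffun card_bool card_ord -natrX -[_ *+ (2 ^ m)]mulr_natl.
Qed.

Lemma avg_exp_coord (I : finType) (a : I -> R) k :
  avg (fun f : {ffun I -> 'I_m * bool} => expR `|ssum a f k 0|) <=
  2 * expR (2 * \sum_l a l ^+ 2).
Proof.
pose v (s : bool) (k' : 'I_m) : R := (-1) ^+ s * (k' == k)%:R.
apply: (@le_trans _ _ (avg (fun f : {ffun I -> 'I_m * bool} =>
    \sum_(s : bool) expR (\sum_k' v s k' * ssum a f k' 0)))).
  apply: ler_avg => f.
  have vE s : \sum_k' v s k' * ssum a f k' 0 = (-1) ^+ s * ssum a f k 0.
    rewrite (bigD1 k)//= big1 ?addr0 /v ?eqxx ?mulr1// => k' /negPf ->.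
    by rewrite mulr0 mul0r.
  rewrite big_bool/= !vE expr0 expr1 mul1r mulN1r.
  by case: (ger0P (ssum a f k 0)) => _; rewrite ?lerDl ?lerDr expR_ge0.
rewrite avg_sum big_bool/= mulr_natl mulr2n.
by apply: lerD; apply: avg_exp_dot => k'; rewrite /v normrM normrX normrN1
  expr1n mul1r normr_nat lern1 leq_b1.
Qed.

End SignedBasis.

(** * Small ball estimate *)

Section SmallBall.
Variable R : realType.

Lemma one_sub_cos_le (y : R) : 1 - cos y <= `|y|.
Proof.
wlog y0 : y / 0 <= y => [hw|].
  have [|y0] := leP 0 y; first exact: hw.
  by have := hw (- y); rewrite cosN normrN; apply; rewrite oppr_ge0 ltW.
rewrite ger0_norm//; have := y0; rewrite le_eqVlt => /predU1P[<-|yp].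
  by rewrite cos0 subrr.
have [|x _] := MVT yp (fun x _ => is_derive_cos x).
  by apply: continuous_subspaceT => x; exact: continuous_cos.
rewrite cos0 subr0 => e.
have : `|cos y - 1| <= y.
  rewrite e normrM normrN (ger0_norm y0) ler_piMl//; exact: sin_max.
by rewrite distrC; apply: le_trans; exact: ler_norm.
Qed.

(** [1 - cos y] is at most [|y|] and at most [2], hence at most [2 |y| ^ r]. *)
Lemma expN_powR_le_cos (r y : R) : 0 < r -> r <= 1 ->
  expR (- (2 * `|y| `^ r)) <= (2 + cos y) / 3.
Proof.
move=> r0 r1; have w0 : 0 <= 1 - cos y by rewrite subr_ge0 cos_le1.
have w2 : 1 - cos y <= 2 by have := cos_geN1 y; lra.
have wr : 1 - cos y <= 2 * `|y| `^ r.
  have [y1|y1] := leP `|y| 1.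
    have : `|y| <= `|y| `^ r.
      have := normr_ge0 y; rewrite le_eqVlt => /predU1P[<-|yp].
        exact: powR_ge0.
      by rewrite ger1_powR// yp.
    by have := one_sub_cos_le y; have := normr_ge0 y; lra.
  apply: (le_trans w2); rewrite ler_peMr// -[leLHS](powRr0 `|y|).
  by rewrite ler_powR ?(ltW y1)// ltW.
apply: (@le_trans _ _ (expR (- (1 - cos y)))); first by rewrite ler_expR lerN2.
have c0 : 0 < (2 + cos y) / 3 by lra.
rewrite expRN invf_ple ?posrE ?expR_gt0//.
apply: (le_trans _ (expR_ge1Dx _)); rewrite invf_div ler_pdivrMr; last lra.
have : 0 <= (1 - cos y) * (2 - (1 - cos y)) by rewrite mulr_ge0// subr_ge0.
move: (cos y) => c; nra.
Qed.

(** Six equally likely values: the law of the variable with masses 2/3, 1/6, 1/6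
   at 0, 1, -1, whose characteristic function [(2 + cos) / 3] is bounded below. *)
Definition trit (t : 'I_6) : R :=
  if val t == 0%N then 1 else if val t == 1%N then -1 else 0.

Lemma sum_trit (F : R -> R) : \sum_t F (trit t) = F 1 + F (-1) + 4 * F 0.
Proof. by rewrite !big_ord_recl big_ord0 /trit/=; ring. Qed.

Lemma avg_trit (F : R -> R) : avg (F \o trit) = (F 1 + F (-1) + 4 * F 0) / 6.
Proof. by rewrite /avg card_ord (sum_trit F). Qed.

Lemma trit_cases t : [\/ trit t = 0, trit t = 1 | trit t = -1].
Proof.
by rewrite /trit; case: ifP => _; [apply: Or32|case: ifP => _;
  [apply: Or33|apply: Or31]].
Qed.

Lemma prod_cos_avg (m : nat) (z : 'I_m -> R) :
  \prod_k ((2 + cos (z k)) / 3) =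
  avg (fun v : {ffun 'I_m -> 'I_6} => cos (\sum_k trit (v k) * z k)).
Proof.
rewrite (avg_cos (g := fun k t => trit t * z k)) => [|k]; last first.
  rewrite (sum_trit (fun c => sin (c * z k))) mul1r mulN1r sinN mul0r sin0.
  by rewrite mulr0 addr0 subrr.
apply: eq_bigr => k _; rewrite (avg_trit (fun c => cos (c * z k))).
rewrite mul1r mulN1r cosN mul0r cos0; lra.
Qed.

(** Exponent in the small ball estimate, when the coefficients of the sum that
   lie in [[beta, 1]] are at least [m / 8] in number. *)
Definition small_ball_rate (beta : R) : R :=
  (1 - expR (- ((1 - cos beta) / 8))) / 3.

Lemma small_ball_rate_gt0 beta : 0 < beta -> beta <= 1 ->
  0 < small_ball_rate beta.
Proof.
move=> b0 b1; rewrite /small_ball_rate divr_gt0// subr_gt0 expR_lt1 oppr_lt0.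
rewrite divr_gt0// subr_gt0 -cos0.
rewrite ltr_cos// in_itv/= ?lexx ?pi_ge0// ltW//=.
by rewrite (le_trans b1)// (le_trans _ (pi_ge2 _))// ler1n.
Qed.

Lemma avg_signed_cos_le (m : nat) (v : {ffun 'I_m -> 'I_6}) (a beta : R) :
  (0 < m)%N -> 0 <= beta -> beta <= `|a| -> `|a| <= 1 ->
  0 <= avg (fun c : 'I_m * bool => cos (a * ((-1) ^+ c.2 * trit (v c.1)))) <=
  expR (- ((1 - cos beta) * (\sum_k trit (v k) ^+ 2) / m%:R)).
Proof.
move=> m0 b0 ba a1; have mp : 0 < m%:R :> R by rewrite ltr0n.
have cosE k : (cos (a * ((-1) ^+ true * trit (v k))) +
    cos (a * ((-1) ^+ false * trit (v k)))) / 2 = cos (a * trit (v k)).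
  by rewrite expr0 expr1 mulN1r mul1r mulrN cosN; field.
rewrite avg_signed//; under eq_bigr do rewrite /= cosE.
have pi1 : 1 <= pi / 2 :> R by have := @pi_ge2 R; lra.
apply/andP; split.
  rewrite divr_ge0 ?sumr_ge0// => k _.
  rewrite cos_ge0_pihalf// -ler_norml normrM (le_trans _ pi1)//.
  rewrite mulr_ile1//; case: (trit_cases (v k)) => ->;
    by rewrite ?normrN ?normr0 ?normr1.
apply: (le_trans _ (expR_ge1Dx _)); rewrite ler_pdivrMr// mulrDl mul1r mulNr.
rewrite -(mulrA _ (m%:R^-1)) mulVf ?gt_eqF// mulr1 mulr_sumr -sumrN.
have -> : m%:R = \sum_(k < m) 1 :> R by rewrite sumr_const card_ord.
rewrite -big_split/=.
apply: ler_sum => k _.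
have ca : cos a <= cos beta.
  have api : `|a| <= pi by have := @pi_ge2 R; lra.
  have aI : `|a| \in `[0, pi] by rewrite in_itv/= normr_ge0.
  have bI : beta \in `[0, pi] by rewrite in_itv/= b0 (le_trans ba).
  by rewrite -(cos_norm a) leNgt (ltr_cos aI bI) -leNgt.
case: (trit_cases (v k)) => ->.
- by rewrite mulr0 cos0 expr0n mulr0 subr0.
- by rewrite mulr1 expr1n mulr1 opprB addrC subrK.
- by rewrite mulrN1 cosN sqrrN expr1n mulr1 opprB addrC subrK.
Qed.

(** Average [cos (sum_k v_k z_k)] over the samples and over the vectors [v] of trits,
   where [z = ssum a f]. For a fixed sample the average over [v] is the product of the
   [(2 + cos z_k) / 3], which dominates [exp (- 2 psum r z)]. For a fixed [v] with [H]
   nonzero entries, the average over the samples factors over the terms of the sum,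
   and each term in [W] contributes a factor at most [exp (- (1 - cos beta) H / m)]. *)
Lemma avg_exp_psum_le (r beta : R) (m : nat) (I : finType) (a : I -> R)
    (W : {set I}) : 0 < r -> r <= 1 -> (0 < m)%N -> 0 <= beta ->
  (forall l, l \in W -> beta <= `|a l| /\ `|a l| <= 1) ->
  m%:R <= 8 * #|W|%:R :> R ->
  avg (fun f : {ffun I -> 'I_m * bool} => expR (- (2 * psum r (ssum a f)))) <=
  expR (- (small_ball_rate beta * m%:R)).
Proof.
move=> r0 r1 m0 b0 aW mW; have mp : 0 < m%:R :> R by rewrite ltr0n.
pose G (v : {ffun 'I_m -> 'I_6}) (f : {ffun I -> 'I_m * bool}) :=
  cos (\sum_k trit (v k) * ssum a f k 0).
apply: (@le_trans _ _ (avg (fun f => avg (G ^~ f)))).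
  apply: ler_avg => f; rewrite -prod_cos_avg /psum mulr_sumr -sumrN expR_sum.
  by apply: ler_prod => k _; rewrite expR_ge0 expN_powR_le_cos.
rewrite avgC.
set w := 1 - cos beta.
apply: (@le_trans _ _ (avg (fun v : {ffun 'I_m -> 'I_6} =>
    \prod_k expR (- (w / 8 * trit (v k) ^+ 2))))).
  apply: ler_avg => v.
  rewrite (@eq_avg _ _ _ (fun f : {ffun I -> 'I_m * bool} =>
      cos (\sum_l a l * ((-1) ^+ (f l).2 * trit (v (f l).1))))); last first.
    by move=> f; rewrite /G (ssum_dot a f (fun k => trit (v k))).
  rewrite (avg_cos (g := fun l (c : 'I_m * bool) =>
      a l * ((-1) ^+ c.2 * trit (v c.1)))) => [|l]; last first.
    rewrite sum_signed big1// => k _; rewrite /= expr0 expr1 mulN1r mul1r mulrN.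
    by rewrite sinN addNr.
  set H := \sum_k trit (v k) ^+ 2.
  have H0 : 0 <= H by apply: sumr_ge0 => k _; rewrite sqr_ge0.
  have w0 : 0 <= w by rewrite subr_ge0 cos_le1.
  apply: (le_trans (ler_norm _)); rewrite normr_prod.
  apply: (@le_trans _ _ (\prod_(l in W) expR (- (w * H / m%:R)))).
    rewrite [leLHS](bigID (mem W))/= -[leRHS]mulr1.
    apply: ler_pM; rewrite ?prodr_ge0//.
      apply: ler_prod => l lW; have [h1 h2] := aW l lW.
      have /andP[p1 p2] := avg_signed_cos_le v m0 b0 h1 h2.
      by rewrite normr_ge0/= ger0_norm.
    apply: prodr_ile1 => l _; rewrite normr_ge0/= /avg normrM.
    rewrite [X in _ * X]ger0_norm ?invr_ge0 ?ler0n// ler_pdivrMr ?card_signed ?mulr_gt0//.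
    rewrite mul1r -card_signed -sumr_const; apply: (le_trans (ler_norm_sum _ _ _)).
    by apply: ler_sum => c _; exact: cos_max.
  rewrite prodr_const -expRM_natr -expR_sum ler_expR sumrN -mulr_sumr -/H.
  rewrite mulNr lerN2.
  have -> : w * H / m%:R * #|W|%:R = w / 8 * H * (8 * #|W|%:R / m%:R).
    by field; rewrite gt_eqF.
  by rewrite ler_peMr ?mulr_ge0 ?divr_ge0// ler_pdivlMr// mul1r.
rewrite (avg_prod (fun _ t => expR (- (w / 8 * trit t ^+ 2)))).
rewrite prodr_const card_ord -mulNr expRM_natr.
have -> : avg (fun t => expR (- (w / 8 * trit t ^+ 2))) =
    1 - small_ball_rate beta.
  rewrite (avg_trit (fun c => expR (- (w / 8 * c ^+ 2)))) expr1n sqrrN expr1n.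
  by rewrite expr0n/= mulr0 oppr0 expR0 !mulr1 /small_ball_rate -/w; lra.
have s1 : small_ball_rate beta <= 1.
  by rewrite /small_ball_rate; have := expR_ge0 (- ((1 - cos beta) / 8)); lra.
rewrite lerXn2r ?nnegrE ?subr_ge0 ?expR_ge0//.
exact: expR_ge1Dx.
Qed.

End SmallBall.

(** * Partial sums of the random series *)

Section SignedBasisPowerSums.
Variable R : realType.

Lemma psum_sbasis (s : R) m (c : 'I_m * bool) : s != 0 ->
  psum s (sbasis R c) = 1.
Proof.
move=> s0; rewrite /psum (bigD1 c.1)//= big1 ?addr0 => [|k kc].
  by rewrite sbasisE eqxx mulr1 normrX normrN1 expr1n powR1.
by rewrite sbasisE eq_sym (negPf kc) mulr0 normr0 powR0.
Qed.

Lemma psum_ssum_le (r : R) m (I : finType) (a : I -> R) (f : I -> 'I_m * bool) :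
  0 < r -> r <= 1 -> psum r (ssum a f) <= \sum_l `|a l| `^ r.
Proof.
move=> r0 r1; apply: (le_trans (psum_sum_le _ _ r0 r1)); apply: ler_sum => l _.
by rewrite psumZ psum_sbasis ?mulr1// gt_eqF.
Qed.

End SignedBasisPowerSums.

Section PartialSums.
Variables (R : realType) (p r : R).
Hypotheses (r_gt0 : 0 < r) (ltrp : r < p).

Definition weight (j : nat) : R := (j.+1%:R `^ p^-1)^-1.

Definition pcoef n J (x : 'cV[R]_n) (l : 'I_n * 'I_J) : R :=
  x l.1 0 * weight l.2.

Definition partial_Smx n m J (f : 'I_n * 'I_J -> 'I_m * bool) : 'M[R]_(m, n) :=
  \matrix_(k, i) \sum_(j < J) weight j * sbasis R (f (i, j)) k 0.

Lemma partial_Smx_mul n m J (f : 'I_n * 'I_J -> 'I_m * bool) (x : 'cV[R]_n) :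
  partial_Smx f *m x = ssum (pcoef x) f.
Proof.
apply/matrixP => k o; rewrite (ord1 o) ssumE mxE.
transitivity (\sum_i \sum_j pcoef x (i, j) * sbasis R (f (i, j)) k 0);
  last by rewrite pair_bigA; apply: eq_bigr => -[i j].
apply: eq_bigr => i _; rewrite mxE mulr_suml; apply: eq_bigr => j _.
by rewrite /pcoef/= mulrC mulrA.
Qed.

Let p_gt0 : 0 < p. Proof. exact: lt_trans ltrp. Qed.

Lemma weightE j : weight j = j.+1%:R `^ (- p^-1).
Proof. by rewrite powRN. Qed.

Lemma weight_gt0 j : 0 < weight j.
Proof. by rewrite invr_gt0 powR_gt0. Qed.

(** In the normalisation by the threshold [t = (psum p x / M) ^ (1 / p)], the
   coefficients of the i-th series are [(u i / j) ^ (1 / p)], j >= 1. *)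
Definition ucoef n (M : R) (x : 'cV[R]_n) (i : 'I_n) : R :=
  M * `|x i 0| `^ p / psum p x.

Definition threshold n (M : R) (x : 'cV[R]_n) : R := (psum p x / M) `^ p^-1.

Lemma ucoef_ge0 n (M : R) (x : 'cV[R]_n) i : 0 <= M -> 0 <= ucoef M x i.
Proof. by move=> M0; rewrite divr_ge0 ?mulr_ge0 ?powR_ge0 ?psum_ge0. Qed.

Lemma sum_ucoef n (M : R) (x : 'cV[R]_n) : 0 < psum p x -> \sum_i ucoef M x i = M.
Proof.
move=> x0; rewrite -mulr_suml -mulr_sumr -/(psum p x) mulfK//.
by rewrite gt_eqF.
Qed.

Lemma threshold_gt0 n (M : R) (x : 'cV[R]_n) : 0 < M -> 0 < psum p x ->
  0 < threshold M x.
Proof. by move=> M0 x0; rewrite powR_gt0// divr_gt0. Qed.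

Lemma normr_threshold n (M : R) (x : 'cV[R]_n) i : 0 < M -> 0 < psum p x ->
  `|x i 0| = threshold M x * ucoef M x i `^ p^-1.
Proof.
move=> M0 x0; rewrite -powRM ?ucoef_ge0 ?divr_ge0 ?psum_ge0 ?(ltW M0)//.
have -> : psum p x / M * ucoef M x i = `|x i 0| `^ p.
  by rewrite /ucoef; field; rewrite !gt_eqF.
by rewrite -powRrM mulfV ?gt_eqF// powRr1 ?normr_ge0.
Qed.

Lemma normr_pcoef n J (M : R) (x : 'cV[R]_n) (l : 'I_n * 'I_J) :
  0 < M -> 0 < psum p x ->
  `|pcoef x l| = threshold M x * (ucoef M x l.1 / l.2.+1%:R) `^ p^-1.
Proof.
move=> M0 x0; rewrite normrM (normr_threshold _ M0 x0) (gtr0_norm (weight_gt0 _)).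
rewrite powRM ?invr_ge0 ?ucoef_ge0 ?(ltW M0)// -mulrA; congr (_ * (_ * _)).
by rewrite weightE -(powR_inv1 (ler0n R l.2.+1)) -powRrM mulN1r.
Qed.

Lemma threshold_powR n (M : R) (x : 'cV[R]_n) : 0 < M -> 0 < psum p x ->
  threshold M x `^ r * M = M `^ (1 - r / p) * psum p x `^ (r / p).
Proof.
move=> M0 x0; rewrite -powRrM [_^-1 * r]mulrC powRM ?invr_ge0 ?(ltW M0) ?psum_ge0//.
rewrite -(powR_inv1 (ltW M0)) -powRrM mulN1r -mulrA.
rewrite [RHS]mulrC [1 - _]addrC powRD ?(gt_eqF M0) ?implybT//.
by rewrite (powRr1 (ltW M0)).
Qed.

End PartialSums.

(** * The image of a fixed vector *)

Lemma half_le_ltn N j : (N./2 <= j)%N -> (N.+1 <= 2 * j.+1)%N.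
Proof. by lia. Qed.

Section FixedVector.
Variables (R : realType) (p r : R).
Hypotheses (r_gt0 : 0 < r) (ltrp : r < p) (p_lt2 : p < 2) (r_le1 : r <= 1).

Let p_gt0 : 0 < p. Proof. exact: lt_trans ltrp. Qed.

Let rho_gt0 : 0 < r / p. Proof. by rewrite divr_gt0. Qed.

Let rho_lt1 : r / p < 1. Proof. by rewrite ltr_pdivrMr// mul1r. Qed.

Lemma ssumZ m (I : finType) (a : I -> R) (c : R) (f : I -> 'I_m * bool) :
  ssum (fun l => c * a l) f = c *: ssum a f.
Proof. by rewrite /ssum scaler_sumr; apply: eq_bigr => l _; rewrite scalerA. Qed.

(** Dividing [u] by integers between [u / 2] and [u] and taking the power [1 / p]
   gives values between [1] and [lower_base^-1]; they are rescaled to at most [1],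
   where the cosine stays away from [1]. *)
Definition lower_base : R := 2 `^ (- p^-1).

Definition lower_rate : R := small_ball_rate lower_base.

Lemma lower_base_gt0 : 0 < lower_base. Proof. exact: powR_gt0. Qed.

Lemma lower_base_le1 : lower_base <= 1.
Proof.
rewrite /lower_base -[leRHS](powRr0 2) ler_powR ?ler1n//.
by rewrite oppr_le0 invr_ge0 ltW.
Qed.

Lemma lower_rate_gt0 : 0 < lower_rate.
Proof. by rewrite small_ball_rate_gt0 ?lower_base_gt0 ?lower_base_le1. Qed.

Lemma lower_rate_le1 : lower_rate <= 1.
Proof.
rewrite /lower_rate /small_ball_rate.
by have := expR_ge0 (- ((1 - cos lower_base) / 8)); lra.
Qed.

(** The small ball estimate is applied to the sum scaled by
   [lower_base / threshold]. With [u = ucoef p m x], the coefficients of the i-th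
   series that fall in [[lower_base, 1]] are those of the indices between
   [u i / 2] and [u i], and there is none if [u i < 1]: this is why the mass must
   not be concentrated on the coordinates with [u i < 1]. *)
Lemma pr_psum_small n m J (x : 'cV[R]_n) : (0 < m)%N -> (m <= J)%N ->
  0 < psum p x ->
  m%:R / 2 <= \sum_(i | 1 <= ucoef p m%:R x i) ucoef p m%:R x i ->
  pr R (fun f : {ffun 'I_n * 'I_J -> 'I_m * bool} =>
    psum r (ssum (pcoef p x) f) <
    lower_rate / 4 * (m%:R `^ (1 - r / p) * psum p x `^ (r / p))) <=
  expR (- (lower_rate / 2 * m%:R)).
Proof.
move=> m0 mJ x0 hx; have mp : 0 < m%:R :> R by rewrite ltr0n.
set t := threshold p m%:R x.
have t0 : 0 < t by exact: threshold_gt0.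
set b := lower_base; have b0 : 0 < b := lower_base_gt0.
have bN0 : b / t != 0 by rewrite gt_eqF// divr_gt0.
pose u := ucoef p m%:R x.
have u0 i : 0 <= u i by apply: ucoef_ge0; exact: ltW.
have um i : u i <= m%:R.
  by rewrite -(sum_ucoef m%:R x0) (bigD1 i)//= lerDl sumr_ge0// => k _; exact: u0.
pose W := finset (fun l : 'I_n * 'I_J => (1 <= u l.1) &&
  ((Num.truncn (u l.1))./2 <= l.2 < Num.truncn (u l.1))%N).
pose a (l : 'I_n * 'I_J) := b / t * pcoef p x l.
have aW l : l \in W -> b <= `|a l| /\ `|a l| <= 1.
  rewrite inE => /and3P[u1 h1 h2].
  have aE : `|a l| = b * (u l.1 / l.2.+1%:R) `^ p^-1.
    rewrite normrM (normr_pcoef r_gt0 ltrp l mp x0)//.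
    by rewrite gtr0_norm ?divr_gt0// -/t -/u mulrA divfK ?gt_eqF.
  have /andP[N1 N2] := truncn_itv (u0 l.1).
  have l0 : 0 < l.2.+1%:R :> R by rewrite ltr0n.
  rewrite aE; split.
    rewrite ler_peMr ?(ltW b0)// -[leLHS](@one_powR R p^-1).
    apply: ge0_ler_powR; rewrite ?nnegrE ?invr_ge0 ?(ltW p_gt0)//.
      by rewrite divr_ge0.
    by rewrite ler_pdivlMr// mul1r (le_trans _ N1)// ler_nat.
  rewrite /b /lower_base powRN mulrC -[leLHS]/(_ / _) ler_pdivrMr ?powR_gt0// mul1r.
  apply: ge0_ler_powR; rewrite ?nnegrE ?invr_ge0 ?(ltW p_gt0)//.
    by rewrite divr_ge0.
  rewrite ler_pdivrMr// -natrM; apply: (le_trans (ltW N2)); rewrite ler_nat.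
  exact: half_le_ltn h1.
have cW : m%:R <= 8 * #|W|%:R :> R.
  have -> : #|W|%:R = \sum_i \sum_(j < J) ((1 <= u i) &&
      ((Num.truncn (u i))./2 <= j < Num.truncn (u i))%N)%:R :> R.
    rewrite pair_bigA -sum1_card natr_sum big_mkcond/=.
    by apply: eq_bigr => l _; rewrite inE; case: ifP => // ->.
  apply: (@le_trans _ _ (8 * \sum_(i | 1 <= u i) u i / 4)).
    rewrite -mulr_suml; move: hx; rewrite -/u; set V := \sum_(i | _) _; lra.
  rewrite ler_pM2l// big_mkcond/=; apply: ler_sum => i _.
  case: ifPn => u1; last by apply: sumr_ge0.
  by apply: sum_window => //; rewrite (le_trans (um i))// ler_nat.
have := avg_exp_psum_le r_gt0 r_le1 m0 (ltW b0) aW cW.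
rewrite -/(lower_rate) => hE.
have c0 := lower_rate_gt0.
apply: (le_trans (markov_avg (c := expR (- (lower_rate / 2 * m%:R)))
  (F := fun f : {ffun 'I_n * 'I_J -> 'I_m * bool} =>
     expR (- (2 * psum r (ssum a f)))) _ _ _)).
- exact: expR_gt0.
- by move=> f; exact: expR_ge0.
- move=> f /= /ltW hf; rewrite ler_expR lerN2 ssumZ psumZ.
  rewrite gtr0_norm ?divr_gt0//.
  move: hf; rewrite -(threshold_powR r mp x0) -/t => hf.
  have bt : (b / t) `^ r <= (t `^ r)^-1.
    rewrite powRM ?invr_ge0 ?(ltW b0) ?(ltW t0)// -(powR_inv1 (ltW t0)) powRAC.
    rewrite powR_inv1 ?powR_ge0//.
    rewrite ler_piMl ?invr_ge0 ?powR_ge0// -[leRHS](@one_powR R r).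
    by apply: ge0_ler_powR; rewrite ?nnegrE ?lower_base_le1// ltW.
  have tr0 : 0 < t `^ r by rewrite powR_gt0.
  apply: (@le_trans _ _ (2 * ((t `^ r)^-1 * (lower_rate / 4 * (t `^ r * m%:R))))).
    by rewrite ler_pM2l// ler_pM ?psum_ge0 ?powR_ge0.
  rewrite le_eqVlt; apply/orP; left; apply/eqP; field.
  by rewrite gt_eqF.
- rewrite ler_pdivrMr ?expR_gt0// -expRD; apply: (le_trans hE).
  rewrite ler_expR; lra.
Qed.

(** Bounds the sum of the squares of the coefficients of a series that lie below the
   threshold; it is finite because [2 / p > 1]. *)
Definition tail_const : R := (2 / p + 2 `^ (2 / p - 1)) / (2 / p - 1).

Let s_gt1 : 1 < 2 / p. Proof. by rewrite ltr_pdivlMr// mul1r. Qed.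

Lemma tail_const_gt0 : 0 < tail_const.
Proof.
by rewrite /tail_const divr_gt0 ?subr_gt0// addr_gt0 ?powR_gt0// divr_gt0.
Qed.

Lemma sum_tail_le (u : R) J : 0 <= u ->
  \sum_(j < J | u < j.+1%:R) (u / j.+1%:R) `^ (2 / p) <= tail_const * u.
Proof.
move=> u0; set s := 2 / p.
have s0 : 0 < s - 1 by rewrite subr_gt0; exact: s_gt1.
have sp : 0 < s by exact: lt_trans s_gt1.
rewrite (eq_bigr (fun j : 'I_J => u `^ s * j.+1%:R `^ (- s))); last first.
  move=> j _; rewrite powRM ?invr_ge0//; congr (_ * _).
  by rewrite -(powR_inv1 (ler0n R j.+1)) -powRrM mulN1r.
rewrite -mulr_sumr.
have tE : tail_const = s / (s - 1) + 2 `^ (s - 1) / (s - 1).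
  by rewrite /tail_const -/s mulrDl.
have [u1|u1] := ltP u 1.
  apply: (@le_trans _ _ (u `^ s * (s / (s - 1)))).
    rewrite ler_wpM2l ?powR_ge0//.
    apply: (@le_trans _ _ (\sum_(0 <= j < J.+1) j.+1%:R `^ (- s))).
      rewrite big_mkord big_mkcond big_ord_recr/=.
      rewrite -[leLHS]addr0 lerD ?powR_ge0// ler_sum// => j _.
      by case: ifP => // _; exact: powR_ge0.
    rewrite big_ltn// powR1.
    have := @sum_powRN_tail R s 1 J.+1 s_gt1 isT; rewrite powR1.
    set V := \sum_(_ <= _ < _) _ => hV.
    apply: (le_trans (lerD (lexx 1) hV)).
    rewrite le_eqVlt; apply/orP; left; apply/eqP; field; exact: lt0r_neq0.
  rewrite [leRHS]mulrC; apply: ler_pM;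
    rewrite ?powR_ge0 ?divr_ge0 ?(ltW s0) ?(ltW sp) ?(ltW p_gt0)//.
    have := u0; rewrite le_eqVlt => /predU1P[<-|up].
      by rewrite powR0// gt_eqF.
    by rewrite ge1r_powR// ?up ?(ltW u1)// ltW.
  by rewrite tE lerDl divr_ge0 ?powR_ge0// ltW.
have /andP[N1 N2] := truncn_itv u0.
set N := Num.truncn u in N1 N2.
have N0 : (0 < N)%N by rewrite -ltnS -(ltr_nat R) (le_lt_trans u1).
have up : 0 < u by exact: lt_le_trans u1.
have Nu : u / 2 <= N%:R.
  rewrite ler_pdivrMr// -natrM; apply: (le_trans (ltW N2)); rewrite ler_nat.
  by rewrite muln2 -addnn -addn1 leq_add2l.
apply: (@le_trans _ _ (u `^ s * (\sum_(N <= j < N + J) j.+1%:R `^ (- s)))).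
  rewrite ler_wpM2l ?powR_ge0//.
  rewrite -(big_mkord (fun j => u < j.+1%:R) (fun j => j.+1%:R `^ (- s))).
  rewrite [leLHS](@big_nat_widen _ _ _ 0 J (N + J))/=; last by rewrite leq_addl.
  rewrite (big_cat_nat (n := N)) ?leq_addr//=.
  rewrite [X in X + _]big_nat_cond [X in X + _]big1 ?add0r => [|j]; last first.
    move=> /andP[/andP[_ jN] /andP[uj _]].
    have := lt_le_trans uj (_ : j.+1%:R <= N%:R); rewrite ler_nat => /(_ jN).
    by rewrite ltNge N1.
  rewrite [leLHS]big_mkcond/= ler_sum// => j _.
  by case: ifP => // _; exact: powR_ge0.
apply: (@le_trans _ _ (u `^ s * ((u / 2) `^ (1 - s) / (s - 1)))).
  rewrite ler_wpM2l ?powR_ge0//; apply: (le_trans (sum_powRN_tail _ s_gt1 N0)).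
  rewrite ler_pM2r ?invr_gt0// -[1 - s]opprB !powRN.
  rewrite lef_pV2 ?posrE ?powR_gt0 ?divr_gt0 ?ltr0n//.
  by apply: ge0_ler_powR; rewrite ?nnegrE ?divr_ge0// ltW.
rewrite powRM ?invr_ge0// mulrA mulrA -powRD ?(gt_eqF up) ?implybT//.
rewrite addrC subrK powRr1// tE mulrC [leRHS]mulrC.
have -> : 2^-1 `^ (1 - s) = 2 `^ (s - 1) :> R.
  by rewrite -powR_inv1// -powRrM mulN1r opprB.
rewrite mulrCA ler_wpM2l// [_^-1 * _]mulrC lerDr divr_ge0// ltW//.
Qed.

(** The coefficients above the threshold are [r]-summable because [r / p < 1]. *)
Lemma sum_head_le (u : R) J : 0 <= u ->
  \sum_(j < J | j.+1%:R <= u) (u / j.+1%:R) `^ (r / p) <= u / (1 - r / p).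
Proof.
move=> u0; set s := r / p.
rewrite (eq_bigr (fun j : 'I_J => u `^ s * j.+1%:R `^ (- s))); last first.
  move=> j _; rewrite powRM ?invr_ge0//; congr (_ * _).
  by rewrite -(powR_inv1 (ler0n R j.+1)) -powRrM mulN1r.
have s0 : 0 < 1 - s by rewrite subr_gt0; exact: rho_lt1.
rewrite -mulr_sumr.
have /andP[N1 N2] := truncn_itv u0; set N := Num.truncn u in N1 N2.
apply: (@le_trans _ _ (u `^ s * (\sum_(0 <= j < N) j.+1%:R `^ (- s)))).
  rewrite ler_wpM2l ?powR_ge0//.
  rewrite -(big_mkord (fun j => j.+1%:R <= u) (fun j => j.+1%:R `^ (- s))).
  rewrite [leLHS](@big_nat_widen _ _ _ 0 J (N + J))/=; last by rewrite leq_addl.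
  rewrite (big_cat_nat (n := N)) ?leq_addr//=.
  rewrite [X in _ + X]big_nat_cond [X in _ + X]big1 ?addr0 => [|j]; last first.
    move=> /andP[/andP[Nj _] /andP[uj _]].
    have := lt_le_trans N2 (_ : N.+1%:R <= j.+1%:R); rewrite ler_nat => /(_ Nj).
    by rewrite ltNge uj.
  rewrite [leLHS]big_mkcond/= ler_sum// => j _.
  by case: ifP => // _; exact: powR_ge0.
apply: (@le_trans _ _ (u `^ s * (u `^ (1 - s) / (1 - s)))).
  rewrite ler_wpM2l ?powR_ge0//; apply: (le_trans (sum_powRN_le _ rho_gt0 rho_lt1)).
  rewrite ler_pM2r ?invr_gt0//.
  by apply: ge0_ler_powR; rewrite ?nnegrE// ltW.
have := u0; rewrite le_eqVlt => /predU1P[<-|up].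
  by rewrite powR0 ?gt_eqF// !mul0r.
by rewrite mulrA -powRD ?(gt_eqF up) ?implybT// subrKC powRr1.
Qed.

(** With this value [D], the ratio of [exp ((1 + 2 tail_const) M)], which bounds the
   exponential moment, to [exp (D M)] is [exp (- 2 M)]. *)
Definition deviation : R := 3 + 2 * tail_const.

Definition upper_const : R := (1 - r / p)^-1 + deviation.

Lemma deviation_ge1 : 1 <= deviation.
Proof. by rewrite /deviation; have := tail_const_gt0; lra. Qed.

Lemma upper_const_ge1 : 1 <= upper_const.
Proof.
rewrite (le_trans deviation_ge1)// lerDr invr_ge0 subr_ge0.
exact: ltW.
Qed.

(** The coefficients above the threshold contribute a deterministic amount in
   l_r; those below have small variance, and their sum is controlled in l_1 by
   an exponential moment. *)
Lemma pr_psum_large n m J (x : 'cV[R]_n) (M : R) : (0 < m)%N -> m%:R <= M ->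
  pr R (fun f : {ffun 'I_n * 'I_J -> 'I_m * bool} =>
    upper_const * (M `^ (1 - r / p) * psum p x `^ (r / p)) <
    psum r (ssum (pcoef p x) f)) <= expR (- (2 * M)).
Proof.
move=> m0 mM; have mp : 0 < m%:R :> R by rewrite ltr0n.
have M0 : 0 < M by exact: lt_le_trans mM.
have [xE|xn0] := eqVneq (psum p x) 0.
  rewrite /pr (@eq_avg _ _ _ (fun=> 0)) => [|f]; last first.
    have x0 := psum_eq0 xE.
    have -> : ssum (pcoef p x) f = 0.
      by rewrite /ssum big1// => l _; rewrite /pcoef x0 mxE mul0r scale0r.
    by rewrite xE powR0 ?gt_eqF// !mulr0 psum0 ?gt_eqF// ltxx.
  by rewrite /avg big1// mul0r expR_ge0.
have x0 : 0 < psum p x by rewrite lt_neqAle eq_sym xn0 psum_ge0.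
set t := threshold p M x; have t0 : 0 < t by exact: threshold_gt0.
pose u := ucoef p M x.
have u0 i : 0 <= u i by apply: ucoef_ge0; exact: ltW.
pose big (l : 'I_n * 'I_J) := l.2.+1%:R <= u l.1.
pose a1 l := if big l then pcoef p x l else 0.
pose a2 l := if big l then 0 else pcoef p x l.
have aE f : ssum (pcoef p x) f = ssum a1 f + ssum a2 f :> 'cV[R]_m.
  rewrite /ssum -big_split; apply: eq_bigr => l _ /=.
  by rewrite -scalerDl /a1 /a2; case: ifP; rewrite ?addr0 ?add0r.
have nE l : `|pcoef p x l| = t * (u l.1 / l.2.+1%:R) `^ p^-1.
  exact: (normr_pcoef r_gt0 ltrp).
have tM : t `^ r * M = M `^ (1 - r / p) * psum p x `^ (r / p).
  exact: threshold_powR.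
have h1 (f : 'I_n * 'I_J -> 'I_m * bool) :
    psum r (ssum a1 f) <= (1 - r / p)^-1 * (t `^ r * M).
  apply: (le_trans (psum_ssum_le _ _ r_gt0 r_le1)).
  rewrite (eq_bigr (fun l : 'I_n * 'I_J => if big l then
      t `^ r * (u l.1 / l.2.+1%:R) `^ (r / p) else 0)); last first.
    move=> l _; rewrite /a1; case: ifP => _; last by rewrite normr0 powR0// gt_eqF.
    by rewrite nE powRM ?powR_ge0 ?(ltW t0)// -powRrM [_^-1 * _]mulrC.
  rewrite -(pair_bigA _ (fun i (j : 'I_J) => if j.+1%:R <= u i then
      t `^ r * (u i / j.+1%:R) `^ (r / p) else 0))/=.
  apply: (@le_trans _ _ (\sum_i t `^ r * (u i / (1 - r / p)))).
    apply: ler_sum => i _; rewrite -big_mkcond/= -mulr_sumr ler_wpM2l ?powR_ge0//.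
    exact: sum_head_le.
  by rewrite -mulr_sumr -mulr_suml (sum_ucoef _ x0) mulrA [leLHS]mulrC.
have h2 : \sum_l (t^-1 * a2 l) ^+ 2 <= tail_const * M.
  rewrite (eq_bigr (fun l : 'I_n * 'I_J => if u l.1 < l.2.+1%:R then
      (u l.1 / l.2.+1%:R) `^ (2 / p) else 0)); last first.
    move=> l _; rewrite /a2 /big ltNge; case: ifP => _ /=.
      by rewrite mulr0 expr0n.
    rewrite -real_normK ?num_real// normrM nE gtr0_norm ?invr_gt0//.
    rewrite mulKf ?gt_eqF// -powR_mulrn ?powR_ge0// -powRrM.
    by rewrite [_^-1 * _]mulrC.
  rewrite -(pair_bigA _ (fun i (j : 'I_J) => if u i < j.+1%:R then
      (u i / j.+1%:R) `^ (2 / p) else 0))/=.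
  apply: (@le_trans _ _ (\sum_i tail_const * u i)).
    by apply: ler_sum => i _; rewrite -big_mkcond/=; exact: sum_tail_le.
  by rewrite -mulr_sumr (sum_ucoef _ x0).
pose S2 (f : {ffun 'I_n * 'I_J -> 'I_m * bool}) : R :=
  \sum_k `|ssum (fun l => t^-1 * a2 l) f k 0|.
have S2E (f : {ffun 'I_n * 'I_J -> 'I_m * bool}) : \sum_k `|ssum a2 f k 0| = t * S2 f.
  rewrite /S2 ssumZ mulr_sumr; apply: eq_bigr => k _.
  by rewrite mxE normrM gtr0_norm ?invr_gt0// mulVKf ?gt_eqF.
have S20 f : 0 <= S2 f by apply: sumr_ge0.
have hE : avg (fun f => expR (S2 f)) <= expR ((1 + 2 * tail_const) * M).
  apply: (le_trans (avg_exp_norm1 m0 _)).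
  apply: (@le_trans _ _ (expR M * expR (2 * (tail_const * M)))).
    apply: ler_pM; rewrite ?exprn_ge0 ?expR_ge0//.
      apply: (@le_trans _ _ (expR m%:R)); last by rewrite ler_expR.
      rewrite -[m%:R]mul1r expRM_natr lerXn2r ?nnegrE ?expR_ge0//.
      by have := expR_ge1Dx (1 : R); rewrite -natr1; lra.
    by rewrite ler_expR ler_wpM2l.
  by rewrite -expRD ler_expR; lra.
apply: (le_trans (markov_avg (c := expR (deviation * M))
  (F := fun f : {ffun 'I_n * 'I_J -> 'I_m * bool} => expR (S2 f))
  _ _ _)).
- exact: expR_gt0.
- by move=> f; exact: expR_ge0.
- move=> f /= hf; rewrite ler_expR leNgt; apply/negP => hS.
  move: hf; rewrite ltNge => /negP; apply.
  rewrite aE; apply: (le_trans (psumD_le _ _ r_gt0 r_le1)).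
  rewrite mulrDl -tM; apply: lerD; first exact: h1.
  have := @psum_mean_le R r 1 m (ssum a2 f) r_gt0 r_le1.
  have -> : psum 1 (ssum a2 f) = t * S2 f.
    by rewrite -S2E; apply: eq_bigr => k _; rewrite powRr1.
  rewrite divr1; move/le_trans; apply.
  have r10 : 0 <= 1 - r by rewrite subr_ge0.
  apply: (@le_trans _ _ (M `^ (1 - r) * (t * (deviation * M)) `^ r)).
    apply: ler_pM; rewrite ?powR_ge0//.
      by apply: ge0_ler_powR; rewrite ?nnegrE ?(ltW M0).
    apply: ge0_ler_powR; rewrite ?nnegrE ?mulr_ge0 ?(ltW t0) ?(ltW r_gt0) ?(ltW M0)//.
      by rewrite (le_trans ler01)// deviation_ge1.
    by rewrite ler_pM2l// ltW.
  have d1 := deviation_ge1; have d0 : 0 < deviation by exact: lt_le_trans d1.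
  rewrite powRM ?mulr_ge0 ?(ltW t0) ?(ltW M0) ?(ltW d0)//.
  rewrite powRM ?(ltW M0) ?(ltW d0)//.
  have -> : M `^ (1 - r) * (t `^ r * (deviation `^ r * M `^ r)) =
      deviation `^ r * (t `^ r * (M `^ (1 - r) * M `^ r)) by ring.
  rewrite -powRD ?(gt_eqF M0) ?implybT// subrK powRr1 ?(ltW M0)//.
  rewrite ler_pM2r ?mulr_gt0 ?(powR_gt0 _ t0)//.
  exact: ler1_powR.
- rewrite ler_pdivrMr ?expR_gt0// -expRD; apply: (le_trans hE).
  by rewrite ler_expR /deviation; lra.
Qed.

End FixedVector.

(** * From sparse vectors to all vectors *)

Section Sparse.
Variables (R : realType) (p r : R).
Hypotheses (r_gt0 : 0 < r) (ltrp : r < p) (r_le1 : r <= 1).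

Let p_gt0 : 0 < p. Proof. exact: lt_trans ltrp. Qed.

Let rho_gt0 : 0 < r / p. Proof. by rewrite divr_gt0. Qed.

Let rho_lt1 : r / p < 1. Proof. by rewrite ltr_pdivrMr// mul1r. Qed.

Definition supp n (x : 'cV[R]_n) := finset (fun i => x i 0 != 0).

Definition restr n (B : {set 'I_n}) (x : 'cV[R]_n) : 'cV[R]_n :=
  \col_i (if i \in B then x i 0 else 0).

Lemma psum_restrD n (B : {set 'I_n}) (x : 'cV[R]_n) s : s != 0 ->
  psum s x = psum s (restr B x) + psum s (x - restr B x).
Proof.
move=> s0; rewrite /psum -big_split; apply: eq_bigr => i _ /=; rewrite !mxE.
by case: ifP => _; rewrite ?subrr ?subr0 normr0 powR0// ?addr0 ?add0r.
Qed.

Lemma psum_restr n (B : {set 'I_n}) (x : 'cV[R]_n) s : s != 0 ->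
  psum s (restr B x) = \sum_(i in B) `|x i 0| `^ s.
Proof.
move=> s0; rewrite [RHS]big_mkcond; apply: eq_bigr => i _ /=; rewrite !mxE.
by case: ifP => // _; rewrite normr0 powR0.
Qed.

Lemma card_supp_restr n (B : {set 'I_n}) (x : 'cV[R]_n) :
  (#|supp (restr B x)| <= #|B|)%N.
Proof.
apply: subset_leq_card; apply/fintype.subsetP => i; rewrite inE mxE.
by case: ifP => //; rewrite eqxx.
Qed.

Lemma psum_le_card n (x : 'cV[R]_n) (k : nat) (b s : R) : 0 < s -> 0 <= b ->
  (#|supp x| <= k)%N -> (forall i, `|x i 0| <= b) -> psum s x <= k%:R * b `^ s.
Proof.
move=> s0 b0 xk xb; rewrite /psum (bigID (mem (supp x)))/=.
rewrite [X in _ + X]big1 ?addr0 => [|i]; last first.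
  by rewrite inE negbK => /eqP ->; rewrite normr0 powR0// gt_eqF.
apply: (@le_trans _ _ (\sum_(i in supp x) b `^ s)).
  by apply: ler_sum => i _; apply: ge0_ler_powR; rewrite ?nnegrE// ltW.
by rewrite sumr_const -[leLHS]mulr_natl ler_wpM2r ?powR_ge0 ?ler_nat.
Qed.

(** At each step a maximal coordinate among the remaining ones is selected. *)
Lemma exists_largest n (x : 'cV[R]_n) k : (k <= n)%N ->
  exists (B : {set 'I_n}) (b : R), [/\ #|B| = k, 0 <= b,
    forall i, i \in B -> b <= `|x i 0| & forall i, i \notin B -> `|x i 0| <= b].
Proof.
elim: k => [_|k IH kn].
  exists finset.set0, (\sum_i `|x i 0|); split.
  - by rewrite cards0.
  - by apply: sumr_ge0.
  - by move=> i; rewrite inE.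
  - by move=> i _; rewrite (bigD1 i)//= lerDl sumr_ge0.
have [B [b [Bk b0 Bb bB]]] := IH (ltnW kn).
have [i0 i0B] : exists i, i \notin B.
  have : (0 < #|~: B|)%N by rewrite cardsCs finset.setCK Bk card_ord subn_gt0.
  by case/card_gt0P => i; rewrite inE; exists i.
pose i1 := [arg max_(i > i0 | i \notin B) `|x i 0|]%O.
have [i1B i1max] : i1 \notin B /\ forall i, i \notin B -> `|x i 0| <= `|x i1 0|.
  by rewrite /i1; case: arg_maxP.
exists (i1 |: B)%SET, `|x i1 0|; split => //.
- by rewrite cardsU1 i1B Bk.
- move=> i; rewrite !inE => /orP[/eqP ->//|iB].
  exact: le_trans (bB _ i1B) (Bb _ iB).
- by move=> i; rewrite !inE negb_or => /andP[_]; exact: i1max.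
Qed.

Section Operator.
Variables (n m : nat) (S : 'M[R]_(m, n)) (k : nat).
Hypotheses (k_gt0 : (0 < k)%N) (k_le : (k <= n)%N).

Let kR : 0 < k%:R :> R. Proof. by rewrite ltr0n. Qed.

Lemma psum_mulmxD (x y : 'cV[R]_n) :
  psum r (S *m x) <= psum r (S *m y) + psum r (S *m (x - y)).
Proof.
by rewrite -{1}(subrKC y x) mulmxDr; exact: psumD_le.
Qed.

Variable U : R.
Hypothesis U0 : 0 <= U.
Hypothesis sparse_le : forall x : 'cV[R]_n, (#|supp x| <= k)%N ->
  psum r (S *m x) <= U * psum p x `^ (r / p).

(** Compares the l_p size of [k] entries at most [b] with the l_r mass of [k] entries
   at least [b]. *)
Lemma block_le (b : R) (B : {set 'I_n}) (x : 'cV[R]_n) : 0 <= b -> #|B| = k ->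
  (forall i, i \in B -> b <= `|x i 0|) ->
  k%:R `^ (r / p) * b `^ r <= k%:R `^ (r / p - 1) * psum r (restr B x).
Proof.
move=> b0 Bk Bb; rewrite powRB ?(gt_eqF kR) ?implybT// powRr1 ?(ltW kR)//.
rewrite -mulrA ler_wpM2l ?powR_ge0// mulrC ler_pdivlMr//.
rewrite psum_restr ?gt_eqF//.
rewrite mulr_natr -Bk -sumr_const; apply: ler_sum => i iB.
by apply: ge0_ler_powR; rewrite ?nnegrE ?Bb// ltW.
Qed.

(** The coordinates are removed by blocks, the [k] largest first. The l_p
   contribution of a block is dominated by the l_r mass of the preceding one,
   because the entries of the latter are larger. *)
Lemma psum_mulmx_flat (b : R) (x : 'cV[R]_n) : 0 <= b ->
  (forall i, `|x i 0| <= b) ->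
  psum r (S *m x) <= U * (k%:R `^ (r / p) * b `^ r +
                          k%:R `^ (r / p - 1) * psum r x).
Proof.
have [N] := ubnP #|supp x|; elim: N x b => // N IH x b xN b0 xb.
have [B [c [Bk c0 Bc cB]]] := exists_largest x k_le.
apply: (le_trans (psum_mulmxD x (restr B x))).
have h1 : psum r (S *m restr B x) <= U * (k%:R `^ (r / p) * b `^ r).
  apply: (le_trans (sparse_le _)); first by rewrite -[leqRHS]Bk card_supp_restr.
  rewrite ler_wpM2l//.
  have -> : k%:R `^ (r / p) * b `^ r = (k%:R * b `^ p) `^ (r / p).
    rewrite powRM ?powR_ge0//; congr (_ * _).
    by rewrite -powRrM mulrCA mulfV ?mulr1 ?gt_eqF.
  apply: ge0_ler_powR; rewrite ?(ltW rho_gt0) ?nnegrE ?psum_ge0 ?mulr_ge0 ?powR_ge0 ?ler0n//.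
  apply: psum_le_card => //; first by rewrite -[leqRHS]Bk card_supp_restr.
  by move=> i; rewrite mxE; case: ifP; rewrite ?normr0.
rewrite mulrDr; apply: lerD => //.
have yc i : `|(x - restr B x) i 0| <= c.
  by rewrite !mxE; case: ifP => iB; rewrite ?subrr ?normr0 ?subr0 ?cB ?iB.
rewrite (psum_restrD B x (lt0r_neq0 r_gt0)) mulrDr.
have h2 := block_le c0 Bk Bc.
have [cE|cn0] := eqVneq c 0.
  have -> : x - restr B x = 0.
    apply/matrixP => i j; rewrite (ord1 j) [RHS]mxE; apply/eqP.
    by rewrite -normr_le0 -cE yc.
  rewrite mulmx0 !psum0 ?gt_eqF// mulr0 addr0.
  by rewrite !mulr_ge0 ?powR_ge0 ?psum_ge0.
have cp : 0 < c by rewrite lt_neqAle eq_sym cn0.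
apply: (le_trans (IH _ c _ c0 yc)); last by rewrite ler_wpM2l// lerD2r.
have BS : B \subset supp x.
  apply/fintype.subsetP => i iB; rewrite inE -normr_gt0.
  exact: lt_le_trans cp (Bc _ iB).
apply: (@leq_ltn_trans #|supp x :\: B|).
  apply: subset_leq_card; apply/fintype.subsetP => i; rewrite !inE !mxE.
  by case: ifP; rewrite ?subrr ?eqxx ?subr0.
have SB : (k <= #|supp x|)%N by rewrite -[leqLHS]Bk subset_leq_card.
rewrite cardsDS// Bk; apply: leq_trans (_ : #|supp x| <= N)%N; last by [].
by rewrite ltn_subrL k_gt0 (leq_trans k_gt0 SB).
Qed.

Lemma split_largest (x : 'cV[R]_n) : exists B : {set 'I_n},
  [/\ (#|supp (restr B x)| <= k)%N,
      psum r (S *m (x - restr B x)) <= U * (k%:R `^ (r / p - 1) * psum r x) &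
      psum p (x - restr B x) `^ (r / p) <= k%:R `^ (r / p - 1) * psum r x].
Proof.
have [B [c [Bk c0 Bc cB]]] := exists_largest x k_le; exists B.
have yc i : `|(x - restr B x) i 0| <= c.
  by rewrite !mxE; case: ifP => iB; rewrite ?subrr ?normr0 ?subr0 ?cB ?iB.
have rn0 : r != 0 by rewrite gt_eqF.
have h2 := block_le c0 Bk Bc; split.
- by rewrite -[leqRHS]Bk card_supp_restr.
- apply: (le_trans (psum_mulmx_flat c0 yc)); rewrite ler_wpM2l//.
  by rewrite (psum_restrD B x rn0) mulrDr lerD2r.
- have c1 : k%:R * c `^ r <= psum r x.
    rewrite (psum_restrD B x rn0) psum_restr//.
    rewrite -[leLHS]addr0 lerD ?psum_ge0// mulr_natl -Bk -sumr_const.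
    apply: ler_sum => i iB.
    by apply: ge0_ler_powR; rewrite ?nnegrE ?Bc// ltW.
  have e : (p - r) * (r / p) = r * (1 - r / p).
    by field; rewrite gt_eqF.
  have pr0 : 0 < p - r by rewrite subr_gt0.
  have h3 : psum p (x - restr B x) <= c `^ (p - r) * psum r x.
    rewrite [psum r x](psum_restrD B x rn0) mulrDr -[leLHS]add0r lerD//.
      by rewrite mulr_ge0 ?powR_ge0 ?psum_ge0.
    rewrite /psum mulr_sumr; apply: ler_sum => i _.
    have -> : `|(x - restr B x) i 0| `^ p =
        `|(x - restr B x) i 0| `^ (p - r) * `|(x - restr B x) i 0| `^ r.
      by rewrite -powRD subrK// gt_eqF.
    rewrite ler_wpM2r ?powR_ge0//.
    by apply: ge0_ler_powR; rewrite ?nnegrE// ltW.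
  apply: (@le_trans _ _ ((c `^ (p - r) * psum r x) `^ (r / p))).
    by apply: ge0_ler_powR; rewrite ?(ltW rho_gt0) ?nnegrE ?mulr_ge0 ?powR_ge0 ?psum_ge0.
  rewrite powRM ?powR_ge0 ?psum_ge0// -powRrM e powRrM.
  apply: (@le_trans _ _ ((psum r x / k%:R) `^ (1 - r / p) * psum r x `^ (r / p))).
    rewrite ler_wpM2r ?powR_ge0//; apply: ge0_ler_powR.
    + by rewrite subr_ge0 ltW.
    + by rewrite nnegrE powR_ge0.
    + by rewrite nnegrE divr_ge0 ?psum_ge0.
    + by rewrite ler_pdivlMr// mulrC.
  rewrite powRM ?psum_ge0 ?invr_ge0// -(powR_inv1 (ltW kR)) -powRrM mulN1r opprB.
  have [->|xn0] := eqVneq (psum r x) 0.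
    by rewrite powR0 ?gt_eqF ?subr_gt0// !mul0r mulr0.
  rewrite [leLHS]mulrAC -powRD ?subrK ?powRr1 ?psum_ge0// ?xn0 ?implybT//.
  by rewrite mulrC.
Qed.

Lemma psum_mulmx_le (x : 'cV[R]_n) : psum r (S *m x) <=
  U * (psum p x `^ (r / p) + k%:R `^ (r / p - 1) * psum r x).
Proof.
have [B [Bk h1 _]] := split_largest x.
have h2 := sparse_le Bk.
apply: (le_trans (psum_mulmxD x (restr B x))); rewrite mulrDr; apply: lerD h1.
apply: (le_trans h2); apply: (ler_wpM2l U0).
apply: ge0_ler_powR; rewrite ?nnegrE ?psum_ge0 ?(ltW rho_gt0)//.
by rewrite (psum_restrD B x (lt0r_neq0 p_gt0)) lerDl psum_ge0.
Qed.

(** A vector is either close in l_p to its [k] largest coordinates, or large in l_r;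
   both cases are covered by one inequality. *)
Lemma psum_mulmx_ge (a : R) : 0 <= a ->
  (forall x : 'cV[R]_n, (#|supp x| <= k)%N ->
    a * psum p x `^ (r / p) <= psum r (S *m x)) ->
  forall x, a * psum p x `^ (r / p) <=
    psum r (S *m x) + (a + U) * (k%:R `^ (r / p - 1) * psum r x).
Proof.
move=> a0 ha x; have [B [Bk h1 h2]] := split_largest x.
have h3 : psum p x `^ (r / p) <= psum p (restr B x) `^ (r / p) +
    psum p (x - restr B x) `^ (r / p).
  rewrite (psum_restrD B x (lt0r_neq0 p_gt0)).
  by apply: powR_subadd; rewrite ?psum_ge0// ltW.
have h4 := ha _ Bk.
have h5 : psum r (S *m restr B x) <=
    psum r (S *m x) + psum r (S *m (x - restr B x)).
  apply: (le_trans (psum_mulmxD _ x)); rewrite lerD2l.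
  by rewrite -[restr B x - x]opprB mulmxN psumN.
have h6 := ler_wpM2l a0 (le_trans h3 (lerD (lexx _) h2)).
rewrite mulrDr in h6.
apply: (le_trans h6); apply: (le_trans (lerD h4 (lexx _))).
apply: (le_trans (lerD h5 (lexx _))); rewrite -addrA lerD2l mulrDl addrC.
by rewrite lerD2l.
Qed.

End Operator.
End Sparse.

(** * A net of lattice points *)

Section Net.
Variables (R : realType) (p : R).
Hypothesis p_gt0 : 0 < p.

(** Zero has a single code: with a code for each sign, the net would be larger by
   a factor exponential in [n]. *)
Definition ival Z (c : option (bool * 'I_Z)) : R :=
  if c is Some (s, j) then (-1) ^+ s * j.+1%:R else 0.

Definition ivec n Z (z : {ffun 'I_n -> option (bool * 'I_Z)}) : 'cV[R]_n :=
  \col_i ival (z i).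

Definition net n Z (Q : R) :=
  finset (fun z : {ffun 'I_n -> option (bool * 'I_Z)} => psum p (ivec z) <= Q).

(** Chernoff bound for the number of lattice points in an l_p ball; it counts
   the choice of a support and of its entries at the same time. *)
Lemma card_net_le n Z (Q theta : R) : 2 / p <= theta ->
  #|net n Z Q|%:R <= expR (theta * Q + 4 * expR (- theta) * n%:R).
Proof.
move=> pth; have th0 : 0 < theta by apply: lt_le_trans pth; rewrite divr_gt0.
apply: (@le_trans _ _ (\sum_(z : {ffun 'I_n -> option (bool * 'I_Z)})
    expR (theta * Q) * \prod_i expR (- (theta * `|ival (z i)| `^ p)))).
  rewrite -sum1_card natr_sum big_mkcond/=; apply: ler_sum => z _.
  rewrite inE; case: ifP => [zQ|_]; last first.
    by rewrite mulr_ge0 ?expR_ge0// prodr_ge0// => i _; exact: expR_ge0.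
  rewrite -expR_sum -expRD sumrN -mulr_sumr -expR0 ler_expR subr_ge0.
  rewrite ler_wpM2l ?(ltW th0)//; move: zQ; rewrite /psum.
  by under eq_bigr do rewrite mxE.
rewrite -mulr_sumr expRD ler_wpM2l ?expR_ge0//.
rewrite -(bigA_distr_bigA (fun (i : 'I_n) c => expR (- (theta * `|ival c| `^ p)))).
rewrite /= prodr_const card_ord expRM_natr lerXn2r ?nnegrE ?expR_ge0//.
  by apply: sumr_ge0 => c _; exact: expR_ge0.
apply: (le_trans _ (expR_ge1Dx _)).
rewrite sum_option/= normr0 powR0 ?gt_eqF// mulr0 oppr0 expR0 lerD2l.
rewrite sum_pair/=.
have h (s : bool) : \sum_(j < Z) expR (- (theta * `|(-1) ^+ s * j.+1%:R| `^ p)) <=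
    2 * expR (- theta).
  apply: (@le_trans _ _ (\sum_(0 <= j < Z.+1) expR (- theta) * j.+1%:R `^ (- 2))).
    rewrite big_mkord big_ord_recr/= -[leLHS]addr0 lerD//.
    apply: ler_sum => j _; rewrite normrM normrX normrN1 expr1n mul1r.
    rewrite ger0_norm ?ler0n//.
    have j0 : j.+1%:R != 0 :> R by rewrite pnatr_eq0.
    rewrite /powR (negPf j0) -expRD ler_expR.
    set l := ln _; have l0 : 0 <= l by rewrite ln_ge0// ler1n.
    have := expR_ge1Dx (p * l); move/(ler_wpM2l (ltW th0)).
    have : 2 * l <= theta * (p * l).
      by rewrite mulrA ler_wpM2r// -ler_pdivrMr.
    lra.
  rewrite big_ltn// -mulr_sumr powR1 mulr1 -{1}[expR (- theta)]mulr1 -mulrDr.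
  rewrite mulrC ler_wpM2r ?expR_ge0//.
  have := @sum_powRN_tail R 2 1 Z.+1 _ isT; rewrite ltr1n => /(_ isT).
  rewrite powR1 (_ : 2 - 1 = 1 :> R); last by lra.
  by rewrite divr1 -(lerD2l 1) => /le_trans; apply; lra.
rewrite big_bool/=; have h1 := h true; have h2 := h false; lra.
Qed.

(** Rounding towards zero on the grid [t Z], so that the power sums do not
   increase. *)
Lemma exists_net_round n Z (x : 'cV[R]_n) (t : R) : 0 < t ->
  (forall i, `|x i 0| <= t * Z%:R) ->
  exists z : {ffun 'I_n -> option (bool * 'I_Z)},
  [/\ forall i, `|t * ival (z i)| <= `|x i 0|,
      forall i, `|x i 0 - t * ival (z i)| <= t,
      forall i, `|x i 0 - t * ival (z i)| <= `|x i 0| &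
      forall i, t <= `|x i 0| -> `|x i 0| <= 2 * `|t * ival (z i)|].
Proof.
move=> t0 xZ.
suff /choice[g hg] : forall i, exists c : option (bool * 'I_Z),
    [/\ `|t * ival c| <= `|x i 0|, `|x i 0 - t * ival c| <= t,
        `|x i 0 - t * ival c| <= `|x i 0| &
        t <= `|x i 0| -> `|x i 0| <= 2 * `|t * ival c|].
  exists (finfun g); split=> i; have [h1 h2 h3 h4] := hg i;
    by rewrite ffunE.
move=> i; set y := x i 0; have yt0 : 0 <= `|y| / t by rewrite divr_ge0// ltW.
have /andP[] := truncn_itv yt0.
case E : (Num.truncn (`|y| / t)) => [|N] N1 N2.
  exists None; rewrite /= mulr0 normr0 subr0; split=> //.
    by move: N2; rewrite ltr_pdivrMr// mul1r => /ltW.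
  by move: N2; rewrite ltr_pdivrMr// mul1r ltNge => /negP.
have NZ : (N < Z)%N.
  rewrite -(ler_nat R); apply: (le_trans N1).
  by rewrite ler_pdivrMr// mulrC xZ.
exists (Some (y < 0, Ordinal NZ)) => /=.
move: N1 N2; rewrite ler_pdivlMr// ltr_pdivrMr// => N1 N2.
have NE : N.+2%:R = N.+1%:R + 1 :> R by rewrite -natr1.
have N1' : 1 <= N.+1%:R :> R by rewrite ler1n.
have e : t * ((-1) ^+ (y < 0)%R * N.+1%:R) = Num.sg y * (N.+1%:R * t).
  have y0 : y != 0.
    apply/eqP => y0; move: N1; rewrite y0 normr0 leNgt => /negP; apply.
    by rewrite mulr_gt0.
  by rewrite sgr_def y0 mulr1n mulrCA; congr (_ * _); rewrite mulrC.
rewrite e; set a := `|y| in N1 N2 *; set b := N.+1%:R * t in N1 N2 *.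
have e2 : y - Num.sg y * b = Num.sg y * (a - b).
  by rewrite {1}[y]numEsg mulrBr.
have a0 : 0 < a by apply: lt_le_trans N1; rewrite mulr_gt0.
have sg1 : `|Num.sg y| = 1 by rewrite normr_sg -normr_gt0 a0.
have b0 : 0 < b by rewrite mulr_gt0.
have tb : t <= b by rewrite /b ler_peMl// ltW.
have ba : a < b + t by move: N2; rewrite NE mulrDl mul1r.
clear e; clearbody b; rewrite e2 !normrM sg1 !mul1r (gtr0_norm b0).
rewrite ger0_norm ?subr_ge0//; split=> //; lra.
Qed.

End Net.

(** * From the net to sparse vectors *)

Lemma dyadic_step (R : realType) (U C q P : R) :
  U * P + (2 * U + C * q) * (2^-1 * P) = (2 * U + C * (2^-1 * q)) * P.
Proof. by lra. Qed.

Lemma sparse_lower_step (R : realType) (a U A B C X W D : R) :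
  a * W <= A -> C <= 2 * U * (D * X) -> A <= B + C -> a * X <= a * (8 * W) ->
  32 * U * D * X <= a * X -> a / 16 * X <= B.
Proof. by lra. Qed.

Section NetToSparse.
Variables (R : realType) (p r : R).
Hypotheses (r_gt0 : 0 < r) (ltrp : r < p) (p_lt2 : p < 2) (r_le1 : r <= 1).

Let p_gt0 : 0 < p. Proof. exact: lt_trans ltrp. Qed.

Let rho_gt0 : 0 < r / p. Proof. by rewrite divr_gt0. Qed.

Let rho_lt1 : r / p < 1. Proof. by rewrite ltr_pdivrMr// mul1r. Qed.

Lemma powR_rho u : 0 <= u -> (u `^ p) `^ (r / p) = u `^ r.
Proof. by move=> u0; rewrite -powRrM mulrCA mulfV ?mulr1 ?gt_eqF. Qed.

Variables (n k Z : nat) (delta : R).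
Hypotheses (k_gt0 : (0 < k)%N) (delta_gt0 : 0 < delta).
Hypothesis delta_le : delta `^ r <= 2^-1.
Hypothesis Zge : k%:R `^ p^-1 / delta <= Z%:R.

Let Q : R := k%:R * (delta `^ p)^-1.

Let kR : 0 < k%:R :> R. Proof. by rewrite ltr0n. Qed.

Lemma delta_le1 : delta <= 1.
Proof.
rewrite leNgt; apply/negP => d1.
have : 1 <= delta `^ r by rewrite -(powRr0 delta) ler_powR// ltW.
by move=> /le_trans/(_ delta_le); lra.
Qed.

Lemma delta_powp_le : delta `^ p <= 2^-1.
Proof.
apply: le_trans delta_le; apply: ger_powR; last exact: ltW.
by rewrite delta_gt0 delta_le1.
Qed.

(** With this step [t], the rounding errors of [k] coordinates add up to [delta ^ p]
   times the mass of [x]. Coordinates below [t] are rounded to [0], and they too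
   carry at most half of the mass. *)
Lemma exists_net_sparse (x : 'cV[R]_n) : 0 < psum p x -> (#|supp x| <= k)%N ->
  exists (t : R) (z : {ffun 'I_n -> option (bool * 'I_Z)}),
  [/\ 0 < t, z \in net p n Z Q, (#|supp (x - t *: ivec R z)| <= k)%N,
      psum p (t *: ivec R z) <= psum p x &
      psum p (x - t *: ivec R z) <= delta `^ p * psum p x /\
      psum p x <= 8 * psum p (t *: ivec R z)].
Proof.
move=> x0 xk; pose t := delta * (psum p x / k%:R) `^ p^-1.
have t0 : 0 < t by rewrite mulr_gt0// powR_gt0// divr_gt0.
have tp : t `^ p = delta `^ p * (psum p x / k%:R).
  rewrite powRM ?powR_ge0 ?(ltW delta_gt0)// -powRrM mulVf ?gt_eqF//.
  by rewrite powRr1// divr_ge0 ?psum_ge0.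
have xle i : `|x i 0| <= psum p x `^ p^-1.
  rewrite -[leLHS](powRr1 (normr_ge0 _)) -(mulfV (lt0r_neq0 p_gt0)) powRrM.
  apply: ge0_ler_powR; rewrite ?nnegrE ?psum_ge0 ?powR_ge0 ?invr_ge0 ?(ltW p_gt0)//.
  by rewrite /psum (bigD1 i)//= lerDl sumr_ge0// => j _; exact: powR_ge0.
have xZ i : `|x i 0| <= t * Z%:R.
  apply: (le_trans (xle i)).
  apply: (@le_trans _ _ (t * (k%:R `^ p^-1 / delta))); last by rewrite ler_pM2l.
  rewrite /t powRM ?psum_ge0 ?invr_ge0 ?(ltW kR)//.
  rewrite -[k%:R^-1](powR_inv1 (ltW kR)) -powRrM mulN1r powRN.
  rewrite le_eqVlt; apply/orP; left; apply/eqP; field.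
  by rewrite !gt_eqF// powR_gt0.
have [z [h1 h2 h3 h4]] := exists_net_round t0 xZ.
exists t, z; set w := t *: ivec R z.
have wE i : w i 0 = t * ival R (z i) by rewrite !mxE.
have wx : psum p w <= psum p x.
  apply: ler_sum => i _; rewrite wE.
  by apply: ge0_ler_powR; rewrite ?nnegrE ?(ltW p_gt0).
have yk : (#|supp (x - w)| <= k)%N.
  apply: leq_trans xk; apply: subset_leq_card; apply/fintype.subsetP => i.
  rewrite !inE; apply: contraNN => /eqP xi0; rewrite !mxE -wE.
  by have := h3 i; rewrite !xi0 -wE normr0 normr_le0.
split=> //.
- rewrite inE; have tp0 : 0 < t `^ p by exact: powR_gt0.
  rewrite -(ler_pM2l tp0) -{1}(gtr0_norm t0) -psumZ -/w; apply: (le_trans wx).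
  rewrite tp /Q le_eqVlt; apply/orP; left; apply/eqP; field.
  by rewrite !gt_eqF// powR_gt0.
- split.
    have yt i : `|(x - w) i 0| <= t by have := h2 i; rewrite !mxE.
    apply: (le_trans (psum_le_card p_gt0 (ltW t0) yk yt)); rewrite tp.
    rewrite le_eqVlt; apply/orP; left; apply/eqP; field.
    by rewrite gt_eqF.
  have h5 : psum p x <= 4 * psum p w + k%:R * t `^ p.
    rewrite /psum (bigID (fun i => t <= `|x i 0|))/=; apply: lerD.
      rewrite mulr_sumr [leRHS](bigID (fun i => t <= `|x i 0|))/=.
      rewrite -[leLHS]addr0; apply: lerD; last first.
        by apply: sumr_ge0 => i _; rewrite mulr_ge0 ?powR_ge0.
      apply: ler_sum => i xi; rewrite wE.
      apply: (@le_trans _ _ ((2 * `|t * ival R (z i)|) `^ p)).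
        by apply: ge0_ler_powR; rewrite ?nnegrE ?(ltW p_gt0) ?mulr_ge0 ?h4.
      rewrite powRM// ler_wpM2r ?powR_ge0//.
      have -> : 4 = 2 `^ 2%:R :> R by rewrite powR_mulrn// -natrX.
      by rewrite ler_powR ?ler1n// ltW.
    apply: (@le_trans _ _ (\sum_(i in supp x) t `^ p)); last first.
      by rewrite sumr_const -[leLHS]mulr_natl ler_wpM2r ?powR_ge0 ?ler_nat.
    rewrite big_mkcond [leRHS]big_mkcond/=; apply: ler_sum => i _.
    rewrite inE; case: (boolP (t <= _)) => /= [_|xt].
      by case: ifP => // _; exact: powR_ge0.
    have [->|xi0] := eqVneq (x i 0) 0.
      by rewrite normr0 powR0// gt_eqF.
    apply: ge0_ler_powR; rewrite ?nnegrE ?(ltW p_gt0) ?(ltW t0)//.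
    by rewrite ltW// ltNge.
  have h6 : k%:R * t `^ p <= psum p x / 2.
    rewrite tp; apply: (@le_trans _ _ (delta `^ p * psum p x)).
      rewrite le_eqVlt; apply/orP; left; apply/eqP; field.
      by rewrite gt_eqF.
    by rewrite mulrC ler_pM2l// delta_powp_le.
  by move: h5 h6; set a := psum p x; set b := psum p w; lra.
Qed.

Section Upper.
Variables (m : nat) (S : 'M[R]_(m, n)) (U : R).
Hypothesis U0 : 0 <= U.
Hypothesis net_le : forall z : {ffun 'I_n -> option (bool * 'I_Z)},
  z \in net p n Z Q ->
  psum r (S *m ivec R z) <= U * psum p (ivec R z) `^ (r / p).

Lemma net_scale_le (t : R) (z : {ffun 'I_n -> option (bool * 'I_Z)}) : 0 < t ->
  z \in net p n Z Q ->
  psum r (S *m (t *: ivec R z)) <= U * psum p (t *: ivec R z) `^ (r / p).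
Proof.
move=> t0 zQ; rewrite -scalemxAr !psumZ (gtr0_norm t0).
rewrite powRM ?powR_ge0 ?psum_ge0// powR_rho ?(ltW t0)// mulrCA.
by rewrite ler_pM2l ?powR_gt0// net_le.
Qed.

(** Successive approximation: the remainder of the rounding is again sparse, and its
   [psum p], to the power [r / p], is at most half of that of [x]. Hence [j] steps
   divide the error of a crude bound [C] by [2 ^ j]. *)
Lemma sparse_le_dyadic : exists2 C : R, 0 <= C & forall j (x : 'cV[R]_n),
  (#|supp x| <= k)%N ->
  psum r (S *m x) <= (2 * U + C * 2^-1 ^+ j) * psum p x `^ (r / p).
Proof.
pose C := \sum_i psum r (col i S).
have C0 : 0 <= C by apply: sumr_ge0 => i _; exact: psum_ge0.
exists C => //; elim=> [|j IH] x xk.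
  apply: (@le_trans _ _ (C * psum p x `^ (r / p))); last first.
    by rewrite expr0 mulr1 ler_wpM2r ?powR_ge0// lerDr mulr_ge0.
  have -> : S *m x = \sum_i x i 0 *: col i S.
    apply/matrixP => a b; rewrite (ord1 b) mxE summxE.
    by apply: eq_bigr => i _; rewrite !mxE mulrC.
  apply: (le_trans (psum_sum_le _ _ r_gt0 r_le1)).
  rewrite mulr_suml; apply: ler_sum => i _; rewrite psumZ mulrC.
  apply: (ler_wpM2l (psum_ge0 _ _)).
  rewrite -powR_rho//; apply: ge0_ler_powR; rewrite ?nnegrE ?psum_ge0 ?powR_ge0//.
    exact: ltW.
  by rewrite /psum (bigD1 i)//= lerDl sumr_ge0// => l _; exact: powR_ge0.
have [xE|xn0] := eqVneq (psum p x) 0.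
  rewrite (psum_eq0 xE) mulmx0 !psum0 ?gt_eqF//.
  by rewrite powR0 ?gt_eqF// mulr0.
have x0 : 0 < psum p x by rewrite lt_neqAle eq_sym xn0 psum_ge0.
have [t [z [t0 zQ yk wx [yx _]]]] := exists_net_sparse x0 xk.
apply: (le_trans (psum_mulmxD r_gt0 r_le1 S x (t *: ivec R z))).
have h1 : psum r (S *m (t *: ivec R z)) <= U * psum p x `^ (r / p).
  apply: (le_trans (net_scale_le t0 zQ)); apply: (ler_wpM2l U0).
  by apply: ge0_ler_powR; rewrite ?(ltW rho_gt0) ?nnegrE ?psum_ge0.
have h2 : psum p (x - t *: ivec R z) `^ (r / p) <= 2^-1 * psum p x `^ (r / p).
  apply: (@le_trans _ _ ((delta `^ p * psum p x) `^ (r / p))).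
    apply: ge0_ler_powR; rewrite ?(ltW rho_gt0) ?nnegrE ?psum_ge0//.
    by rewrite mulr_ge0 ?powR_ge0 ?psum_ge0.
  rewrite powRM ?powR_ge0 ?psum_ge0// powR_rho ?(ltW delta_gt0)//.
  by rewrite ler_wpM2r ?powR_ge0.
have K0 : 0 <= 2 * U + C * 2^-1 ^+ j by rewrite addr_ge0 ?mulr_ge0 ?exprn_ge0.
apply: (le_trans (lerD h1 (le_trans (IH _ yk) (ler_wpM2l K0 h2)))).
by rewrite exprS dyadic_step.
Qed.

Lemma sparse_of_net_le (x : 'cV[R]_n) : (#|supp x| <= k)%N ->
  psum r (S *m x) <= 2 * U * psum p x `^ (r / p).
Proof.
move=> xk; have [C C0 hC] := sparse_le_dyadic.
set P := psum p x `^ (r / p); have P0 : 0 <= P by exact: powR_ge0.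
apply/ler_addgt0Pr => e e0.
pose j := Num.truncn (C * P / e).
have jC : C * P <= e * 2 ^+ j.
  have h0 : 0 <= C * P / e by rewrite divr_ge0 ?mulr_ge0 ?(ltW e0).
  have /andP[_ h1] := truncn_itv h0; rewrite -/j in h1.
  have h2 : j.+1%:R <= 2 ^+ j :> R by rewrite -natrX ler_nat ltn_expl.
  rewrite -ler_pdivrMl// mulrC; exact: le_trans (ltW h1) h2.
apply: (le_trans (hC j x xk)); rewrite -/P mulrDl lerD2l.
by rewrite mulrAC exprVn ler_pdivrMr ?exprn_gt0.
Qed.

(** The image of the remainder is controlled by the upper bound, and [delta] is small
   enough for it to be absorbed. *)
Lemma sparse_of_net_ge (a : R) : 0 <= a -> 32 * U * delta `^ r <= a ->
  (forall z : {ffun 'I_n -> option (bool * 'I_Z)}, z \in net p n Z Q ->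
    a * psum p (ivec R z) `^ (r / p) <= psum r (S *m ivec R z)) ->
  forall x : 'cV[R]_n, (#|supp x| <= k)%N ->
    a / 16 * psum p x `^ (r / p) <= psum r (S *m x).
Proof.
move=> a0 aU ha x xk.
have [xE|xn0] := eqVneq (psum p x) 0.
  by rewrite xE powR0 ?gt_eqF// mulr0 psum_ge0.
have x0 : 0 < psum p x by rewrite lt_neqAle eq_sym xn0 psum_ge0.
have [t [z [t0 zQ yk wx [yx xw]]]] := exists_net_sparse x0 xk.
set w := t *: ivec R z in yk wx yx xw *.
have h1 : a * psum p w `^ (r / p) <= psum r (S *m w).
  rewrite /w -scalemxAr !psumZ (gtr0_norm t0).
  rewrite powRM ?powR_ge0 ?psum_ge0// powR_rho ?(ltW t0)// mulrCA.
  by rewrite ler_pM2l ?powR_gt0// ha.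
have h2 : psum r (S *m (x - w)) <= 2 * U * (delta `^ r * psum p x `^ (r / p)).
  apply: (le_trans (sparse_of_net_le yk)); apply: ler_wpM2l.
    by rewrite mulr_ge0.
  rewrite -(powR_rho (ltW delta_gt0)) -powRM ?powR_ge0 ?psum_ge0//.
  apply: ge0_ler_powR; rewrite ?(ltW rho_gt0) ?nnegrE ?psum_ge0//.
  by rewrite mulr_ge0 ?powR_ge0 ?psum_ge0.
have h3 : psum r (S *m w) <= psum r (S *m x) + psum r (S *m (x - w)).
  apply: (le_trans (psum_mulmxD r_gt0 r_le1 S w x)); rewrite lerD2l.
  by rewrite -[w - x]opprB mulmxN psumN.
have h4 : psum p x `^ (r / p) <= 8 * psum p w `^ (r / p).
  apply: (@le_trans _ _ ((8 * psum p w) `^ (r / p))).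
    apply: ge0_ler_powR; rewrite ?(ltW rho_gt0) ?nnegrE ?psum_ge0//.
    by rewrite mulr_ge0 ?psum_ge0.
  rewrite powRM ?psum_ge0// ler_wpM2r ?powR_ge0//.
  by apply: ler1_powR; rewrite ?ler1n// ltW.
have h5 := ler_wpM2l a0 h4.
have h6 := ler_wpM2r (powR_ge0 (psum p x) (r / p)) aU.
exact: sparse_lower_step h1 h2 h3 h5 h6.
Qed.

End Upper.
End NetToSparse.

(** * The level of sparsity *)

Section SparsityLevel.
Variable R : realType.
Variables (phi : R).
Hypotheses (phi_gt0 : 0 < phi) (phi_le1 : phi <= 1).

(** The scale at which [kappa * ln (1 / kappa)] is below [phi], up to constants. *)
Definition kappa : R := 2 * (phi / 16) ^+ 2.

Lemma kappa_gt0 : 0 < kappa.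
Proof. by rewrite mulr_gt0// exprn_gt0// divr_gt0. Qed.

Lemma ln2_ge : 2^-1 <= ln 2 :> R.
Proof.
rewrite -[leLHS]expRK ler_ln ?posrE ?expR_gt0//.
rewrite -[expR _]invrK -[leRHS]invrK lef_pV2 ?posrE ?invr_gt0 ?expR_gt0//.
by rewrite -expRN; apply: (le_trans _ (expR_ge1Dx _)); lra.
Qed.

Definition logratio (n m : nat) : R := ln (1 + n%:R / m%:R).

Lemma logratio_ge n m : (0 < m <= n)%N -> 2^-1 <= logratio n m.
Proof.
move=> /andP[m0 mn]; apply: (le_trans ln2_ge).
have h : 1 <= n%:R / m%:R :> R by rewrite ler_pdivlMr ?ltr0n// mul1r ler_nat.
by rewrite ler_ln ?posrE//; lra.
Qed.

(** The left-hand side is the exponent in the cardinality of the net. It is compared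
   with [M] through [ln (n / k) <= ln (n / m) + ln L + ln (2 / kappa)]. *)
Lemma entropy_le (n m k : nat) (M : R) : (0 < m <= n)%N -> (0 < k)%N ->
  k%:R * logratio n m <= kappa * M ->
  kappa * m%:R <= 2 * logratio n m * k%:R ->
  k%:R * (1 + ln (n%:R / k%:R)) <= phi * M.
Proof.
move=> mn k0 h1 h2; have L2 := logratio_ge mn; move: mn => /andP[m0 mn].
set L := logratio n m in h1 h2 L2 *.
have s0 : 0 < phi / 16 by rewrite divr_gt0.
set s := phi / 16 in s0; have kE : kappa = 2 * s ^+ 2 by [].
have mp : 0 < m%:R :> R by rewrite ltr0n.
have kp : 0 < k%:R :> R by rewrite ltr0n.
have np : 0 < n%:R :> R by rewrite ltr0n (leq_trans m0).
have L0 : 0 < L by lra.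
have nm0 : 0 < n%:R / m%:R :> R by rewrite divr_gt0.
have nk : n%:R / k%:R <= (n%:R / m%:R) * (L * s^-1 ^+ 2).
  rewrite -mulrA ler_pM2l//.
  rewrite [leLHS](_ : _ = m%:R^-1 * (m%:R / k%:R)); last first.
    by rewrite mulrA mulVf ?gt_eqF// mul1r.
  rewrite ler_pM2l ?invr_gt0// ler_pdivrMr// exprVn.
  rewrite -(ler_pM2l kappa_gt0); apply: (le_trans h2).
  rewrite kE le_eqVlt; apply/orP; left; apply/eqP; field.
  by rewrite gt_eqF.
have lnk : ln (n%:R / k%:R) <= L + (L + 2 * s^-1).
  have sV0 : 0 < s^-1 by rewrite invr_gt0.
  apply: (@le_trans _ _ (ln (n%:R / m%:R * (L * s^-1 ^+ 2)))).
    by rewrite ler_ln ?posrE ?divr_gt0 ?mulr_gt0 ?exprn_gt0 ?invr_gt0.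
  rewrite lnM ?posrE ?mulr_gt0 ?exprn_gt0 ?invr_gt0//.
  rewrite [X in _ + X <= _]lnM ?posrE ?exprn_gt0 ?invr_gt0//.
  apply: lerD; last apply: lerD.
  - by rewrite /L /logratio ler_ln ?posrE ?addr_gt0 ?lerDr.
  - exact/ltW/ln_sublinear.
  - by rewrite lnXn// -[leLHS]mulr_natl ler_pM2l//; exact/ltW/ln_sublinear.
have s1 : s <= 1 by rewrite /s ler_pdivrMr// mul1r (le_trans phi_le1)// ler1n.
have sV : s * s^-1 = 1 by rewrite mulfV ?gt_eqF.
have h3 : 1 + ln (n%:R / k%:R) <= L * (4 + 4 * s^-1).
  have : 2^-1 * s^-1 <= L * s^-1 by rewrite ler_pM2r ?invr_gt0.
  move: lnk L2; move: (ln _) => l; lra.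
apply: (@le_trans _ _ (k%:R * (L * (4 + 4 * s^-1)))); first by rewrite ler_pM2l.
have c0 : 0 < 4 + 4 * s^-1 by rewrite addr_gt0// mulr_gt0// invr_gt0.
rewrite mulrA; apply: (@le_trans _ _ (kappa * M * (4 + 4 * s^-1))).
  by rewrite ler_pM2r.
have M0 : 0 < M.
  have : 0 < kappa * M by apply: lt_le_trans h1; rewrite mulr_gt0.
  by rewrite pmulr_rgt0 ?kappa_gt0.
have -> : phi = 16 * s by rewrite /s; field.
rewrite mulrAC ler_pM2r// kE.
have -> : 2 * s ^+ 2 * (4 + 4 * s^-1) = 8 * s ^+ 2 + 8 * s * (s * s^-1) by ring.
rewrite sV; nra.
Qed.

(** Up to constants, [k] is the largest sparsity level for which a union bound against
   [exp (- c m)] is possible; if there is none, [k = 1] and [m] is replaced by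
   the larger exponent [M]. *)
Lemma exists_sparsity_level (n m : nat) : (0 < m <= n)%N ->
  exists (k : nat) (M : R), [/\ (0 < k <= n)%N, m%:R <= M,
    kappa * M <= 2 * logratio n m * k%:R,
    k%:R * (1 + ln (n%:R / k%:R)) <= phi * M &
    (M = m%:R /\ k%:R <= phi * m%:R) \/ kappa * m%:R <= logratio n m].
Proof.
move=> mn; have L2 := logratio_ge mn; have := mn => /andP[m0 mn'].
set L := logratio n m in L2 *; have L0 : 0 < L by lra.
have mp : 0 < m%:R :> R by rewrite ltr0n.
have k0 := kappa_gt0.
have [mL|Lm] := leP (kappa * m%:R) L.
  have kV : kappa * (L / kappa) = L by rewrite mulrC divfK ?gt_eqF.
  have e1 : 1%:R * L <= kappa * (L / kappa) by rewrite kV mul1r.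
  have e2 : kappa * m%:R <= 2 * L * 1%:R by rewrite mulr1; lra.
  exists 1%N, (L / kappa); split; last by right.
  - by rewrite (leq_trans m0 mn').
  - by rewrite ler_pdivlMr// mulrC.
  - by rewrite kV mulr1; lra.
  - exact: (@entropy_le n m 1 _ mn).
have q1 : 1 < kappa * m%:R / L by rewrite ltr_pdivlMr// mul1r.
have /andP[N1 N2] := truncn_itv (le_trans ler01 (ltW q1)).
set k := Num.truncn _ in N1 N2.
have k1 : (0 < k)%N by rewrite -ltnS -(ltr_nat R) (lt_trans q1).
have e1 : k%:R * L <= kappa * m%:R by rewrite -ler_pdivlMr.
have e2 : kappa * m%:R <= 2 * L * k%:R.
  move: N2; rewrite ltr_pdivrMr// => /ltW/le_trans; apply.
  have k2 : k.+1%:R <= 2 * k%:R :> R.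
    by rewrite -natrM ler_nat mul2n -addnn -addn1 leq_add2l.
  by rewrite [leRHS]mulrAC ler_pM2r.
have e3 : k%:R <= phi * m%:R.
  apply: (@le_trans _ _ (2 * kappa * m%:R)).
    have : k%:R * 2^-1 <= k%:R * L by rewrite ler_pM2l ?ltr0n.
    lra.
  rewrite ler_pM2r// /kappa; have f0 := phi_gt0.
  have : phi * phi <= phi by rewrite ler_piMr// ltW.
  lra.
exists k, m%:R; split => //.
- rewrite k1 -(ler_nat R) (le_trans e3)//=.
  by apply: (@le_trans _ _ m%:R); rewrite ?ler_nat// ler_piMl// ltW.
- exact: (@entropy_le n m k _ mn).
- by left.
Qed.

End SparsityLevel.

(** * Samples that are good on the net *)

Lemma net_exponent_step (R : realType) (e q d K l n : R) :
  e * n <= K -> 0 < q -> 0 < d -> 0 <= l -> 0 < K ->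
  (q + l) * (K * d) + 4 * e * n <= (d * (q + 1) + 4) * (K * (1 + l)).
Proof.
move=> en q0 d0 l0 K0; have dK : 0 < d * K by rewrite mulr_gt0.
have h1 : 0 <= d * K * (1 + q * l) by rewrite mulr_ge0 ?addr_ge0 ?mulr_ge0// ltW.
have h2 : 0 <= K * l by rewrite mulr_ge0// ltW.
lra.
Qed.

Section Constants.
Variables (R : realType) (p r : R).
Hypotheses (r_gt0 : 0 < r) (ltrp : r < p) (p_lt2 : p < 2) (r_le1 : r <= 1).

Let p_gt0 : 0 < p. Proof. exact: lt_trans ltrp. Qed.

Let rho_gt0 : 0 < r / p. Proof. by rewrite divr_gt0. Qed.

Let rho_lt1 : r / p < 1. Proof. by rewrite ltr_pdivrMr// mul1r. Qed.

Definition lower_const : R := lower_rate p / 4.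

(** Chosen so that the image of the remainder of a rounding, of order
   [upper_const * mesh ^ r], is below [lower_const]. *)
Definition mesh : R := (lower_const / (64 * upper_const p r)) `^ r^-1.

Definition net_exponent : R := (mesh `^ p)^-1 * (2 / p + 1) + 4.

(** The first bound makes the cardinality of the net small with respect to the small
   ball probability; the second one limits the support of the vectors of the net to
   [m / 2] coordinates. *)
Definition sparsity : R := Num.min (lower_rate p / (4 * net_exponent)) (mesh `^ p / 2).

Let A1 : 1 <= upper_const p r. Proof. exact: upper_const_ge1. Qed.

Let A0 : 0 < upper_const p r. Proof. exact: lt_le_trans A1. Qed.

Let lr0 : 0 < lower_rate p. Proof. exact: lower_rate_gt0 ltrp. Qed.

Let lr1 : lower_rate p <= 1. Proof. exact: lower_rate_le1. Qed.

Lemma lower_const_gt0 : 0 < lower_const.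
Proof. by rewrite divr_gt0. Qed.

Lemma mesh_gt0 : 0 < mesh.
Proof. by rewrite powR_gt0// divr_gt0 ?lower_const_gt0 ?mulr_gt0. Qed.

Lemma meshp_gt0 : 0 < mesh `^ p.
Proof. exact: (powR_gt0 _ mesh_gt0). Qed.

Lemma mesh_powr : mesh `^ r = lower_const / (64 * upper_const p r).
Proof.
rewrite -powRrM mulVf ?gt_eqF// powRr1//.
by rewrite divr_ge0 ?(ltW lower_const_gt0) ?mulr_ge0 ?(ltW A0).
Qed.

Lemma mesh_powr_le : mesh `^ r <= 2^-1.
Proof.
rewrite mesh_powr ler_pdivrMr ?mulr_gt0// /lower_const.
by move: lr1 A1; set a := lower_rate p; set b := upper_const p r; lra.
Qed.

Lemma net_exponent_ge4 : 4 <= net_exponent.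
Proof.
by rewrite /net_exponent lerDr mulr_ge0 ?invr_ge0 ?powR_ge0 ?addr_ge0 ?divr_ge0 ?(ltW p_gt0).
Qed.

Let B0 : 0 < net_exponent.
Proof. by apply: lt_le_trans net_exponent_ge4. Qed.

Lemma sparsity_gt0 : 0 < sparsity.
Proof.
rewrite lt_min (divr_gt0 lr0) ?(divr_gt0 meshp_gt0)//.
by apply: mulr_gt0.
Qed.

Lemma sparsity_le1 : sparsity <= 1.
Proof.
rewrite ge_min; apply/orP; left; rewrite ler_pdivrMr ?mulr_gt0// mul1r.
by apply: (le_trans lr1); have := net_exponent_ge4; lra.
Qed.

Lemma sparsity_net : net_exponent * sparsity <= lower_rate p / 4.
Proof.
apply: (@le_trans _ _ (net_exponent * (lower_rate p / (4 * net_exponent)))).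
  by rewrite ler_pM2l// ge_min lexx.
rewrite le_eqVlt; apply/orP; left; apply/eqP; field.
by rewrite gt_eqF.
Qed.

Definition net_radius (k : nat) : R := k%:R * (mesh `^ p)^-1.

Definition net_height (k : nat) : nat := (Num.truncn (k%:R `^ p^-1 / mesh)).+1.

Lemma net_height_ge k : k%:R `^ p^-1 / mesh <= (net_height k)%:R.
Proof.
have h : 0 <= k%:R `^ p^-1 / mesh by rewrite divr_ge0 ?powR_ge0.
by have /andP[_ /ltW] := truncn_itv h.
Qed.

Lemma card_net_sparse_le n k : (0 < k <= n)%N ->
  #|net p n (net_height k) (net_radius k)|%:R <=
  expR (net_exponent * (k%:R * (1 + ln (n%:R / k%:R)))).
Proof.
move=> /andP[k0 kn]; have kp : 0 < k%:R :> R by rewrite ltr0n.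
have np : 0 < n%:R :> R by rewrite ltr0n (leq_trans k0).
set l := ln (n%:R / k%:R).
have l0 : 0 <= l by rewrite ln_ge0// ler_pdivlMr// mul1r ler_nat.
have th : 2 / p <= 2 / p + l by rewrite lerDl.
apply: (le_trans (card_net_le p_gt0 n _ _ th)); rewrite ler_expR.
have e1 : expR (- (2 / p + l)) * n%:R <= k%:R.
  apply: (@le_trans _ _ (expR (- l) * n%:R)).
    by rewrite ler_pM2r// ler_expR lerN2 lerDr divr_ge0// ltW.
  by rewrite expRN lnK ?posrE ?divr_gt0// invf_div divfK// gt_eqF.
have q0 : 0 < 2 / p by rewrite divr_gt0.
have d0 : 0 < (mesh `^ p)^-1 by rewrite invr_gt0 meshp_gt0.
rewrite /net_exponent /net_radius.
exact: net_exponent_step.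
Qed.

(** The flag [low] records whether a lower bound is required. None is needed when [m]
   is so small that the identity block alone gives the lower bound for [W]. *)
Definition net_good n m k (M : R) (low : bool) (S : 'M[R]_(m, n)) : Prop :=
  forall z, z \in net p n (net_height k) (net_radius k) ->
  psum r (S *m ivec R z) <=
    upper_const p r * (M `^ (1 - r / p) * psum p (ivec R z) `^ (r / p)) /\
  (low -> lower_const * (m%:R `^ (1 - r / p) * psum p (ivec R z) `^ (r / p)) <=
    psum r (S *m ivec R z)).

(** Coordinates with [ucoef < 1] contribute at most one each, and a vector of integers
   has at most [psum p] nonzero coordinates. *)
Lemma net_window n m k Z (z : {ffun 'I_n -> option (bool * 'I_Z)}) :
  (0 < m)%N -> k%:R <= sparsity * m%:R -> z \in net p n Z (net_radius k) ->
  0 < psum p (ivec R z) ->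
  m%:R / 2 <= \sum_(i | 1 <= ucoef p m%:R (ivec R z) i) ucoef p m%:R (ivec R z) i.
Proof.
move=> m0 km; rewrite inE => zQ z0; have mp : 0 < m%:R :> R by rewrite ltr0n.
set u := ucoef p m%:R (ivec R z).
have uM : \sum_i u i = m%:R by exact: sum_ucoef.
have Qm : net_radius k <= m%:R / 2.
  rewrite /net_radius ler_pdivrMr ?meshp_gt0//; apply: (le_trans km).
  have h : sparsity <= mesh `^ p / 2 by rewrite ge_min lexx orbT.
  by rewrite [leRHS]mulrAC -[leRHS]mulrA [leRHS]mulrC ler_pM2r.
rewrite (bigID (fun i => 1 <= u i))/= in uM.
have : \sum_(i | ~~ (1 <= u i)) u i <= m%:R / 2; last by move: uM; lra.
apply: le_trans Qm; apply: le_trans zQ; rewrite big_mkcond/=.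
apply: ler_sum => i _; case: ifP => [|_]; last exact: powR_ge0.
rewrite -ltNge => ui; case E : (z i) => [[s j]|].
  apply: (le_trans (ltW ui)); rewrite mxE E /= normrM normrX normrN1 expr1n mul1r.
  rewrite -[leLHS](one_powR p).
  apply: ge0_ler_powR; rewrite ?nnegrE ?(ltW p_gt0)//.
  by rewrite ger0_norm ?ler0n// ler1n.
by rewrite /u /ucoef mxE E /= normr0 powR0 ?gt_eqF// mulr0 mul0r.
Qed.

Definition net_goodb n m k (M : R) (low : bool) J
    (f : {ffun 'I_n * 'I_J -> 'I_m * bool}) : bool :=
  ~~ has (fun z => (upper_const p r *
        (M `^ (1 - r / p) * psum p (ivec R z) `^ (r / p)) <
      psum r (partial_Smx p f *m ivec R z)) ||
      low && (psum r (partial_Smx p f *m ivec R z) <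
    lower_const * (m%:R `^ (1 - r / p) * psum p (ivec R z) `^ (r / p))))
  (enum (net p n (net_height k) (net_radius k))).

Lemma net_goodbP n m k M low J (f : {ffun 'I_n * 'I_J -> 'I_m * bool}) :
  net_goodb k M low f -> net_good k M low (partial_Smx p f).
Proof.
move=> /hasPn h z zN; have := h z; rewrite mem_enum => /(_ zN).
rewrite negb_or -leNgt => /andP[-> h2]; split => // lowT.
by move: h2; rewrite lowT/= -leNgt.
Qed.

(** Union bound: the net has at most [exp (lower_rate p / 4 * M)] points, and the two
   bounds fail at a given point with probability at most [exp (- 2 M)] and
   [exp (- lower_rate p / 2 * m)] respectively. *)
Lemma pr_net_bad_le n m k (M : R) (low : bool) J :
  (0 < m)%N -> (m <= J)%N -> (0 < k <= n)%N -> m%:R <= M ->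
  k%:R * (1 + ln (n%:R / k%:R)) <= sparsity * M ->
  (low -> M = m%:R /\ k%:R <= sparsity * m%:R) ->
  pr R (fun f : {ffun 'I_n * 'I_J -> 'I_m * bool} => ~~ net_goodb k M low f) <=
  2 * expR (- (lower_rate p / 4 * m%:R)).
Proof.
move=> m0 mJ kn mM kM hlow; have mp : 0 < m%:R :> R by rewrite ltr0n.
have M0 : 0 < M by exact: lt_le_trans mM.
have cN : #|net p n (net_height k) (net_radius k)|%:R <=
    expR (lower_rate p / 4 * M).
  apply: (le_trans (card_net_sparse_le kn)); rewrite ler_expR.
  apply: (@le_trans _ _ (net_exponent * (sparsity * M))); first by rewrite ler_pM2l.
  by rewrite mulrA ler_pM2r// sparsity_net.
set N := net p n _ _ in cN *.
pose up (z : {ffun 'I_n -> option (bool * 'I_(net_height k))})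
    (f : {ffun 'I_n * 'I_J -> 'I_m * bool}) : bool := upper_const p r *
  (M `^ (1 - r / p) * psum p (ivec R z) `^ (r / p)) < psum r (partial_Smx p f *m ivec R z).
pose lo (z : {ffun 'I_n -> option (bool * 'I_(net_height k))})
    (f : {ffun 'I_n * 'I_J -> 'I_m * bool}) : bool :=
  low && (psum r (partial_Smx p f *m ivec R z) <
    lower_const * (m%:R `^ (1 - r / p) * psum p (ivec R z) `^ (r / p))).
apply: (@le_trans _ _ (pr R (fun f : {ffun 'I_n * 'I_J -> 'I_m * bool} =>
    has (up ^~ f) (enum N) || has (lo ^~ f) (enum N)))).
  by apply: pr_le => f; rewrite negbK /= -has_predU.
apply: (le_trans (pr_or _ _ _)); rewrite mulr_natl mulr2n; apply: lerD.
  apply: (le_trans (pr_union (e := expR (- (2 * M))) _)).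
    move=> z _; apply: (le_trans _ (pr_psum_large r_gt0 ltrp p_lt2 r_le1 J (ivec R z) m0 mM)).
    by apply: pr_le => f; rewrite /up partial_Smx_mul.
  rewrite -cardE; apply: (le_trans (ler_wpM2r (expR_ge0 _) cN)).
  rewrite -expRD ler_expR.
  have l1 : lower_rate p / 4 <= 1 by have := lr1; lra.
  have := ler_wpM2r (ltW M0) l1; have := ler_wpM2r (ltW mp) l1.
  by rewrite !mul1r; move: mM; lra.
case: (boolP low) hlow => [lowT /(_ isT)[ME km]|lowF _]; last first.
  rewrite /pr (@eq_avg _ _ _ (fun=> 0)) => [|f]; last first.
    by rewrite (eq_has (a2 := pred0)) ?has_pred0// => z; rewrite /lo (negPf lowF).
  by rewrite /avg big1// mul0r expR_ge0.
apply: (le_trans (pr_union (e := expR (- (lower_rate p / 2 * m%:R))) _)).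
  move=> z; rewrite mem_enum => zN.
  have [zE|zn0] := eqVneq (psum p (ivec R z)) 0.
    rewrite /pr (@eq_avg _ _ _ (fun=> 0)) => [|f]; last first.
      by rewrite /lo zE powR0 ?gt_eqF// !mulr0 ltNge psum_ge0 andbF.
    by rewrite /avg big1// mul0r expR_ge0.
  have z0 : 0 < psum p (ivec R z) by rewrite lt_neqAle eq_sym zn0 psum_ge0.
  have hw := net_window m0 km zN z0.
  apply: (le_trans _ (pr_psum_small r_gt0 ltrp r_le1 m0 mJ z0 hw)).
  by apply: pr_le => f; rewrite /lo partial_Smx_mul lowT.
rewrite -cardE; apply: (le_trans (ler_wpM2r (expR_ge0 _) cN)).
by rewrite -expRD ler_expR ME; lra.
Qed.

End Constants.

(** * Deterministic bounds for a good matrix *)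

Section Conclusion.
Variables (R : realType) (p r : R).
Hypotheses (r_gt0 : 0 < r) (ltrp : r < p) (p_lt2 : p < 2) (r_le1 : r <= 1).

Let p_gt0 : 0 < p. Proof. exact: lt_trans ltrp. Qed.

Let rho_gt0 : 0 < r / p. Proof. by rewrite divr_gt0. Qed.

Let rho_lt1 : r / p < 1. Proof. by rewrite ltr_pdivrMr// mul1r. Qed.

Let sig := 1 - r / p.

Let sig_gt0 : 0 < sig. Proof. by rewrite subr_gt0. Qed.

(** Bounds [(M / k) ^ (1 - r / p)] divided by [L ^ (1 - r / p)], where
   [L = ln (1 + n / m)]. *)
Definition ratio_const : R := (2 / kappa (sparsity p r)) `^ (1 - r / p).

(** The power [r] of the constant [c'], small enough for [S x] to contribute at most as
   much as the bound on the identity block. *)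
Definition scale_pow : R := (4 * upper_const p r * ratio_const)^-1.

(** The power [r] of the constant of the lower bound; the first term serves when [m]
   is small, the second one otherwise. *)
Definition lower_pow : R :=
  Num.min (kappa (sparsity p r) `^ (1 - r / p))
    (lower_const p / 16 / (scale_pow^-1 +
      (lower_const p / 16 + 2 * upper_const p r) * ratio_const)).

Let A0 : 0 < upper_const p r.
Proof. exact: lt_le_trans (upper_const_ge1 r_gt0 ltrp p_lt2). Qed.

Let a0 : 0 < lower_const p. Proof. exact: lower_const_gt0 r_gt0 ltrp. Qed.

Let kap0 : 0 < kappa (sparsity p r).
Proof. by apply: kappa_gt0; apply: sparsity_gt0. Qed.

Let V0 : 0 < ratio_const.
Proof. by apply: powR_gt0; rewrite divr_gt0. Qed.

Lemma scale_pow_gt0 : 0 < scale_pow.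
Proof. by rewrite invr_gt0; apply: mulr_gt0 => //; apply: mulr_gt0. Qed.

Let den0 : 0 < scale_pow^-1 +
  (lower_const p / 16 + 2 * upper_const p r) * ratio_const.
Proof.
have h1 : 0 < scale_pow^-1 by rewrite invr_gt0 scale_pow_gt0.
have h2 : 0 < lower_const p / 16 by apply: divr_gt0.
have h3 : 0 < 2 * upper_const p r by apply: mulr_gt0.
by apply: (addr_gt0 h1); apply: mulr_gt0 => //; apply: addr_gt0.
Qed.

Lemma lower_pow_gt0 : 0 < lower_pow.
Proof.
rewrite lt_min (powR_gt0 _ kap0)/=; apply: divr_gt0 den0.
exact: divr_gt0 a0 _.
Qed.

Variables (n m k : nat) (M L : R) (low : bool) (S : 'M[R]_(m, n)).
Hypotheses (m_gt0 : (0 < m)%N) (mn : (m <= n)%N) (k_gt0 : (0 < k)%N).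
Hypotheses (kn : (k <= n)%N) (mM : m%:R <= M) (L_gt0 : 0 < L).
Hypothesis kM : kappa (sparsity p r) * M <= 2 * L * k%:R.
Hypothesis lowM : low -> M = m%:R.
Hypothesis notlow : ~~ low -> kappa (sparsity p r) * m%:R <= L.
Hypothesis good : net_good p r k M low S.

Let mp : 0 < m%:R :> R. Proof. by rewrite ltr0n. Qed.
Let kp : 0 < k%:R :> R. Proof. by rewrite ltr0n. Qed.
Let np : 0 < n%:R :> R. Proof. by rewrite ltr0n (leq_trans m_gt0). Qed.
Let M0 : 0 < M. Proof. exact: lt_le_trans mM. Qed.

Let U := upper_const p r * M `^ sig.

Let U0 : 0 <= U. Proof. by apply: mulr_ge0; [exact: ltW | exact: powR_ge0]. Qed.

Let delta0 : 0 < mesh p r. Proof. exact: mesh_gt0. Qed.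

Let delta1 : mesh p r `^ r <= 2^-1. Proof. exact: mesh_powr_le. Qed.

Let net_upper (z : {ffun 'I_n -> option (bool * 'I_(net_height p r k))}) :
  z \in net p n (net_height p r k) (net_radius p r k) ->
  psum r (S *m ivec R z) <= U * psum p (ivec R z) `^ (r / p).
Proof. by move=> zN; rewrite /U -mulrA; have [] := good zN. Qed.

Lemma good_sparse_le (x : 'cV[R]_n) : (#|supp x| <= k)%N ->
  psum r (S *m x) <= 2 * U * psum p x `^ (r / p).
Proof.
exact: (sparse_of_net_le r_gt0 ltrp p_lt2 r_le1 k_gt0 delta0 delta1
  (net_height_ge p r k) U0 net_upper).
Qed.

Let U2_ge0 : 0 <= 2 * U. Proof. by apply: mulr_ge0. Qed.

Let powk (u : R) : 0 <= u -> u `^ sig * k%:R `^ (r / p - 1) = (u / k%:R) `^ sig.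
Proof.
move=> u0; rewrite powR_div ?(ltW kp)//; congr (_ * _).
by rewrite -powRN opprB.
Qed.

Let ratio_le : (M / k%:R) `^ sig <= ratio_const * L `^ sig.
Proof.
rewrite /ratio_const -powRM ?(ltW L_gt0) ?divr_ge0 ?(ltW kap0)//.
apply: ge0_ler_powR; first exact: ltW.
- by rewrite nnegrE divr_ge0 ?(ltW M0).
- by rewrite nnegrE mulr_ge0 ?(ltW L_gt0) ?divr_ge0 ?(ltW kap0).
- rewrite ler_pdivrMr// -(ler_pM2l kap0); apply: (le_trans kM).
  rewrite le_eqVlt; apply/orP; left; apply/eqP; field.
  by rewrite gt_eqF.
Qed.

(** Up to the factor [n ^ (1 - r / p)], the left-hand side is the power sum of [W x]. *)
Lemma good_upper (x : 'cV[R]_n) :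
  psum r x + scale_pow / L `^ sig * psum r (S *m x) <=
  2 * (n%:R `^ sig * psum p x `^ (r / p)).
Proof.
have h1 := psum_mulmx_le r_gt0 ltrp r_le1 k_gt0 kn U2_ge0 good_sparse_le x.
have h2 : psum r x <= n%:R `^ sig * psum p x `^ (r / p).
  exact: psum_mean_le r_gt0 (ltW ltrp).
set N := psum p x `^ (r / p) in h1 h2 *.
have N0 : 0 <= N by exact: powR_ge0.
have Ls : 0 < L `^ sig by exact: powR_gt0.
have nk : 1 <= (n%:R / k%:R) `^ sig.
  rewrite -[leLHS](one_powR sig); apply: ge0_ler_powR; first exact: ltW.
  - by rewrite nnegrE.
  - by rewrite nnegrE divr_ge0 ?(ltW np).
  - by rewrite ler_pdivlMr// mul1r ler_nat.
have h3 : psum r (S *m x) <= 2 * U * (2 * ((n%:R / k%:R) `^ sig * N)).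
  apply: (le_trans h1); apply: (ler_wpM2l U2_ge0).
  rewrite [2 * _]mulr_natl mulr2n; apply: lerD; first by rewrite ler_peMl.
  rewrite -powk ?(ltW np)// [_ * k%:R `^ _]mulrC -mulrA.
  exact: ler_wpM2l (powR_ge0 _ _) _ _ h2.
have h4 : psum r (S *m x) <=
    scale_pow^-1 * L `^ sig * (n%:R `^ sig * N).
  apply: (le_trans h3); rewrite /U /scale_pow invrK.
  rewrite powR_div ?(ltW np) ?(ltW kp)//.
  have := ratio_le; rewrite powR_div ?(ltW M0) ?(ltW kp)//.
  have c0 : 0 <= 4 * upper_const p r * (n%:R `^ sig * N).
    by rewrite !mulr_ge0 ?powR_ge0 ?(ltW A0).
  move/(ler_wpM2l c0) => h5; apply: (le_trans _ (le_trans h5 _)).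
  - by rewrite le_eqVlt; apply/orP; left; apply/eqP; ring.
  - by rewrite le_eqVlt; apply/orP; left; apply/eqP; ring.
rewrite [2 * _]mulr_natl mulr2n; apply: lerD => //.
rewrite mulrAC ler_pdivrMr// -ler_pdivlMl ?scale_pow_gt0//.
by apply: (le_trans h4); rewrite -mulrA [L `^ _ * _]mulrC.
Qed.

(** If a lower bound on the net is available, it extends to sparse vectors and then to
   all vectors up to a multiple of [psum r x], which the identity block provides. If
   not, [m / L] is bounded and [psum p x ^ (r / p) <= psum r x] is enough. *)
Lemma good_lower (x : 'cV[R]_n) :
  lower_pow * ((m%:R / L) `^ sig * psum p x `^ (r / p)) <=
  psum r x + scale_pow / L `^ sig * psum r (S *m x).
Proof.
set N := psum p x `^ (r / p); have N0 : 0 <= N by exact: powR_ge0.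
have Ls : 0 < L `^ sig by exact: powR_gt0.
have P0 := psum_ge0 r x; have S0 := psum_ge0 r (S *m x).
have D0 := scale_pow_gt0.
have T0 : 0 <= scale_pow / L `^ sig * psum r (S *m x).
  by rewrite mulr_ge0// divr_ge0// ltW.
have mL0 : 0 <= (m%:R / L) `^ sig by exact: powR_ge0.
have mLN : 0 <= (m%:R / L) `^ sig * N by exact: mulr_ge0.
have [lowT|/notlow kmL] := boolP low; last first.
  apply: (@le_trans _ _ (psum r x)); last by rewrite lerDl.
  apply: (@le_trans _ _ (kappa (sparsity p r) `^ sig * ((m%:R / L) `^ sig * N))).
    by apply: ler_wpM2r => //; rewrite ge_min lexx.
  rewrite mulrA -powRM ?(ltW kap0) ?divr_ge0 ?(ltW mp) ?(ltW L_gt0)//.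
  apply: (@le_trans _ _ N).
    rewrite -[leRHS]mul1r; apply: ler_wpM2r => //.
    rewrite -[leRHS](one_powR sig); apply: ge0_ler_powR; first exact: ltW.
    - by rewrite nnegrE mulr_ge0 ?(ltW kap0) ?divr_ge0 ?(ltW mp) ?(ltW L_gt0).
    - by rewrite nnegrE.
    - by rewrite mulrA ler_pdivrMr// mul1r.
  exact: psum_powR_le r_gt0 (ltW ltrp).
have ME := lowM lowT.
have a16 : 0 <= lower_const p * M `^ sig by rewrite mulr_ge0 ?powR_ge0 ?(ltW a0).
have a16' : 0 <= lower_const p * M `^ sig / 16 by exact: divr_ge0.
have ge_net (z : {ffun 'I_n -> option (bool * 'I_(net_height p r k))}) :
    z \in net p n (net_height p r k) (net_radius p r k) ->
    lower_const p * M `^ sig * psum p (ivec R z) `^ (r / p) <=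
    psum r (S *m ivec R z).
  by move=> zN; rewrite ME -mulrA; have [_ ->] := good zN.
have mesh_le : 32 * U * mesh p r `^ r <= lower_const p * M `^ sig.
  rewrite mesh_powr// /U.
  have -> : 32 * (upper_const p r * M `^ sig) *
      (lower_const p / (64 * upper_const p r)) = lower_const p * M `^ sig / 2.
    by field; rewrite gt_eqF.
  by rewrite ler_pdivrMr// ler_peMr// ler1n.
have h1 := psum_mulmx_ge r_gt0 ltrp r_le1 k_gt0 kn U2_ge0 good_sparse_le
  a16' (sparse_of_net_ge r_gt0 ltrp p_lt2 r_le1 k_gt0 delta0 delta1
  (net_height_ge p r k) U0 net_upper a16 mesh_le ge_net) x.
rewrite -/N in h1.
have h2 : lower_const p / 16 * ((m%:R / L) `^ sig * N) <=
    psum r (S *m x) / L `^ sig +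
    (lower_const p / 16 + 2 * upper_const p r) * ratio_const * psum r x.
  rewrite powR_div ?(ltW mp) ?(ltW L_gt0)// -ME.
  have -> : lower_const p / 16 * (M `^ sig / L `^ sig * N) =
      lower_const p * M `^ sig / 16 * N / L `^ sig by field; rewrite gt_eqF.
  rewrite ler_pdivrMr//; apply: (le_trans h1).
  rewrite [leRHS]mulrDl divfK ?gt_eqF//.
  rewrite lerD2l.
  have -> : (lower_const p * M `^ sig / 16 + 2 * U) *
      (k%:R `^ (r / p - 1) * psum r x) =
      (lower_const p / 16 + 2 * upper_const p r) *
      ((M `^ sig * k%:R `^ (r / p - 1)) * psum r x) by rewrite /U; field.
  rewrite powk ?(ltW M0)// -!mulrA; apply: ler_wpM2l.
    by rewrite addr_ge0 ?divr_ge0 ?mulr_ge0 ?(ltW a0) ?(ltW A0).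
  by rewrite [psum r x * _]mulrC mulrA; apply: ler_wpM2r.
set K := (lower_const p / 16 + 2 * upper_const p r) * ratio_const in h2.
have q0 := den0; rewrite -/K in q0; set q := scale_pow^-1 + K in q0.
apply: (@le_trans _ _ (lower_const p / 16 / q * ((m%:R / L) `^ sig * N))).
  by apply: ler_wpM2r => //; rewrite ge_min lexx orbT.
rewrite mulrAC ler_pdivrMr//; apply: (le_trans h2).
have K0 : 0 <= K.
  apply: mulr_ge0; last exact: ltW.
  by rewrite addr_ge0 ?divr_ge0 ?mulr_ge0 ?(ltW a0) ?(ltW A0).
have -> : (psum r x + scale_pow / L `^ sig * psum r (S *m x)) * q =
    psum r (S *m x) / L `^ sig + K * psum r x +
    (psum r x / scale_pow + scale_pow / L `^ sig * psum r (S *m x) * K).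
  by rewrite /q; field; rewrite !gt_eqF.
rewrite lerDl; apply: addr_ge0; first exact: divr_ge0 P0 (ltW D0).
exact: mulr_ge0 T0 K0.
Qed.

End Conclusion.

(** * Convergence of weighted series *)

Section Convergence.
Variable R : realType.

Lemma cvg_cV m (u : nat -> 'cV[R]_m) (l : 'cV[R]_m) :
  (forall k, (fun N => u N k 0) @ \oo --> l k 0) -> u @ \oo --> l.
Proof.
move=> h; apply/cvg_ballP => e e0.
have H k : \forall N \near \oo, ball (l k 0) e (u N k 0).
  by move: (h k) => /cvg_ballP /(_ e e0).
have : \forall N \near \oo, forall k, ball (l k 0) e (u N k 0).
  exact: filter_forall.
by apply: filterS => N hN; split => // k j; rewrite (ord1 j).
Qed.

Lemma cvg_coord m (u : nat -> 'cV[R]_m) (l : 'cV[R]_m) k :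
  u @ \oo --> l -> (fun N => u N k 0) @ \oo --> l k 0.
Proof.
move=> ul; apply: (@cvg_comp _ _ _ u (fun v : 'cV[R]_m => v k 0) _ _ _ ul).
exact: coord_continuous.
Qed.

Lemma is_cvg_cVP m (u : nat -> 'cV[R]_m) :
  cvgn u <-> forall k, cvgn (fun N => u N k 0).
Proof.
split=> [/cvg_ex[l ul] k|h]; first by apply/cvg_ex; exists (l k 0); exact: cvg_coord.
apply/cvg_ex; exists (\col_k limn (fun N => u N k 0)).
by apply: cvg_cV => k; rewrite mxE; exact: h.
Qed.

Lemma abel_sum (a y T : nat -> R) N : T 0%N = 0 ->
  (forall j, T j.+1 = T j + y j) ->
  \sum_(0 <= j < N) a j * y j =
  \sum_(0 <= j < N) (a j - a j.+1) * T j.+1 + a N * T N.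
Proof.
move=> T0 TS; elim: N => [|N IH]; first by rewrite !big_geq// T0 mulr0 addr0.
by rewrite !big_nat_recr//= IH TS; ring.
Qed.

Lemma powRN_cvg0 (s : R) : 0 < s -> (fun N => N.+1%:R `^ (- s)) @ \oo --> (0 : R).
Proof.
move=> s0; apply/cvgrPdist_lt => e e0; near=> N.
rewrite sub0r normrN ger0_norm ?powR_ge0// powRN.
rewrite invf_plt ?posrE ?powR_gt0//.
have : e^-1 `^ s^-1 < N.+1%:R.
  near: N; exists (Num.truncn (e^-1 `^ s^-1)) => // n /= hn.
  have /andP[_ h] := truncn_itv (powR_ge0 e^-1 s^-1).
  by apply: (lt_le_trans h); rewrite ler_nat.
move=> /(gt0_ltr_powR s0); rewrite !nnegrE powR_ge0 ler0n => /(_ isT isT).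
by rewrite -powRrM mulVf ?gt_eqF// powRr1// invr_ge0 ltW.
Unshelve. all: by end_near.
Qed.

Lemma cvgn_of_sum_powRN (u : nat -> R) (s C : R) : 1 < s ->
  (forall j, `|u j| <= C * j.+1%:R `^ (- s)) -> cvgn (series u).
Proof.
move=> s1 uC; apply: normed_cvg.
have C0 : 0 <= C.
  by have := uC 0%N; rewrite powR1 mulr1; apply: le_trans.
apply: nondecreasing_is_cvgn.
  apply/nondecreasing_seqP => n; rewrite [leRHS]seriesSr lerDl.
  exact: normr_ge0.
exists (C * (1 + (s - 1)^-1)) => _ [N _ <-].
apply: (@le_trans _ _ (\sum_(0 <= j < N.+1) C * j.+1%:R `^ (- s))).
  have -> : [normed series u] N = \sum_(0 <= j < N) `|u j| by [].
  rewrite [leRHS]big_nat_recr//= -[leLHS]addr0 lerD//.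
    by apply: ler_sum => j _; exact: uC.
  by rewrite mulr_ge0 ?powR_ge0.
rewrite -mulr_sumr ler_wpM2l// big_ltn// powR1 lerD2l.
by have := @sum_powRN_tail R s 1 N.+1 s1 isT; rewrite powR1 mul1r.
Qed.

(** Summation by parts: partial sums of order [N ^ g] with [g < s] are enough
   for the convergence of the series with weights [j ^ - s]. *)
Lemma cvgn_abel (y T : nat -> R) (s g C : R) : 0 < s -> g < s ->
  T 0%N = 0 -> (forall j, T j.+1 = T j + y j) ->
  (forall j, `|T j.+1| <= C * j.+1%:R `^ g) ->
  cvgn (series (fun j => j.+1%:R `^ (- s) * y j)).
Proof.
move=> s0 gs T0 TS TC.
have C0 : 0 <= C.
  by have := TC 0%N; rewrite powR1 mulr1; apply: le_trans.
pose a j : R := j.+1%:R `^ (- s).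
have aE : series (fun j => a j * y j) =
    series (fun j => (a j - a j.+1) * T j.+1) \+ (fun N => a N * T N).
  by apply/funext => N; rewrite /= !seriesEnat; exact: abel_sum.
have -> : (fun j => j.+1%:R `^ (- s) * y j) = (fun j => a j * y j) by [].
rewrite aE; apply: is_cvgD.
  apply: (@cvgn_of_sum_powRN _ (1 + s - g) (s * C)); first by lra.
  move=> j; rewrite normrM.
  have j0 : 0 < j.+1%:R :> R by rewrite ltr0n.
  have jn0 : j.+1%:R != 0 :> R by rewrite gt_eqF.
  have j20 : 0 < j.+2%:R :> R by rewrite ltr0n.
  have a1 : 0 <= a j - a j.+1 <= s * (j.+1%:R `^ (- s) * j.+1%:R^-1).
    apply/andP; split.
      rewrite subr_ge0 /a !powRN lef_pV2 ?posrE ?powR_gt0//.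
      by apply: ge0_ler_powR; rewrite ?nnegrE ?(ltW s0) ?ler_nat.
    have e : j.+2%:R = j.+1%:R * (1 + j.+1%:R^-1) :> R.
      by rewrite mulrDr mulr1 mulfV// natr1.
    have i0 : 0 <= 1 + j.+1%:R^-1 :> R by rewrite addr_ge0 ?invr_ge0.
    rewrite /a e powRM ?(ltW j0)//.
    have h : 1 - s * j.+1%:R^-1 <= (1 + j.+1%:R^-1) `^ (- s) :> R.
      by apply: powRN_1D_ge; rewrite ?invr_ge0// ltW.
    have := ler_wpM2l (powR_ge0 j.+1%:R (- s)) h.
    rewrite mulrBr mulr1 lerBlDr -lerBlDl => /le_trans; apply.
    by rewrite mulrCA.
  have /andP[a2 a3] := a1.
  rewrite (ger0_norm a2).
  apply: (@le_trans _ _ (s * (j.+1%:R `^ (- s) * j.+1%:R^-1) * (C * j.+1%:R `^ g))).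
    exact: ler_pM.
  have -> : - (1 + s - g) = - s + -1 + g by lra.
  rewrite powRD ?jn0 ?implybT// powRD ?jn0 ?implybT// powR_inv1 ?(ltW j0)//.
  by rewrite le_eqVlt; apply/orP; left; apply/eqP; ring.
apply/cvg_ex; exists 0; rewrite -(cvg_shiftS (fun N => a N * T N)).
apply/norm_cvg0P.
apply: (@squeeze_cvgr _ _ _ _ (fun=> 0) (fun N => C * N.+1%:R `^ (- (s - g)))).
- near=> N; rewrite normr_ge0/= normrM ger0_norm ?powR_ge0//.
  have -> : C * N.+1%:R `^ (- (s - g)) = N.+1%:R `^ (- s) * (C * N.+1%:R `^ g).
    rewrite opprB addrC powRD ?pnatr_eq0 ?implybT//; ring.
  apply: ler_pM; rewrite ?powR_ge0//.
  by rewrite /a !powRN lef_pV2 ?posrE ?powR_gt0//; apply: ge0_ler_powR;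
    rewrite ?nnegrE ?(ltW s0) ?ler_nat.
- exact: cvg_cst.
- rewrite -(mulr0 C); apply: cvgM; first exact: cvg_cst.
  by apply: powRN_cvg0; rewrite subr_gt0.
Unshelve. all: by end_near.
Qed.

(** From [ln (y / s) <= y / s]. *)
Lemma powR_le_expR (s y : R) : 0 < s -> 0 < y -> y `^ s <= s `^ s * expR y.
Proof.
move=> s0 y0.
have e : y = y / s * s by rewrite divfK// gt_eqF.
rewrite {1}e powRM ?divr_ge0 ?(ltW y0) ?(ltW s0)// mulrC ler_wpM2l ?powR_ge0//.
rewrite /powR gt_eqF ?divr_gt0// ler_expR {2}e mulrC ler_wpM2r ?(ltW s0)//.
by apply/ltW/ln_sublinear; rewrite divr_gt0.
Qed.

End Convergence.

(** * The law of finitely many terms *)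

Section Borel.
Variables (R : realType) (m : nat).

Lemma measurable_borel_set1 (c : 'cV[R]_m) : measurable ([set c] : set (borel_cV R m)).
Proof.
rewrite -[X in measurable X]setCK; apply: measurableC; apply: sub_sigma_algebra.
rewrite /= openC; apply: accessible_closed_set1; apply: hausdorff_accessible.
exact: norm_hausdorff.
Qed.

Lemma measurable_borel_coord (k : 'I_m) :
  measurable_fun [set: borel_cV R m] (fun v : borel_cV R m => (v : 'cV[R]_m) k 0).
Proof.
apply: (measurability _ (RGenOpens.measurableE R)) => _ /= -[_ [a [b ->] <-]].
rewrite setTI; apply: sub_sigma_algebra; rewrite /=.
apply: open_comp; last exact: interval_open.
by move=> v _; exact: coord_continuous.
Qed.

Lemma sbasis_inj : injective (@sbasis R m).
Proof.
move=> [k s] [k' s'] /matrixP/(_ k 0); rewrite !sbasisE/= eqxx mulr1.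
have n0 : (-1) ^+ s != 0 :> R by rewrite signr_eq0.
case: eqVneq => [->|_]; last by rewrite mulr0 => /eqP; rewrite (negPf n0).
by rewrite mulr1 => /(@signr_inj R) ->.
Qed.

End Borel.

Section Cells.
Variables (R : realType) (d : measure_display) (T : measurableType d).
Variables (P : probability T R) (n m : nat) (Y : 'I_n -> nat -> T -> 'cV[R]_m).
Hypothesis Yunif : forall i j, uniform_signed_basis P (Y i j).
Hypothesis Yind : mutually_independent P
  (fun (ij : 'I_n * nat) => Y ij.1 ij.2 : T -> borel_cV R m).

Lemma measurable_sample i j (c : 'cV[R]_m) : measurable [set w | Y i j w = c].
Proof.
have [mY _] := Yunif i j.
have := mY measurableT [set c] (measurable_borel_set1 c).
by rewrite setTI.
Qed.

Section Horizon.
Variable J : nat.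
Notation sample := {ffun 'I_n * 'I_J -> 'I_m * bool}.

Definition cell (f : sample) : set T :=
  [set w | forall i (j : 'I_J), Y i j w = sbasis R (f (i, j))].

Lemma cell_bigcap f : cell f =
  \bigcap_(l in [set: 'I_n * 'I_J]) [set w | Y l.1 l.2 w = sbasis R (f l)].
Proof.
by apply/seteqP; split=> [w h [i j] _|w h i j]; [exact: h|exact: (h (i, j))].
Qed.

Lemma measurable_cell f : measurable (cell f).
Proof.
rewrite cell_bigcap; apply: fin_bigcap_measurable => [|l _].
  exact: finite_finset.
exact: measurable_sample.
Qed.

Let emb (l : 'I_n * 'I_J) : 'I_n * nat := (l.1, val l.2).

Let emb_inj : injective emb.
Proof. by move=> [i j] [i' j'] [-> /val_inj ->]. Qed.

Lemma prob_cell f : P (cell f) = ((2 * m%:R)^-1 ^+ #|{: 'I_n * 'I_J}|)%:E.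
Proof.
pose A (ij : 'I_n * nat) : set (borel_cV R m) :=
  if insub ij.2 is Some j then [set sbasis R (f (ij.1, j))] else setT.
have AE l : A (emb l) = [set sbasis R (f l)].
  by case: l => i j; rewrite /A /emb/= valK.
have mA ij : measurable (A ij).
  by rewrite /A; case: insub => [j|]; [exact: measurable_borel_set1|exact: measurableT].
have su : uniq [seq emb l | l <- enum {: 'I_n * 'I_J}].
  by rewrite map_inj_uniq ?enum_uniq.
have := Yind su (fun ij _ => mA ij).
have -> : \bigcap_(ij in [set` [seq emb l | l <- enum {: 'I_n * 'I_J}]])
    ((fun ij : 'I_n * nat => Y ij.1 ij.2 : T -> borel_cV R m) ij @^-1` A ij) = cell f.
  apply/seteqP; split=> w h.
    move=> i j; have := h (emb (i, j)); rewrite /= AE; apply.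
    by apply: map_f; rewrite mem_enum.
  move=> _ /= /mapP[l _ ->]; rewrite AE.
  by case: l => i j; exact: h.
move=> ->; rewrite big_map.
rewrite (eq_bigr (fun=> ((2 * m%:R)^-1)%:E)); last first.
  move=> l _; rewrite AE; have [_ ] := Yunif (emb l).1 (emb l).2.
  by move=> /(_ (f l).1 (f l).2).
by rewrite prodEFin big_enum/= prodr_const.
Qed.

Definition cells (B : pred sample) : set T :=
  \bigcup_(f in [set` enum B]) cell f.

Lemma measurable_cells B : measurable (cells B).
Proof.
apply: fin_bigcup_measurable => [|f _]; first exact: finite_seq.
exact: measurable_cell.
Qed.

(** Up to a null event, the first [J] terms of each of the [n] sequences are
   distributed as the uniform measure on a finite set. *)
Lemma prob_cells B : P (cells B) = (pr R B)%:E.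
Proof.
rewrite /cells measure_fin_bigcup; last 3 first.
- exact: finite_seq.
- apply/trivIsetP => f g _ _ fg; apply/seteqP; split=> // w [hf hg].
  move/eqP: fg; apply; apply/ffunP => -[i j]; apply: (@sbasis_inj R m).
  by rewrite -(hf i j) -(hg i j).
- by move=> f _; exact: measurable_cell.
rewrite -fsbig_seq ?enum_uniq//.
rewrite (eq_bigr (fun=> (((2 * m%:R)^-1 ^+ #|{: 'I_n * 'I_J}|) : R)%:E)); last first.
  by move=> f _; exact: prob_cell.
rewrite sumEFin big_enum/= /pr /avg card_ffun natrX card_signed -exprVn.
congr (_%:E); rewrite sumr_const -[LHS]mulr_natl.
congr (_ * _); rewrite -sum1_card natr_sum big_mkcond/=.
by apply: eq_bigr => f _; rewrite unfold_in; case: (B f).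
Qed.

End Horizon.
End Cells.

(** * Continuity and measurability *)

Section Continuity.
Variable R : realType.

Lemma cvg_sumr (I : Type) (l : seq I) (u : I -> nat -> R) (v : I -> R) :
  (forall i, u i @ \oo --> v i) ->
  (fun N => \sum_(i <- l) u i N) @ \oo --> \sum_(i <- l) v i.
Proof.
move=> uv; elim: l => [|i l IH].
  by rewrite big_nil; under eq_fun do rewrite big_nil; exact: cvg_cst.
rewrite big_cons; under eq_fun do rewrite big_cons.
by apply: cvgD; [exact: uv|exact: IH].
Qed.

Lemma cvg_exprn (u : nat -> R) (l : R) K :
  u @ \oo --> l -> (fun N => u N ^+ K) @ \oo --> l ^+ K.
Proof.
move=> ul; elim: K => [|K IH]; first exact: cvg_cst.
rewrite exprS; under eq_fun do rewrite exprS.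
exact: (cvgM ul IH).
Qed.

Lemma cvg_norm_powR (u : nat -> R) (l s : R) : 0 < s ->
  u @ \oo --> l -> (fun N => `|u N| `^ s) @ \oo --> `|l| `^ s.
Proof.
wlog s1 : s / s <= 1 => [hw|] s0 ul.
  (* powers above 1 are integer powers of powers below 1 *)
  pose K := (Num.truncn s).+1; have K0 : 0 < K%:R :> R by rewrite ltr0n.
  have e (x : R) : `|x| `^ s = (`|x| `^ (s / K%:R)) ^+ K :> R.
    by rewrite -powR_mulrn ?powR_ge0// -powRrM divfK// gt_eqF.
  rewrite e; under eq_fun do rewrite e.
  have sK : s / K%:R <= 1.
    rewrite ler_pdivrMr// mul1r.
    by have /andP[_ /ltW] := truncn_itv (ltW s0).
  exact: cvg_exprn (hw _ sK (divr_gt0 s0 K0) ul).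
apply/cvgrPdist_lt => e e0.
have e1 : 0 < e `^ s^-1 by exact: powR_gt0.
move/cvgrPdist_lt : ul => /(_ _ e1); apply: filterS => N hN.
have key (a b : R) : `|a| `^ s - `|b| `^ s <= `|a - b| `^ s :> R.
  rewrite lerBlDr; apply: (le_trans _ (powR_subadd s0 s1 _ _)) => //.
  apply: ge0_ler_powR; rewrite ?nnegrE ?addr_ge0 ?(ltW s0)//.
  by rewrite -{1}(subrK b a) ler_normD.
have lt : `|l - u N| `^ s < e.
  have := gt0_ltr_powR s0 _ _ hN; rewrite !nnegrE normr_ge0 powR_ge0.
  move=> /(_ isT isT); rewrite -powRrM mulVf ?gt_eqF// powRr1//.
  exact: ltW.
rewrite ltr_norml; apply/andP; split.
  rewrite ltrNl opprB; apply: le_lt_trans (key _ _) _.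
  by rewrite distrC.
exact: le_lt_trans (key _ _) lt.
Qed.

Lemma cvg_psum (s : R) m (u : nat -> 'cV[R]_m) (l : 'cV[R]_m) : 0 < s ->
  (forall k, (fun N => u N k 0) @ \oo --> l k 0) ->
  (fun N => psum s (u N)) @ \oo --> psum s l.
Proof. by move=> s0 ul; apply: cvg_sumr => k; exact: cvg_norm_powR. Qed.

Lemma lnormE (s : R) m (x : 'cV[R]_m) : lnorm s x = psum s x `^ s^-1.
Proof. by []. Qed.

Lemma cvg_lnorm (s : R) m (u : nat -> 'cV[R]_m) (l : 'cV[R]_m) : 0 < s ->
  (forall k, (fun N => u N k 0) @ \oo --> l k 0) ->
  (fun N => lnorm s (u N)) @ \oo --> lnorm s l.
Proof.
move=> s0 ul; have si : 0 < s^-1 by rewrite invr_gt0.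
have := cvg_norm_powR si (cvg_psum s0 ul).
rewrite ger0_norm ?psum_ge0//.
have -> : (fun N => `|psum s (u N)| `^ s^-1) = (fun N => lnorm s (u N)).
  by apply/funext => N; rewrite ger0_norm ?psum_ge0.
by [].
Qed.

Lemma cvg_mulmx m n (A : nat -> 'M[R]_(m, n)) (B : 'M[R]_(m, n))
    (x : nat -> 'cV[R]_n) (y : 'cV[R]_n) :
  (forall k i, (fun N => A N k i) @ \oo --> B k i) ->
  (forall i, (fun N => x N i 0) @ \oo --> y i 0) ->
  forall k, (fun N => (A N *m x N) k 0) @ \oo --> (B *m y) k 0.
Proof.
move=> AB xy k; rewrite mxE; under eq_fun do rewrite mxE.
by apply: cvg_sumr => i; apply: cvgM.
Qed.

(** A closed condition that holds along a subsequence passes to the limit. *)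
Lemma frequently_le (u : nat -> R) (l c : R) : u @ \oo --> l ->
  (forall N, exists2 J, (N <= J)%N & u J <= c) -> l <= c.
Proof.
move=> ul uc; rewrite leNgt; apply/negP => cl.
have [N _ hN] : \forall N \near \oo, c < u N by exact: cvgr_gt ul _ cl.
by have [J NJ] := uc N; rewrite leNgt hN.
Qed.

Lemma frequently_ge (u : nat -> R) (l c : R) : u @ \oo --> l ->
  (forall N, exists2 J, (N <= J)%N & c <= u J) -> c <= l.
Proof.
move=> ul uc; rewrite leNgt; apply/negP => cl.
have [N _ hN] : \forall N \near \oo, u N < c by exact: cvgr_lt ul _ cl.
by have [J NJ] := uc N; rewrite leNgt hN.
Qed.

Definition grid n (zN : {ffun 'I_n -> int} * nat) : 'cV[R]_n :=
  \col_i ((zN.1 i)%:~R / zN.2.+1%:R).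

Lemma grid_dense n (x : 'cV[R]_n) : exists z : nat -> {ffun 'I_n -> int},
  forall i, (fun N => grid (z N, N) i 0) @ \oo --> x i 0.
Proof.
exists (fun N => [ffun i => Num.floor (x i 0 * N.+1%:R)]) => i.
apply/cvgrPdist_lt => e e0.
have /cvgrPdist_lt/(_ e e0) := @cvg_harmonic R.
apply: filterS => N; rewrite sub0r normrN /= ger0_norm ?invr_ge0// => hN.
rewrite mxE ffunE /=.
have N0 : 0 < N.+1%:R :> R by rewrite ltr0n.
set a := x i 0 * N.+1%:R.
have -> : x i 0 - (Num.floor a)%:~R / N.+1%:R = (a - (Num.floor a)%:~R) / N.+1%:R.
  by rewrite /a mulrBl mulfK// gt_eqF.
have a0 : 0 <= a - (Num.floor a)%:~R by rewrite subr_ge0 ge_floor.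
rewrite ger0_norm ?divr_ge0//; apply: le_lt_trans hN.
rewrite ler_pdivrMr// mulVf ?gt_eqF// lerBlDl.
by rewrite -[1]/(1%:~R) -intrD ltW// lt_succ_floor.
Qed.

End Continuity.

Section Measurability.
Variables (R : realType) (d : measure_display) (T : measurableType d).

Lemma measurable_fun_sumr (D : set T) (I : Type) (l : seq I) (f : I -> T -> R) :
  (forall i, measurable_fun D (f i)) ->
  measurable_fun D (fun w => \sum_(i <- l) f i w).
Proof.
move=> mf; elim: l => [|i l IH].
  by under eq_fun do rewrite big_nil; exact: measurable_cst.
under eq_fun do rewrite big_cons.
exact: measurable_funD.
Qed.

Lemma is_cvgn_cauchyP (u : nat -> R) : cvgn u <->
  forall e : nat, exists N, forall a, `|u (N + a)%N - u N| <= e.+1%:R^-1.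
Proof.
split=> [/cvg_ex[l ul] e|h].
  have e0 : 0 < (2 * e.+1%:R)^-1 :> R by rewrite invr_gt0 mulr_gt0 ?ltr0n.
  move/cvgrPdist_lt : ul => /(_ _ e0)[N _ hN].
  exists N => a.
  have h1 := hN (N + a)%N (leq_addr _ _); have h2 := hN N (leqnn _).
  have -> : u (N + a)%N - u N = (l - u N) - (l - u (N + a)%N) by ring.
  apply: (le_trans (ler_normB _ _)).
  have -> : e.+1%:R^-1 = (2 * e.+1%:R)^-1 + (2 * e.+1%:R)^-1 :> R.
    by field; rewrite gt_eqF// ltr0n.
  by apply: lerD; exact: ltW.
apply/cauchy_cvgP; apply: cauchy_exP => e e0.
have [N hN] := h (Num.truncn e^-1).
exists (u N); exists N => // M /= NM.
rewrite /ball/= distrC -(subnKC NM); apply: le_lt_trans (hN _) _.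
have ei : 0 <= e^-1 by rewrite invr_ge0 ltW.
have /andP[_ h2] := truncn_itv ei.
by rewrite invf_plt ?posrE ?ltr0n.
Qed.

Lemma measurable_is_cvgn (u : nat -> T -> R) :
  (forall N, measurable_fun setT (u N)) ->
  measurable [set w | cvgn (u ^~ w)].
Proof.
move=> mu.
have -> : [set w | cvgn (u ^~ w)] =
  \bigcap_e \bigcup_N \bigcap_a [set w | `|u (N + a)%N w - u N w| <= e.+1%:R^-1].
  apply/seteqP; split=> w /=.
    move=> /is_cvgn_cauchyP h e _; have [N hN] := h e.
    by exists N => // a _; exact: hN.
  move=> h; apply/is_cvgn_cauchyP => e.
  by have [N _ hN] := h e I; exists N => a; exact: hN.
apply: bigcapT_measurable => e; apply: bigcupT_measurable => N.
apply: bigcapT_measurable => a.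
have mg : measurable_fun setT (fun w => `|u (N + a)%N w - u N w|).
  by apply: measurableT_comp => //; exact: measurable_funB.
have := mg measurableT _ (measurable_itv `]-oo, (e.+1%:R^-1 : R)]).
by rewrite setTI; congr measurable.
Qed.

End Measurability.

(** * Almost sure convergence *)

Section AlmostSure.
Variables (R : realType) (d : measure_display) (T : measurableType d).
Variables (P : probability T R) (n m : nat) (Y : 'I_n -> nat -> T -> 'cV[R]_m).
Hypothesis m_gt0 : (0 < m)%N.
Hypothesis Yunif : forall i j, uniform_signed_basis P (Y i j).
Hypothesis Yind : mutually_independent P
  (fun (ij : 'I_n * nat) => Y ij.1 ij.2 : T -> borel_cV R m).

Definition order (p : R) : R := (2^-1 + p^-1) / 2.

(** The partial sums up to [N] of a coordinate of the i-th sequence are of order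
   [N ^ (1 / 2)]; a slightly larger power of [N], still below [N ^ (1 / p)],
   gives summable probabilities. *)
Definition large_walk (p : R) i k (N : nat) : set T :=
  @cells R d T n m Y N (fun f => N%:R `^ order p <
    `|\sum_j sbasis R (f (i, j)) k 0|).

Definition walk_const (p : R) : R :=
  2 * ((2 / (2 * order p - 1)) `^ (2 / (2 * order p - 1)) *
       8 `^ (2 / (2 * order p - 1))).

Lemma prob_large_walk (p : R) i k N : 0 < p -> p < 2 -> (0 < N)%N ->
  (P (large_walk p i k N) <= (walk_const p * N%:R `^ (- 2))%:E)%E.
Proof.
move=> p0 p2 N0; rewrite /large_walk (prob_cells Yunif Yind) lee_fin.
have N1 : 0 < N%:R :> R by rewrite ltr0n.
have Nn0 : N%:R != 0 :> R by rewrite gt_eqF.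
have p12 : 2^-1 < p^-1 by rewrite ltf_pV2 ?posrE.
set g := order p; have g1 : 2^-1 < g by rewrite /g /order; lra.
set ep := 2 * g - 1; have ep0 : 0 < ep by rewrite /ep; lra.
pose X : R := N%:R `^ ep; have X0 : 0 < X by exact: powR_gt0.
pose th : R := N%:R `^ (g - 1) / 4.
have th0 : 0 < th by rewrite divr_gt0// powR_gt0.
pose a (l : 'I_n * 'I_N) : R := if l.1 == i then th else 0.
have aE (f : {ffun 'I_n * 'I_N -> 'I_m * bool}) :
    ssum a f k 0 = th * \sum_j sbasis R (f (i, j)) k 0.
  rewrite ssumE sum_pair/= (bigD1 i)//= [X in _ + X]big1 ?addr0 => [|i' ii].
    by rewrite mulr_sumr; apply: eq_bigr => j _; rewrite /a/= eqxx.
  by rewrite big1// => j _; rewrite /a/= (negPf ii) mul0r.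
have a2 : \sum_l a l ^+ 2 = th ^+ 2 * N%:R.
  rewrite sum_pair/= (bigD1 i)//= [X in _ + X]big1 ?addr0 => [|i' ii].
    rewrite (eq_bigr (fun=> th ^+ 2)) => [|j _]; last by rewrite /a/= eqxx.
    by rewrite sumr_const card_ord mulr_natr.
  by rewrite big1// => j _; rewrite /a/= (negPf ii) expr0n.
have e1 : th * N%:R `^ g = X / 4.
  rewrite /th /X mulrAC -powRD ?Nn0 ?implybT//.
  by congr (_ `^ _ / _); rewrite /ep; ring.
have e2 : 2 * (th ^+ 2 * N%:R) = X / 8.
  rewrite /th /X expr_div_n -powR_mulrn ?powR_ge0// -powRrM.
  have -> : N%:R `^ ep = N%:R `^ ((g - 1) * 2) * N%:R :> R.
    rewrite -{3}(powRr1 (ltW N1)) -powRD ?Nn0 ?implybT//.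
    by congr (_ `^ _); rewrite /ep; ring.
  by field.
apply: (le_trans (markov_avg (c := expR (X / 4))
  (F := fun f : {ffun 'I_n * 'I_N -> 'I_m * bool} => expR `|ssum a f k 0|) _ _ _)).
- exact: expR_gt0.
- by move=> f; exact: expR_ge0.
- move=> f /= hf; rewrite ler_expR aE normrM (gtr0_norm th0) -e1.
  by rewrite ler_pM2l// ltW.
rewrite ler_pdivrMr ?expR_gt0//.
apply: (le_trans (avg_exp_coord m_gt0 a k)); rewrite a2 e2.
have s0 : 0 < 2 / ep by exact: divr_gt0.
have p8 : 0 < 8 :> R by [].
have := powR_le_expR s0 (divr_gt0 X0 p8).
set s := 2 / ep in s0 *.
rewrite powR_div ?(ltW X0)// -powRrM mulrCA mulfV ?mulr1 ?(gt_eqF ep0)// => h.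
have h8 : 0 < 8 `^ s :> R by exact: powR_gt0.
have NN : 0 < N%:R `^ 2 :> R by exact: powR_gt0.
rewrite ler_pdivrMr// in h.
have -> : X / 4 = X / 8 + X / 8 by field.
rewrite expRD mulrA; apply: ler_wpM2r; first exact: expR_ge0.
rewrite /walk_const -/g -/ep -/s powRN -!mulrA ler_peMr//.
have -> : s `^ s * (8 `^ s * ((N%:R `^ 2)^-1 * expR (X / 8))) =
    s `^ s * expR (X / 8) * 8 `^ s / N%:R `^ 2 by ring.
by rewrite ler_pdivlMr// mul1r.
Qed.

End AlmostSure.

Lemma negligible_bigcup_count d (T : measurableType d) (R : realType)
    (mu : {measure set T -> \bar R}) (I : countType) (F : I -> set T) :
  (forall i, mu.-negligible (F i)) -> mu.-negligible (\bigcup_i F i).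
Proof.
move=> hF; pose G (N : nat) := if unpickle N is Some i then F i else set0.
apply: (@negligibleS _ _ _ mu (\bigcup_N G N)).
  by move=> w [i _ Fw]; exists (pickle i) => //; rewrite /G pickleK.
apply: negligible_bigcup => N; rewrite /G.
by case: unpickle => [i|]; [exact: hF | exact: negligible_set0].
Qed.

Section AlmostSureConvergence.
Variables (R : realType) (d : measure_display) (T : measurableType d).
Variables (P : probability T R) (n m : nat) (Y : 'I_n -> nat -> T -> 'cV[R]_m).
Hypothesis m_gt0 : (0 < m)%N.
Hypothesis Yunif : forall i j, uniform_signed_basis P (Y i j).
Hypothesis Yind : mutually_independent P
  (fun (ij : 'I_n * nat) => Y ij.1 ij.2 : T -> borel_cV R m).
Variable p : R.
Hypotheses (p_gt0 : 0 < p) (p_lt2 : p < 2).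

(** By Borel-Cantelli, the probabilities of [prob_large_walk] being summable. *)
Lemma negligible_large_walk i k :
  P.-negligible (lim_sup_set (fun N => large_walk Y p i k N.+1)).
Proof.
have mF N : measurable (large_walk Y p i k N.+1).
  exact: (measurable_cells Yunif).
have C0 : 0 <= walk_const p.
  by rewrite /walk_const !mulr_ge0 ?powR_ge0.
apply/negligibleP.
  apply: bigcap_measurable => // N _.
  by apply: bigcup_measurable => j _; exact: mF.
apply: lim_sup_set_cvg0 => //.
apply: (@le_lt_trans _ _ (walk_const p * 2)%:E); last by rewrite ltry.
apply: lime_le.
  by apply: is_cvg_nneseries => N _ _; exact: measure_ge0.
apply: nearW => N.
apply: (@le_trans _ _ (\sum_(0 <= j < N) (walk_const p * j.+1%:R `^ (- 2))%:E)%E).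
  by apply: lee_sum => j _; exact: (prob_large_walk m_gt0 Yunif Yind).
rewrite sumEFin lee_fin -mulr_sumr ler_wpM2l//.
apply: (@le_trans _ _ (\sum_(0 <= j < N.+1) j.+1%:R `^ (- 2))).
  by rewrite [leRHS]big_nat_recr//= lerDl powR_ge0.
rewrite big_ltn// powR1.
have := @sum_powRN_tail R 2 1 N.+1 _ isT; rewrite ltr1n => /(_ isT).
rewrite powR1 (_ : 2 - 1 = 1 :> R); last by lra.
by rewrite divr1 -(lerD2l 1) => /le_trans; apply; lra.
Qed.

Lemma negligible_not_cells J :
  P.-negligible (~` cells Y (J := J) predT).
Proof.
have mC := measurable_cells (T := T) Yunif (J := J) predT.
apply/negligibleP; first exact: measurableC.
apply: (etrans (probability_setC P mC)); rewrite (prob_cells Yunif Yind).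
rewrite /pr (@eq_avg _ _ _ (fun=> 1))// avg_cst ?subee//.
by rewrite card_ffun expn_gt0 card_prod card_ord card_bool muln_gt0 m_gt0.
Qed.

Lemma weighted_seriesE (y : nat -> 'cV[R]_m) N k :
  weighted_series p y N k 0 =
  series (fun j => j.+1%:R `^ (- p^-1) * y j k 0) N.
Proof.
rewrite /weighted_series !seriesEnat/= summxE; apply: eq_bigr => j _.
by rewrite mxE powRN.
Qed.

Definition coord_cvg i k : set T :=
  [set w | cvgn (fun N => weighted_series p (fun j => Y i j w) N k 0)].

Lemma measurable_partial_sum i k N :
  measurable_fun setT (fun w => weighted_series p (fun j => Y i j w) N k 0).
Proof.
under eq_fun do rewrite weighted_seriesE seriesEnat/=.
apply: measurable_fun_sumr => j; apply: measurable_funM; first exact: measurable_cst.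
have [mY _] := Yunif i j.
exact: (measurableT_comp (measurable_borel_coord k) mY).
Qed.

Lemma measurable_coord_cvg i k : measurable (coord_cvg i k).
Proof. by apply: measurable_is_cvgn => N; exact: measurable_partial_sum. Qed.

(** If the partial sums of the signs are large only finitely often, the series
   converges by summation by parts. *)
Lemma negligible_not_coord_cvg i k : P.-negligible (~` coord_cvg i k).
Proof.
apply: (@negligibleS _ _ _ P (lim_sup_set (fun N => large_walk Y p i k N.+1) `|`
    \bigcup_J ~` cells Y (J := J) predT)); last first.
  apply: negligibleU; first exact: negligible_large_walk.
  by apply: negligible_bigcup => J; exact: negligible_not_cells.
move=> w /= hw; apply: contrapT => /not_orP[h1 h2]; apply: hw; rewrite /coord_cvg/=.
pose S N : R := \sum_(0 <= j < N) Y i j w k 0.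
have [N0 hN0] : exists N0, forall N, (N0 <= N)%N -> `|S N.+1| <= N.+1%:R `^ order p.
  move: h1; rewrite /lim_sup_set => /existsNP[N0] /not_implyP[_ h1]; exists N0.
  move=> N NN; rewrite leNgt; apply/negP => hS; apply: h1; exists N => //.
  have [f _ wf] : cells Y (J := N.+1) predT w.
    by apply: contrapT => hc; apply: h2; exists N.+1.
  exists f => //=; rewrite mem_enum unfold_in.
  move: hS; rewrite /S big_mkord; congr (_ < `|_|).
  by apply: eq_bigr => j _; rewrite wf.
under eq_fun do rewrite weighted_seriesE.
have p12 : 2^-1 < p^-1 by rewrite ltf_pV2 ?posrE.
have g0 : 0 <= order p by rewrite /order; lra.
apply: (@cvgn_abel _ _ S p^-1 (order p) (1 + \sum_(0 <= N < N0) `|S N.+1|)).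
- by rewrite invr_gt0.
- by rewrite /order; lra.
- by rewrite /S big_geq.
- by move=> N; rewrite /S big_nat_recr.
- move=> N; have [NN|NN] := leqP N0 N.
    apply: (le_trans (hN0 N NN)); rewrite ler_peMl ?powR_ge0// lerDl.
    exact: sumr_ge0.
  apply: (@le_trans _ _ (1 + \sum_(0 <= N < N0) `|S N.+1|)).
    rewrite (big_cat_nat (n := N))//=; last exact: ltnW.
    rewrite [X in _ + (_ + X)]big_ltn//=.
    set A := \sum_(0 <= _ < _) _; set B := \sum_(_ <= _ < _) _.
    have A0 : 0 <= A by exact: sumr_ge0.
    have B0 : 0 <= B by exact: sumr_ge0.
    by lra.
  rewrite ler_peMr ?addr_ge0 ?sumr_ge0// -[leLHS](powRr0 N.+1%:R).
  by rewrite ler_powR// ler1n.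
Qed.

Definition series_cvg : set T :=
  [set w | forall i, cvgn (weighted_series p (fun j => Y i j w))].

Lemma series_cvgE :
  series_cvg = \bigcap_(ik in [set: 'I_n * 'I_m]) coord_cvg ik.1 ik.2.
Proof.
apply/seteqP; split=> [w h [i k] _|w h i].
  exact: (is_cvg_cVP _).1 (h i) k.
by apply/is_cvg_cVP => k; exact: (h (i, k) I).
Qed.

Lemma measurable_series_cvg : measurable series_cvg.
Proof.
rewrite series_cvgE; apply: fin_bigcap_measurable => [|l _].
  exact: finite_finset.
exact: measurable_coord_cvg.
Qed.

Lemma negligible_not_series_cvg : P.-negligible (~` series_cvg).
Proof.
rewrite series_cvgE setC_bigcap; apply: negligible_bigcup_count => l.
exact: negligible_not_coord_cvg.
Qed.

End AlmostSureConvergence.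

(** * The random matrix *)

Lemma measurable_fun_powR d (T : measurableType d) (R : realType) (D : set T)
    (g : T -> R) (s : R) :
  measurable_fun D g -> measurable_fun D (fun w => g w `^ s).
Proof. by move=> mg; exact: (measurableT_comp (measurable_powR s) mg). Qed.

Section RandomMatrix.
Variables (R : realType) (p q r : R).
Hypotheses (r_gt0 : 0 < r) (ltrp : r < p) (p_lt2 : p < 2) (r_le1 : r <= 1).
Hypothesis pqr : p^-1 + q^-1 = r^-1.

Let p_gt0 : 0 < p. Proof. exact: lt_trans ltrp. Qed.

Let rV_gt0 : 0 < r^-1. Proof. by rewrite invr_gt0. Qed.

Let sig := 1 - r / p.

Let qr : q^-1 * r = sig.
Proof.
have -> : q^-1 = r^-1 - p^-1 by rewrite -pqr addrAC subrr add0r.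
by rewrite mulrBl mulVf ?gt_eqF// [p^-1 * r]mulrC.
Qed.

Let sigV : sig * r^-1 = q^-1.
Proof. by rewrite -qr mulfK// gt_eqF. Qed.

Lemma psum_col_mx m n (x : 'cV[R]_m) (y : 'cV[R]_n) :
  psum r (col_mx x y) = psum r x + psum r y.
Proof.
rewrite /psum big_split_ord/=; congr (_ + _); apply: eq_bigr => i _.
  by rewrite col_mxEu.
by rewrite col_mxEd.
Qed.

Lemma psum_Wmx n m (c eta : R) (y : 'I_n -> nat -> 'cV[R]_m) (x : 'cV[R]_n) :
  (0 < n)%N -> 0 <= c -> 0 < ln (1 + eta^-1) ->
  psum r (Wmx p q c eta y *m x) = (n%:R `^ sig)^-1 *
    (psum r x + c `^ r / ln (1 + eta^-1) `^ sig * psum r (Smx p y *m x)).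
Proof.
move=> n0 c0 L0; have np : 0 < n%:R :> R by rewrite ltr0n.
rewrite /Wmx -scalemxAl mul_col_mx mul1mx -scalemxAl psumZ psum_col_mx psumZ.
have -> : `|(n%:R `^ q^-1)^-1| `^ r = (n%:R `^ sig)^-1 :> R.
  by rewrite ger0_norm ?invr_ge0 ?powR_ge0// -powRN -powRrM mulNr qr powRN.
have -> : `|c / ln (1 + eta^-1) `^ q^-1| `^ r = c `^ r / ln (1 + eta^-1) `^ sig.
  by rewrite ger0_norm ?divr_ge0 ?powR_ge0// powR_div ?powR_ge0// -powRrM qr.
by [].
Qed.

Lemma Wmx_bounds n m k (M eta : R) (low : bool) (y : 'I_n -> nat -> 'cV[R]_m) :
  (0 < m)%N -> (m <= n)%N -> (0 < k)%N -> (k <= n)%N -> m%:R <= M ->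
  eta = m%:R / n%:R -> 0 < ln (1 + eta^-1) ->
  kappa (sparsity p r) * M <= 2 * ln (1 + eta^-1) * k%:R ->
  (low -> M = m%:R) ->
  (~~ low -> kappa (sparsity p r) * m%:R <= ln (1 + eta^-1)) ->
  net_good p r k M low (Smx p y) ->
  forall x : 'cV[R]_n,
  lower_pow p r `^ r^-1 * (eta / ln (1 + eta^-1)) `^ q^-1 * lnorm p x <=
  lnorm r (Wmx p q (scale_pow p r `^ r^-1) eta y *m x) <=
  3 * 2 `^ r^-1 * lnorm p x.
Proof.
move=> m0 mn k0 kn mM etaE L0 kM lowM notlow good x.
have n0 : (0 < n)%N by exact: leq_trans mn.
have np : 0 < n%:R :> R by rewrite ltr0n.
have mp : 0 < m%:R :> R by rewrite ltr0n.
have ns : 0 < n%:R `^ sig by exact: powR_gt0.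
have D0 : 0 < scale_pow p r by exact: scale_pow_gt0.
have C0 : 0 < lower_pow p r by exact: lower_pow_gt0.
have eta0 : 0 <= eta by rewrite etaE divr_ge0.
rewrite !lnormE psum_Wmx ?powR_ge0// -powRrM mulVf ?gt_eqF// powRr1 ?(ltW D0)//.
set L := ln _ in L0 kM notlow *.
have hu := good_upper r_gt0 ltrp p_lt2 r_le1 m0 mn k0 kn mM L0 kM good x.
have hl := good_lower r_gt0 ltrp p_lt2 r_le1 m0 k0 kn mM L0 kM lowM notlow good x.
rewrite -/sig in hu hl *.
set V := psum r x + _ in hu hl *.
have V0 : 0 <= V.
  apply: addr_ge0; first exact: psum_ge0.
  apply: mulr_ge0; last exact: psum_ge0.
  exact: divr_ge0 (ltW D0) (powR_ge0 _ _).
have NE : psum p x `^ p^-1 = (psum p x `^ (r / p)) `^ r^-1.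
  by rewrite -powRrM mulrAC divff ?mul1r// gt_eqF.
set N := psum p x `^ (r / p) in hu hl NE.
have N0 : 0 <= N by exact: powR_ge0.
apply/andP; split.
  have -> : lower_pow p r `^ r^-1 * (eta / L) `^ q^-1 * psum p x `^ p^-1 =
      (lower_pow p r * ((eta / L) `^ sig * N)) `^ r^-1.
    rewrite NE [RHS]powRM ?mulr_ge0 ?powR_ge0 ?(ltW C0)//.
    by rewrite [X in _ = _ * X]powRM ?powR_ge0// -[(_ `^ sig) `^ _]powRrM sigV mulrA.
  apply: ge0_ler_powR; rewrite ?nnegrE ?(ltW rV_gt0)//.
  - by rewrite !mulr_ge0 ?powR_ge0 ?(ltW C0).
  - by rewrite mulr_ge0 ?invr_ge0 ?(ltW ns).
  rewrite ler_pdivlMl//; apply: le_trans hl.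
  have -> : (m%:R / L) `^ sig = n%:R `^ sig * (eta / L) `^ sig.
    rewrite -powRM ?divr_ge0 ?(ltW L0)//; congr (_ `^ _).
    by rewrite etaE mulrA mulrCA mulfV ?gt_eqF// mulr1.
  by rewrite le_eqVlt; apply/orP; left; apply/eqP; ring.
apply: (@le_trans _ _ (2 `^ r^-1 * psum p x `^ p^-1)).
  rewrite NE -powRM//; apply: ge0_ler_powR; rewrite ?nnegrE ?(ltW rV_gt0)//.
  - by rewrite mulr_ge0 ?invr_ge0 ?(ltW ns).
  - by rewrite mulr_ge0.
  rewrite ler_pdivrMl//; apply: (le_trans hu).
  by rewrite le_eqVlt; apply/orP; left; apply/eqP; ring.
by rewrite ler_wpM2r ?powR_ge0// ler_peMl ?powR_ge0// ler1n.
Qed.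

Section Sample.
Variables (d : measure_display) (T : measurableType d).
Variables (P : probability T R) (n m : nat) (Y : 'I_n -> nat -> T -> 'cV[R]_m).
Hypotheses (m_gt0 : (0 < m)%N) (n_gt0 : (0 < n)%N).
Hypothesis Yunif : forall i j, uniform_signed_basis P (Y i j).

Let y w i j := Y i j w.

Lemma measurable_Smx k i :
  measurable_fun (series_cvg Y p) (fun w => Smx p (y w) k i).
Proof.
apply: (@measurable_fun_cvg _ _ _ _
  (fun N w => weighted_series p (fun j => Y i j w) N k 0)).
  move=> N; apply: (measurable_funS measurableT) => //.
  exact: (measurable_partial_sum Yunif).
by move=> w hw; rewrite mxE; apply: cvg_coord; exact: hw.
Qed.

Lemma measurable_lnorm_Wmx (c eta : R) (x : 'cV[R]_n) :
  0 <= c -> 0 < ln (1 + eta^-1) ->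
  measurable_fun (series_cvg Y p) (fun w => lnorm r (Wmx p q c eta (y w) *m x)).
Proof.
move=> c0 L0; under eq_fun do rewrite lnormE psum_Wmx//.
apply: measurable_fun_powR.
apply: measurable_funM; first exact: measurable_cst.
apply: measurable_funD; first exact: measurable_cst.
apply: measurable_funM; first exact: measurable_cst.
apply: measurable_fun_sumr => k.
apply: measurable_fun_powR; apply: measurableT_comp => //.
under eq_fun do rewrite mxE.
apply: measurable_fun_sumr => i; apply: measurable_funM; last exact: measurable_cst.
exact: measurable_Smx.
Qed.

Definition embedding_event (c1 c2 c eta : R) : set T :=
  [set w | (forall i, cvgn (weighted_series p (y w i))) /\
    (forall x : 'cV[R]_n, c1 * lnorm p x <=
      lnorm r (Wmx p q c eta (y w) *m x) <= c2 * lnorm p x)].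

(** By continuity, it is enough to test vectors of a countable dense set. *)
Lemma measurable_embedding_event (c1 c2 c eta : R) :
  0 <= c -> 0 < ln (1 + eta^-1) -> measurable (embedding_event c1 c2 c eta).
Proof.
move=> c0 L0.
pose F (g : {ffun 'I_n -> int} * nat) : set T := series_cvg Y p `&`
  [set w | c1 * lnorm p (grid R g) <=
    lnorm r (Wmx p q c eta (y w) *m grid R g) <= c2 * lnorm p (grid R g)].
have mF g : measurable (F g).
  have mS := measurable_series_cvg Yunif p.
  have := measurable_lnorm_Wmx (grid R g) c0 L0 mS (measurable_itv
    `[c1 * lnorm p (grid R g), c2 * lnorm p (grid R g)]).
  by congr measurable; apply/seteqP; split=> w [h1 h2]; split=> //;
    move: h2; rewrite /= in_itv.
have -> : embedding_event c1 c2 c eta = \bigcap_N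
    (if unpickle N is Some g then F g else setT).
  apply/seteqP; split=> w.
    move=> [h1 h2] N _; case: unpickle => // g; split; first exact: h1.
    exact: h2.
  move=> h; have hF g : F g w by have := h (pickle g) I; rewrite pickleK.
  split; first by have [] := hF ([ffun=> 0], 0%N).
  move=> x; have [z zx] := grid_dense x.
  have cp := cvg_lnorm p_gt0 zx.
  have cW : (fun N => lnorm r (Wmx p q c eta (y w) *m grid R (z N, N))) @ \oo -->
      lnorm r (Wmx p q c eta (y w) *m x).
    apply: cvg_lnorm => //; apply: cvg_mulmx => // k i; exact: cvg_cst.
  have h2 N : 0 <= lnorm r (Wmx p q c eta (y w) *m grid R (z N, N)) -
      c1 * lnorm p (grid R (z N, N)).
    by rewrite subr_ge0; have [_ /andP[]] := hF (z N, N).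
  have h3 N : 0 <= c2 * lnorm p (grid R (z N, N)) -
      lnorm r (Wmx p q c eta (y w) *m grid R (z N, N)).
    by rewrite subr_ge0; have [_ /andP[]] := hF (z N, N).
  apply/andP; split; rewrite -subr_ge0.
    apply: (frequently_ge (cvgB cW (cvgM (cvg_cst c1) cp))) => N.
    by exists N => //; exact: h2.
  apply: (frequently_ge (cvgB (cvgM (cvg_cst c2) cp) cW)) => N.
  by exists N => //; exact: h3.
apply: bigcapT_measurable => N; case: unpickle => [g|]; first exact: mF.
exact: measurableT.
Qed.

(** The conditions on the net are closed, so that they pass to the limit of the
   partial sums along a subsequence. *)
Lemma net_good_limit k (M : R) (low : bool) w : series_cvg Y p w ->
  (forall N, exists2 J, (N <= J)%N & cells Y (@net_goodb R p r n m k M low J) w) ->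
  net_good p r k M low (Smx p (y w)).
Proof.
move=> wc wG z zN.
pose SJ J : 'M[R]_(m, n) :=
  \matrix_(k, i) weighted_series p (fun j => Y i j w) J k 0.
have cS : (fun J => psum r (SJ J *m ivec R z)) @ \oo -->
    psum r (Smx p (y w) *m ivec R z).
  apply: cvg_psum => //; apply: cvg_mulmx => [k' i|i]; last exact: cvg_cst.
  rewrite mxE; under eq_fun do rewrite mxE.
  by apply: cvg_coord; exact: wc.
have good N : exists2 J, (N <= J)%N & net_good p r k M low (SJ J).
  have [J NJ [f /=]] := wG N; rewrite mem_enum unfold_in => fG wf.
  exists J => //; have := net_goodbP fG; congr net_good.
  apply/matrixP => k' i; rewrite !mxE weighted_seriesE seriesEnat/= big_mkord.
  by apply: eq_bigr => j _; rewrite wf weightE.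
split=> [|lowT].
  apply: (frequently_le cS) => N; have [J NJ gJ] := good N.
  by exists J => //; have [] := gJ z zN.
apply: (frequently_ge cS) => N; have [J NJ gJ] := good N.
by exists J => //; have [_ ->] := gJ z zN.
Qed.

Hypothesis Yind : mutually_independent P
  (fun (ij : 'I_n * nat) => Y ij.1 ij.2 : T -> borel_cV R m).

(** Reverse Fatou lemma for events. *)
Lemma prob_frequently_ge (G : nat -> set T) (e : R) :
  (forall N, measurable (G N)) -> (forall N, ((1 - e)%:E <= P (G N))%E) ->
  ((1 - e)%:E <= P (lim_sup_set G))%E.
Proof.
move=> mG PG; have h := lim_sup_set_cvg P G mG.
have fin : (P (\bigcup_(k in [set k | (0 <= k)%N]) G k) < +oo)%E.
  apply: le_lt_trans (probability_le1 _ _) _; last exact: ltry.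
  by apply: bigcup_measurable => k _; exact: mG.
have c := h fin; rewrite -(cvg_lim _ c)//; apply: lime_ge.
  by apply/cvg_ex; exists (P (lim_sup_set G)).
apply: nearW => N; apply: (le_trans (PG N)); apply: le_measure.
- by rewrite inE; exact: mG.
- by rewrite inE; apply: bigcup_measurable => k _; exact: mG.
- by move=> w hw; exists N => /=.
Qed.

Lemma prob_net_good k (M : R) (low : bool) (E : set T) :
  (0 < k <= n)%N -> m%:R <= M ->
  k%:R * (1 + ln (n%:R / k%:R)) <= sparsity p r * M ->
  (low -> M = m%:R /\ k%:R <= sparsity p r * m%:R) ->
  measurable E ->
  (forall w, series_cvg Y p w -> net_good p r k M low (Smx p (y w)) -> E w) ->
  ((1 - 2 * expR (- (lower_rate p / 4 * m%:R)))%:E <= P E)%E.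
Proof.
move=> kn mM kM hlow mE hE.
pose G N := cells Y (@net_goodb R p r n m k M low (m + N)).
have mG N : measurable (G N) by exact: (measurable_cells Yunif).
have PG N : ((1 - 2 * expR (- (lower_rate p / 4 * m%:R)))%:E <= P (G N))%E.
  rewrite /G (prob_cells Yunif Yind) lee_fin.
  have := pr_net_bad_le r_gt0 ltrp p_lt2 r_le1 (J := (m + N)%N) m_gt0
    (leq_addr _ _) kn mM kM hlow.
  set B := pr R _ => hB; rewrite lerBlDr -lerBlDl; apply: le_trans hB.
  rewrite lerBlDl /B /pr.
  have c0 : (0 < #|{: {ffun 'I_n * 'I_(m + N) -> 'I_m * bool}}|)%N.
    by rewrite card_ffun expn_gt0 card_prod card_ord card_bool muln_gt0 m_gt0.
  rewrite -[leLHS](avg_cst (1 : R) c0) /avg -mulrDl ler_wpM2r ?invr_ge0//.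
  rewrite -big_split/=; apply: ler_sum => f _.
  by case: net_goodb; rewrite ?addr0 ?add0r.
have := prob_frequently_ge mG PG; move/le_trans; apply.
have [N [mN PN cN]] := negligible_not_series_cvg m_gt0 Yunif Yind p_gt0 p_lt2.
have mlim : measurable (lim_sup_set G).
  apply: bigcap_measurable => // N' _.
  by apply: bigcup_measurable => j _; exact: mG.
apply: (@le_trans _ _ (P (E `|` N))).
  apply: le_measure; rewrite ?inE//; first exact: measurableU.
  move=> w hw; have [wc|wc] := pselect (series_cvg Y p w); last by right; exact: cN.
  left; apply: hE => //; apply: net_good_limit => // N'.
  have [J /= NJ GJ] := hw N' I; exists (m + J)%N => //.
  exact: leq_trans NJ (leq_addl _ _).
apply: (le_trans (measureU2 _ mE mN)).
by rewrite [X in (_ + X)%E]PN adde0.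
Qed.

End Sample.
End RandomMatrix.

Theorem theorem2 (R : realType) (p q r : R) (r_gt0 : 0 < r) (ltrp : r < p)
    (p_lt2 : p < 2) (r_le1 : r <= 1) (pqr : p^-1 + q^-1 = r^-1) :
  exists c' b c : R, [/\ 0 < c', 0 < b, 0 < c &
    forall (eta : R) (n m : nat), 0 < eta -> eta <= 1 ->
      (0 < m)%N -> eta * n%:R = m%:R ->
    forall (d : measure_display) (T : measurableType d) (P : probability T R)
      (Y : 'I_n -> nat -> T -> 'cV[R]_m),
      (forall i j, uniform_signed_basis P (Y i j)) ->
      mutually_independent P
        (fun (ij : 'I_n * nat) => Y ij.1 ij.2 : T -> borel_cV R m) ->
    let y w i j := Y i j w in
    let E := [set w : T |
      (forall i, cvgn (weighted_series p (y w i))) /\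
      (forall x : 'cV[R]_n,
        c * (eta / ln (1 + eta^-1)) `^ q^-1 * lnorm p x
          <= lnorm r (Wmx p q c' eta (y w) *m x)
          <= 3 * 2 `^ r^-1 * lnorm p x)] in
    measurable E /\
    ((1 - 2 * expR (- (b * eta * n%:R)))%:E < P E)%E].
Proof.
have lr0 : 0 < lower_rate p by exact: lower_rate_gt0 ltrp.
exists (scale_pow p r `^ r^-1), (lower_rate p / 8), (lower_pow p r `^ r^-1).
split.
- by rewrite powR_gt0// scale_pow_gt0.
- by rewrite divr_gt0.
- by rewrite powR_gt0// lower_pow_gt0.
move=> eta n m eta0 eta1 m0 etam d T P Y Yunif Yind y E.
have mp : 0 < m%:R :> R by rewrite ltr0n.
have mn : (m <= n)%N by rewrite -(ler_nat R) -etam ler_piMl.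
have n0 : (0 < n)%N by exact: leq_trans mn.
have np : 0 < n%:R :> R by rewrite ltr0n.
have etaE : eta = m%:R / n%:R by rewrite -etam mulfK// gt_eqF.
have LE : ln (1 + eta^-1) = logratio R n m by rewrite /logratio etaE invf_div.
have m0n : (0 < m <= n)%N by rewrite m0.
have L0 : 0 < ln (1 + eta^-1).
  by rewrite LE; apply: lt_le_trans (logratio_ge R m0n).
have mE : measurable E by apply: measurable_embedding_event; rewrite ?powR_ge0.
split=> //.
have [k [M [kn mM kM kphi cases]]] := exists_sparsity_level
  (sparsity_gt0 r_gt0 ltrp p_lt2) (sparsity_le1 r_gt0 ltrp) m0n.
have /andP[k0 kn'] := kn.
have [low lowT lowF] : exists2 low : bool,
    low -> M = m%:R /\ k%:R <= sparsity p r * m%:R &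
    ~~ low -> kappa (sparsity p r) * m%:R <= logratio R n m.
  by case: cases => h; [exists true|exists false].
apply: (@lt_le_trans _ _ (1 - 2 * expR (- (lower_rate p / 4 * m%:R)))%:E).
  rewrite lte_fin ltrD2l ltrN2 ltr_pM2l// ltr_expR ltrN2 -mulrA etam.
  by rewrite ltr_pM2r//; lra.
apply: (prob_net_good r_gt0 ltrp p_lt2 r_le1 m0 Yunif Yind kn mM kphi lowT mE).
move=> w wc good; split; first exact: wc.
apply: (Wmx_bounds r_gt0 ltrp p_lt2 r_le1 pqr m0 mn k0 kn' mM etaE L0 _ _ _ good).
- by rewrite LE.
- by move=> /lowT[].
- by rewrite LE.
Qed.
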